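(* Let $k$ be a field, let $E=(E_0,E_1,r,s)$ be a finite quiver without sources, let $N=N_E$ be the reduced incidence matrix of $E$ (defined in the context), and let $L(E)$ be the Leavitt path algebra of $E$ over $k$, with its standard $\mathbb{Z}$-grading. For each $i\in E_0\setminus\mathrm{Sink}(E)$ and each $m\ge 1$, let $V_{i,m}$ be the $k$-vector space with basis the closed paths $c$ of length $m$ in $E$ with $s(c)=r(c)=i$. Let the infinite cyclic group $\mathbb{Z}=\langle\sigma\rangle$ act on $$V_m=\bigoplus_{i\in E_0\setminus \mathrm{Sink}(E)}V_{i,m}$$ by rotation of closed paths. Then for all $m\in\mathbb{Z}$ and $n\ge 0$ there are isomorphisms of $k$-vector spaces $${}_mHH_n(L(E))\cong\begin{cases} \operatorname{coker}(1-\sigma:V_{|m|}\to V_{|m|}) & n=0,\ m\neq 0,\\ \operatorname{coker}(1-N^t) & n=m=0,\\ \ker(1-\sigma:V_{|m|}\to V_{|m|}) & n=1,\ m\neq 0,\\ \ker(1-N^t) & n=1,\ m=0,\\ 0 & n\notin\{0,1\},\end{cases}$$ where $1-N^t$ is regarded as a $k$-linear map $k^{e_0-e_0'}\to k^{e_0}$, with $e_0=|E_0|$ and $e_0'=|\mathrm{Sink}(E)|$.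
   Context: All algebras and tensor products are over the field $k$. Quivers: a finite quiver $E=(E_0,E_1,r,s)$ has finite sets $E_0$ of vertices and $E_1$ of arrows, and range and source maps $r,s:E_1\to E_0$. A sink is a vertex that is not the source of any arrow, and $\mathrm{Sink}(E)$ is the set of sinks; a source is a vertex that is not the range of any arrow. Paths $\alpha_1\alpha_2\cdots\alpha_m$ satisfy $r(\alpha_i)=s(\alpha_{i+1})$; a path $c$ is closed if $s(c)=r(c)$. Rotation of closed paths is the cyclic permutation $\alpha_1\alpha_2\cdots\alpha_m\mapsto \alpha_2\cdots\alpha_m\alpha_1$. Leavitt path algebra: let $\hat E$ be the quiver obtained from $E$ by adding, for each $\alpha\in E_1$, an arrow $\alpha^*$ in the opposite direction ($s(\alpha^* )=r(\alpha)$, $r(\alpha^* )=s(\alpha)$). $L(E)$ is the $k$-algebra with generators $p_i$ ($i\in E_0$) and $\alpha\in\hat E_1$, and relations: $p_ip_j=\delta_{i,j}p_i$ ($i,j\in E_0$); $p_{s(\alpha)}\alpha=\alpha=\alpha p_{r(\alpha)}$ ($\alpha\in\hat E_1$); $\alpha^*\beta=\delta_{\alpha,\beta}p_{r(\alpha)}$ ($\alpha,\beta\in E_1$); $p_i=\sum_{\alpha\in E_1,\,s(\alpha)=i}\alpha\alpha^*$ ($i\in E_0\setminus\mathrm{Sink}(E)$). It is $\mathbb{Z}$-graded by $|p_i|=0$, $|\alpha|=1$, $|\alpha^*|=-1$ for $\alpha\in E_1$. Hochschild homology: for a unital $k$-algebra $R$, $HH_n(R)=\mathrm{Tor}_n^{R\otimes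 R^{op}}(R,R)$, computed by the Hochschild complex $HH(R)_n=R\otimes R^{\otimes n}$ with boundary $b(a_0\otimes\cdots\otimes a_n)=\sum_{i=0}^{n-1}(-1)^ia_0\otimes\cdots\otimes a_ia_{i+1}\otimes\cdots\otimes a_n+(-1)^na_na_0\otimes a_1\otimes\cdots\otimes a_{n-1}$. If $R$ is $\mathbb{Z}$-graded, ${}_mHH(R)$ is the subcomplex spanned by the elementary tensors $a_0\otimes\cdots\otimes a_n$ of homogeneous elements with $\sum_i|a_i|=m$, and ${}_mHH_n(R)$ is its $n$-th homology. Matrix: let $e_0=|E_0|$, $e_0'=|\mathrm{Sink}(E)|$, and order $E_0$ so that the first $e_0'$ vertices are the sinks. Let $N_E'=[n_{i,j}]\in M_{e_0}(\mathbb{Z})$ with $n_{i,j}=\#\{\alpha\in E_1: s(\alpha)=i,\ r(\alpha)=j\}$, and let $N_E$ be the $(e_0-e_0')\times e_0$ matrix obtained by deleting the first $e_0'$ rows (which are zero). By abuse of notation $1-N_E^t$ denotes the $e_0\times(e_0-e_0')$ matrix $\begin{pmatrix}0\\ 1_{e_0-e_0'}\end{pmatrix}-N_E^t$. *)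

(* Defs.v *)
From HB Require Import structures.
From mathcomp Require Import all_boot all_order all_algebra.
From mathcomp Require Import ring_quotient zify.
From mathcomp Require Import finmap boolp.
From mathcomp Require Import monalg.

Set Implicit Arguments.
Unset Strict Implicit.
Unset Printing Implicit Defensive.

Import GRing.Theory Num.Theory.
Local Open Scope ring_scope.
Local Open Scope quotient_scope.

Section Span.
Variables (k : fieldType) (V : lmodType k) (G : V -> Prop).

Inductive in_span : V -> Prop :=
| in_span0 : in_span 0
| in_spanS a x y : G x -> in_span y -> in_span (a *: x + y).

Definition span : {pred V} := fun x => `[< in_span x >].

Lemma spanP x : reflect (in_span x) (x \in span).
Proof. exact: asboolP. Qed.

Lemma span_gen x : G x -> x \in span.
Proof.
by move=> Gx; apply/spanP; rewrite -[x]addr0 -[x]scale1r; apply: in_spanS => //;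
  apply: in_span0.
Qed.

Lemma span_submod : submod_closed span.
Proof.
split; first exact/spanP/in_span0.
move=> a x y /spanP sx /spanP sy; apply/spanP.
elim: sx => [|b u v Gu _ IH]; first by rewrite scaler0 add0r.
by rewrite scalerDr scalerA -addrA; apply: in_spanS.
Qed.

HB.instance Definition _ := GRing.isSubmodClosed.Build k V span
  span_submod.

Lemma span_min (S : submodClosed V) :
  (forall x, G x -> x \in S) -> {subset span <= S}.
Proof.
move=> GS x /spanP; elim=> [|a u v Gu _ IH]; first exact: rpred0.
by apply: rpredD => //; apply: rpredZ; apply: GS.
Qed.

End Span.

Section SubSpace.
Variables (k : fieldType) (V : lmodType k) (S : submodClosed V).

Definition vsub : Type := {x : V | x \in S}.
HB.instance Definition _ := SubChoice.on vsub.
HB.instance Definition _ := [SubChoice_isSubLmodule of vsub by <:].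

End SubSpace.

Section QuotSpace.
Variables (k : fieldType) (V : lmodType k) (S : submodClosed V).

(* submodClosed is defined over semirings, hence does not provide closure under
   opposite by itself. *)
Definition zmod_pred : {pred V} := S.
HB.instance Definition _ := GRing.isZmodClosed.Build V zmod_pred
  (submodClosedP S : zmod_closed S).

Definition vquot : Type := @Quotient.quot V zmod_pred.
HB.instance Definition _ := GRing.Zmodule.on vquot.

Definition vproj : V -> vquot := \pi_(@Quotient.quot V zmod_pred).
Definition vrepr : vquot -> V := fun x => repr (x : (@Quotient.quot V zmod_pred)).

Lemma vprojK x : vproj (vrepr x) = x.
Proof. exact: reprK. Qed.

Lemma eq_vproj x y : (vproj x = vproj y) <-> (x - y \in S).
Proof. by rewrite (Quotient.idealrBE zmod_pred); split=> /eqP. Qed.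

Lemma vproj_eq0 x : (vproj x = 0) <-> (x \in S).
Proof. by rewrite -[0](raddf0 (\pi_(@Quotient.quot V zmod_pred))) eq_vproj subr0. Qed.

Lemma vprojD x y : vproj (x + y) = vproj x + vproj y.
Proof. exact: (raddfD (\pi_(@Quotient.quot V zmod_pred))). Qed.

Definition vscale (a : k) (x : vquot) : vquot := vproj (a *: vrepr x).

Lemma vprojZ a x : vproj (a *: x) = vscale a (vproj x).
Proof.
by apply/eq_vproj; rewrite -scalerBr rpredZ //; apply/eq_vproj; rewrite vprojK.
Qed.

Fact vscaleA a b x : vscale a (vscale b x) = vscale (a * b) x.
Proof. by rewrite -[x]vprojK -!vprojZ scalerA. Qed.
Fact vscale1 : left_id 1 vscale.
Proof. by move=> x; rewrite -[x]vprojK -vprojZ scale1r. Qed.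
Fact vscaleDr : right_distributive vscale +%R.
Proof.
move=> a x y; rewrite -[x]vprojK -[y]vprojK -vprojD -!vprojZ -vprojD.
by rewrite scalerDr.
Qed.
Fact vscaleDl x : {morph vscale^~ x : a b / a + b}.
Proof. by move=> a b; rewrite -[x]vprojK -!vprojZ -vprojD scalerDl. Qed.

HB.instance Definition _ := GRing.Zmodule_isLmodule.Build k vquot
  vscaleA vscale1 vscaleDr vscaleDl.

Fact vproj_linear : linear vproj.
Proof. by move=> a x y; rewrite vprojD vprojZ. Qed.
HB.instance Definition _ := GRing.isLinear.Build k V vquot _ vproj vproj_linear.

End QuotSpace.

Section KerCoker.
Variables (k : fieldType) (U V : lmodType k) (f : {linear U -> V}).

Definition ker_pred : {pred U} := [pred x | f x == 0].
Definition im_pred : {pred V} := fun y => `[< exists x, y = f x >].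

Fact ker_submod : submod_closed ker_pred.
Proof.
split=> [|a x y]; rewrite !inE ?linear0 //.
by move=> /eqP fx /eqP fy; rewrite linearP fx fy scaler0 addr0.
Qed.
HB.instance Definition _ := GRing.isSubmodClosed.Build k U ker_pred
  ker_submod.

Fact im_submod : submod_closed im_pred.
Proof.
split=> [|a x y]; first by apply/asboolP; exists 0; rewrite linear0.
move=> /asboolP[u ->] /asboolP[v ->]; apply/asboolP.
by exists (a *: u + v); rewrite linearP.
Qed.
HB.instance Definition _ := GRing.isSubmodClosed.Build k V im_pred
  im_submod.

Definition kernel : lmodType k := vsub ker_pred.
Definition coker : lmodType k := vquot im_pred.

End KerCoker.

Section SubImage.
Variables (k : fieldType) (U V : lmodType k) (f : {linear U -> V}).
Variables (S : submodClosed U) (T : submodClosed V).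

Definition sub_im : {pred vsub T} :=
  fun z => `[< exists2 y : U, y \in S & val z = f y >].

Fact sub_im_submod : submod_closed sub_im.
Proof.
split=> [|a x y].
  by apply/asboolP; exists 0; rewrite ?rpred0 // !linear0.
move=> /asboolP[u gu eu] /asboolP[v gv ev]; apply/asboolP.
exists (a *: u + v); first by rewrite rpredD ?rpredZ.
by rewrite linearP -eu -ev [LHS]linearP.
Qed.
HB.instance Definition _ := GRing.isSubmodClosed.Build k (vsub T)
  sub_im sub_im_submod.

End SubImage.
Arguments sub_im {k U V} f S T _.

Definition lmod_iso (k : fieldType) (U V : lmodType k) : Prop :=
  exists f : {linear U -> V}, bijective f.

(* Linear extension of a function on a basis: {malg k[T]} is the k-vector space
   with basis T, and << t >> is the basis vector of t. *)
Section FreeSpace.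
Variables (k : fieldType) (T : choiceType) (W : lmodType k) (h : T -> W).
Implicit Types g : {malg k[T]}.

Definition free_ext g : W := \sum_(t <- msupp g) g@_t *: h t.

Lemma free_extw (d : {fset T}) g : (msupp g `<=` d)%fset ->
  free_ext g = \sum_(t <- d) g@_t *: h t.
Proof.
move=> le; rewrite /free_ext (big_fset_incl _ le) //= => t _ /mcoeff_outdom ->.
by rewrite scale0r.
Qed.

Fact free_ext_linear : linear free_ext.
Proof.
move=> a x y.
pose d := (msupp (a *: x + y) `|` (msupp x `|` msupp y))%fset.
rewrite !(@free_extw d); last first.
- exact: fsubsetUl.
- by rewrite /d fsetUA fsetUAC fsubsetUr.
- by rewrite /d fsetUA fsubsetUr.
rewrite scaler_sumr -big_split; apply: eq_bigr => t _ /=.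
by rewrite mcoeffD mcoeffZ scalerDl scalerA.
Qed.
HB.instance Definition _ :=
  GRing.isLinear.Build k {malg k[T]} W _ free_ext free_ext_linear.

Lemma free_extU t : free_ext << t >> = h t.
Proof.
by rewrite (@free_extw [fset t]%fset) ?msuppU_le // big_seq_fset1 mcoeffUU scale1r.
Qed.

End FreeSpace.

(* MathComp's algType requires 1 != 0, but the Leavitt path algebra of the
   quiver without vertices is zero. *)
Record pzAlg (k : fieldType) := PzAlg {
  pz_space :> lmodType k;
  pz_one : pz_space;
  pz_mul : pz_space -> pz_space -> pz_space;
  pz_mulA : associative pz_mul;
  pz_mul1l : left_id pz_one pz_mul;
  pz_mul1r : right_id pz_one pz_mul;
  pz_mul_linl : forall y, linear (pz_mul^~ y);
  pz_mul_linr : forall x, linear (pz_mul x)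
}.

Arguments pz_one {k p}.
Arguments pz_mul {k p} x y : rename.

Section FreeAlgebra.
Variables (k : fieldType) (X : choiceType).

Definition free_alg : Type := {malg k[{fmonom X}]}.
HB.instance Definition _ := GRing.Lalgebra.on free_alg.

Fact malg_scalerAr (a : k) (x y : {malg k[{fmonom X}]}) :
  a *: (x * y) = x * (a *: y).
Proof.
have C (z : {malg k[{fmonom X}]}) : a%:MP * z = z * a%:MP.
  rewrite !malgM_def fgmulUg fgmulgU; apply: eq_bigr => m _.
  by rewrite mulrC mul1m mulm1.
by rewrite -!mul_malgC mulrA C mulrA.
Qed.
HB.instance Definition _ :=
  GRing.Lalgebra_isAlgebra.Build k free_alg malg_scalerAr.

Definition free_word (w : {fmonom X}) : free_alg := << w >>.
Definition free_gen (x : X) : free_alg := free_word (fmu x).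

End FreeAlgebra.

Section AlgQuotient.
Variables (k : fieldType) (A : algType k) (G : A -> Prop).

Definition ideal_gen : {pred A} :=
  span (fun x => exists a g b, G g /\ x = a * g * b).
HB.instance Definition _ := GRing.SubmodClosed.on ideal_gen.

Lemma ideal_genM a b x : x \in ideal_gen -> a * x * b \in ideal_gen.
Proof.
move=> /spanP; elim=> [|c u v [p [g [q [Gg ->]]]] _ IH].
  by rewrite mulr0 mul0r; exact: rpred0.
rewrite mulrDr mulrDl -scalerAr -scalerAl; apply: rpredD => //.
apply: rpredZ; apply: span_gen; exists (a * p), g, (q * b); split=> //.
by rewrite !mulrA.
Qed.

Local Notation Q := (vquot ideal_gen).
Local Notation pi := (@vproj k A ideal_gen).

Definition quot_mul (x y : Q) : Q := pi (vrepr x * vrepr y).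

Lemma quot_mulE x y : quot_mul (pi x) (pi y) = pi (x * y).
Proof.
have I z : z - vrepr (pi z) \in ideal_gen by apply/eq_vproj; rewrite vprojK.
apply/esym/eq_vproj.
rewrite -(subrKA (vrepr (pi x) * y)) -mulrBl -mulrBr; apply: rpredD.
  by rewrite -[_ - _]mul1r ideal_genM.
by rewrite -[_ * _]mulr1 ideal_genM.
Qed.

Fact quot_mulA : associative quot_mul.
Proof.
move=> x y z; rewrite -[x]vprojK -[y]vprojK -[z]vprojK.
by rewrite !quot_mulE mulrA.
Qed.
Fact quot_mul1l : left_id (pi 1) quot_mul.
Proof. by move=> x; rewrite -[x]vprojK quot_mulE mul1r. Qed.
Fact quot_mul1r : right_id (pi 1) quot_mul.
Proof. by move=> x; rewrite -[x]vprojK quot_mulE mulr1. Qed.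
Fact quot_mul_linl y : linear (quot_mul^~ y).
Proof.
move=> a u v; rewrite -[u]vprojK -[v]vprojK -[y]vprojK -linearP.
by rewrite !quot_mulE mulrDl -scalerAl linearP.
Qed.
Fact quot_mul_linr x : linear (quot_mul x).
Proof.
move=> a u v; rewrite -[u]vprojK -[v]vprojK -[x]vprojK -linearP.
by rewrite !quot_mulE mulrDr -scalerAr linearP.
Qed.

Definition alg_quot : pzAlg k :=
  PzAlg quot_mulA quot_mul1l quot_mul1r quot_mul_linl quot_mul_linr.

Definition alg_proj (x : A) : alg_quot := pi x.

End AlgQuotient.

Section TensorPower.
Variables (k : fieldType) (V : lmodType k).

Definition upd n (a : {ffun 'I_n -> V}) (i : 'I_n) (x : V) : {ffun 'I_n -> V} :=
  [ffun j => if j == i then x else a j].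

Definition multilinear n (W : lmodType k) (h : {ffun 'I_n -> V} -> W) : Prop :=
  forall a i (c : k) x y,
    h (upd a i (c *: x + y)) = c *: h (upd a i x) + h (upd a i y).

Section MultilinearOps.
Variables (n : nat) (W : lmodType k).
Implicit Types h : {ffun 'I_n -> V} -> W.

Lemma multilinearD h1 h2 : multilinear h1 -> multilinear h2 ->
  multilinear (fun a => h1 a + h2 a).
Proof. by move=> H1 H2 a i c x y; rewrite H1 H2 scalerDr addrACA. Qed.

Lemma multilinearZ (b : k) h : multilinear h -> multilinear (fun a => b *: h a).
Proof.
by move=> H a i c x y; rewrite H scalerDr !scalerA [b * c]mulrC.
Qed.

Lemma multilinear_sum (I : finType) (h : I -> {ffun 'I_n -> V} -> W) :
  (forall j, multilinear (h j)) -> multilinear (fun a => \sum_j h j a).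
Proof.
move=> H a i c x y; rewrite scaler_sumr -big_split.
by apply: eq_bigr => j _; rewrite H.
Qed.

End MultilinearOps.

Definition multilinear_rel n (z : {malg k[{ffun 'I_n -> V}]}) : Prop :=
  exists a i (c : k) x y, z =
    << upd a i (c *: x + y) >> - (c *: << upd a i x >> + << upd a i y >>).

Definition tpow n : lmodType k := vquot (span (@multilinear_rel n)).

Definition tens n (a : {ffun 'I_n -> V}) : tpow n := vproj _ << a >>.

Lemma tens_multilinear n : multilinear (@tens n).
Proof.
move=> a i c x y; rewrite /tens -linearP; apply/eq_vproj/span_gen.
by exists a, i, c, x, y.
Qed.

Section Lift.
Variables (n : nat) (W : lmodType k) (h : {ffun 'I_n -> V} -> W).

Definition tlift (x : tpow n) : W := free_ext h (vrepr x).

Hypothesis h_lin : multilinear h.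

Lemma tliftE g : tlift (vproj _ g) = free_ext h g.
Proof.
suff K z : z \in span (@multilinear_rel n) -> free_ext h z = 0.
  apply/eqP; rewrite -subr_eq0 -linearB; apply/eqP/K/eq_vproj.
  by rewrite vprojK.
have := @span_min k _ (@multilinear_rel n)
  (ker_pred (free_ext h) : submodClosed _) _ z.
move=> + zS => /(_ _ zS) H; apply/eqP; apply: H => _ [a [i [c [x [y ->]]]]].
by rewrite inE linearB linearP /= !free_extU h_lin subrr.
Qed.

Lemma tlift_tens a : tlift (tens a) = h a.
Proof. by rewrite tliftE free_extU. Qed.

Lemma tlift_linear : linear tlift.
Proof.
by move=> a x y; rewrite -[x]vprojK -[y]vprojK -linearP !tliftE linearP.
Qed.

End Lift.
End TensorPower.

Section Hochschild.
Variables (k : fieldType) (R : pzAlg k).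

Definition hh_chain n : lmodType k := tpow R n.+1.

(* (a_0, ..., a_{n+1}) |-> (a_0, ..., a_i a_{i+1}, ..., a_{n+1}), for i <= n *)
Definition hface n (i : 'I_n.+1) (a : {ffun 'I_n.+2 -> R}) :
    {ffun 'I_n.+1 -> R} :=
  [ffun j : 'I_n.+1 =>
     let aj := a (widen_ord (leqnSn n.+1) j) in
     let aj1 := a (lift ord0 j) in
     if (j < i)%N then aj else if j == i then pz_mul aj aj1 else aj1].

(* (a_0, ..., a_{n+1}) |-> (a_{n+1} a_0, a_1, ..., a_n) *)
Definition hface_last n (a : {ffun 'I_n.+2 -> R}) : {ffun 'I_n.+1 -> R} :=
  [ffun j : 'I_n.+1 => if j == ord0 then pz_mul (a ord_max) (a ord0)
                       else a (widen_ord (leqnSn n.+1) j)].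

Definition hh_bd_tens n (a : {ffun 'I_n.+2 -> R}) : hh_chain n :=
  \sum_(i < n.+1) (-1) ^+ i *: tens (hface i a)
  + (-1) ^+ n.+1 *: tens (hface_last a).

Fact hface_multilinear n (i : 'I_n.+1) : multilinear (fun a => tens (hface i a)).
Proof.
move=> a l c x y.
pose P (f : R -> R) (j : 'I_n.+1) :=
  (forall z, hface i (upd a l z) = upd (hface i (upd a l 0)) j (f z)) /\ linear f.
suff [f [j [Hf lf]]] : exists f j, P f j.
  by rewrite (Hf (c *: x + y)) (Hf x) (Hf y) lf tens_multilinear.
have vW (j : 'I_n.+1) : (widen_ord (leqnSn n.+1) j == l) = (j == l :> nat) by [].
have vL (j : 'I_n.+1) : (lift ord0 j == l) = (j.+1 == l :> nat).
  by rewrite -val_eqE.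
have [li|il] := ltnP l i.
  exists id, (Ordinal (ltn_trans li (ltn_ord i))); split=> // z.
  apply/ffunP => j; rewrite !ffunE vW vL -[j == Ordinal _]val_eqE /=.
  case: (ltngtP j i) => [ji|ij|/val_inj ->]; rewrite ?eqxx.
  - by case: eqP.
  - have /negbTE -> : j.+1 != l by lia.
    have /negbTE -> : j != l :> nat by lia.
    by case: (j == i).
  - have /negbTE -> : i.+1 != l by lia.
    by have /negbTE -> : i != l :> nat by lia.
have [{il}il|] := ltnP i l; last first.
  move=> li; have e : l = i :> nat by apply/eqP; rewrite eqn_leq li il.
  exists (pz_mul^~ (a (lift ord0 i))), i; split; last exact: pz_mul_linl.
  move=> z; apply/ffunP => j; rewrite !ffunE vW vL e -[j == i]val_eqE.
  case: (ltngtP j i) => [ji|ij|/val_inj ->] //.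
    by have /negbTE -> : j.+1 != i by lia.
  by have /negbTE -> : i.+1 != i by lia.
have l0 : (l.-1 < n.+1)%N by case: l il {P vW vL} => -[|m].
have eL : l.-1.+1 = l by apply: prednK; apply: leq_ltn_trans il.
have [il1|] := ltnP i.+1 l; last first.
  move=> li; have e : l = i.+1 :> nat by apply/eqP; rewrite eqn_leq li il.
  exists (pz_mul (a (widen_ord (leqnSn n.+1) i))), i; split; last exact: pz_mul_linr.
  move=> z; apply/ffunP => j; rewrite !ffunE vW vL e eqSS -[j == i]val_eqE.
  case: (ltngtP j i) => [ji|ij|/val_inj ->] //.
    by have /negbTE -> : j != i.+1 :> nat by lia.
  by have /negbTE -> : i != i.+1 :> nat by lia.
exists id, (Ordinal l0); split=> // z.
apply/ffunP => j; rewrite !ffunE vW vL -[j == Ordinal _]val_eqE /=.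
have -> : (j == l.-1 :> nat) = (j.+1 == l) by rewrite -eqSS eL.
rewrite -[j == i]val_eqE.
case: (ltngtP j i) => [ji|ij|/val_inj ->].
- have /negbTE -> : j != l :> nat by lia.
  by have /negbTE -> : j.+1 != l :> nat by lia.
- by case: eqP.
- have /negbTE -> : i != l :> nat by lia.
  by have /negbTE -> : i.+1 != l :> nat by lia.
Qed.

Fact hface_last_multilinear n : multilinear (fun a => tens (@hface_last n a)).
Proof.
move=> a l c x y.
pose P (f : R -> R) (j : 'I_n.+1) :=
  (forall z, hface_last (upd a l z) = upd (hface_last (upd a l 0)) j (f z))
  /\ linear f.
suff [f [j [Hf lf]]] : exists f j, P f j.
  by rewrite (Hf (c *: x + y)) (Hf x) (Hf y) lf tens_multilinear.
have vW (j : 'I_n.+1) : (widen_ord (leqnSn n.+1) j == l) = (j == l :> nat) by [].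
have vM : (ord_max == l) = (n.+1 == l :> nat) by [].
have v0 : (ord0 == l) = (0%N == l :> nat) by [].
have [l0|l0] := eqVneq (l : nat) 0%N.
  exists (pz_mul (a ord_max)), ord0; split; last exact: pz_mul_linr.
  move=> z; apply/ffunP => j; rewrite !ffunE vW vM v0 l0.
  have [//|j0] := eqVneq j ord0.
  by have /negbTE -> : j != 0%N :> nat by [].
have [lm|lm] := eqVneq (l : nat) n.+1.
  exists (pz_mul^~ (a ord0)), ord0; split; last exact: pz_mul_linl.
  move=> z; apply/ffunP => j; rewrite !ffunE vW vM v0 lm eqxx.
  have [//|j0] := eqVneq j ord0.
  by have /negbTE -> : j != n.+1 :> nat by have := ltn_ord j; lia.
have ln : (l < n.+1)%N by have := ltn_ord l; lia.
exists id, (Ordinal ln); split=> // z.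
apply/ffunP => j; rewrite !ffunE vW vM v0 -[j == Ordinal _]val_eqE /=.
have /negbTE -> : n.+1 != l by lia.
have /negbTE -> : 0%N != l by lia.
have [->|j0] := eqVneq j ord0; last by case: eqP.
by have /negbTE -> : (ord0 : 'I_n.+1) != l :> nat by rewrite /=; lia.
Qed.

Fact hh_bd_multilinear n : multilinear (@hh_bd_tens n).
Proof.
apply: multilinearD; last exact/multilinearZ/hface_last_multilinear.
by apply: multilinear_sum => i; apply/multilinearZ/hface_multilinear.
Qed.

Definition hh_bd n : hh_chain n.+1 -> hh_chain n := tlift (@hh_bd_tens n).
HB.instance Definition _ n := GRing.isLinear.Build k (hh_chain n.+1) (hh_chain n)
  _ (@hh_bd n) (tlift_linear (@hh_bd_multilinear n)).

Lemma hh_bdE n a : hh_bd (tens a) = hh_bd_tens a :> hh_chain n.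
Proof. exact: tlift_tens (@hh_bd_multilinear n) a. Qed.

Section Graded.
(* [deg d x] : x is homogeneous of degree d *)
Variables (deg : int -> R -> Prop) (m : int).

Definition hh_gr n : {pred hh_chain n} :=
  span (fun x => exists (a : {ffun 'I_n.+1 -> R}) (d : 'I_n.+1 -> int),
    [/\ forall i, deg (d i) (a i), \sum_i d i = m & x = tens a]).
HB.instance Definition _ n := GRing.SubmodClosed.on (@hh_gr n).

Definition is_cycle n : {pred hh_chain n} :=
  match n with 0 => predT | n'.+1 => ker_pred (@hh_bd n') end.

Fact is_cycle_submod n : submod_closed (@is_cycle n).
Proof. by case: n => [|n]; [split | exact: ker_submod]. Qed.

Definition gr_cycle n : {pred hh_chain n} :=
  [predI @hh_gr n & @is_cycle n].

Fact gr_cycle_submod n : submod_closed (@gr_cycle n).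
Proof.
have [c0 cD] := is_cycle_submod n.
have [g0 gD] := submodClosedP (@hh_gr n).
split=> [|a x y]; first by apply/andP.
by move=> /andP[gx cx] /andP[gy cy]; apply/andP; split; [apply: gD | apply: cD].
Qed.
HB.instance Definition _ n := GRing.isSubmodClosed.Build k (hh_chain n)
  (@gr_cycle n) (@gr_cycle_submod n).

Definition gr_bound n : {pred vsub (@gr_cycle n)} :=
  sub_im (@hh_bd n) (@hh_gr n.+1) (@gr_cycle n).
HB.instance Definition _ n := GRing.SubmodClosed.on (@gr_bound n).

(* _mHH_n(R), the n-th homology of the subcomplex hh_gr of total degree m *)
Definition HH n : lmodType k := vquot (@gr_bound n).

End Graded.
End Hochschild.

Record quiver := Quiver {
  vertex : finType;
  arrow : finType;
  range : arrow -> vertex;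
  source : arrow -> vertex
}.

Definition sink (E : quiver) : {set vertex E} :=
  [set i | [forall a : arrow E, source a != i]].

Definition no_sources (E : quiver) : Prop :=
  forall i : vertex E, exists a : arrow E, range a = i.

Section Leavitt.
Variables (k : fieldType) (E : quiver).

(* The arrows of the doubled quiver: [inl a] is a and [inr a] is a^*. *)
Definition darrow : Type := (arrow E + arrow E)%type.
HB.instance Definition _ := Finite.on darrow.

Definition dsource (x : darrow) : vertex E :=
  match x with inl a => source a | inr a => range a end.
Definition drange (x : darrow) : vertex E :=
  match x with inl a => range a | inr a => source a end.

Definition lgen : Type := (vertex E + darrow)%type.
HB.instance Definition _ := Finite.on lgen.

Definition lgen_deg (x : lgen) : int :=
  match x with inl _ => 0 | inr (inl _) => 1 | inr (inr _) => -1 end.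

Local Notation lfree := (free_alg k lgen).

Definition lf_p (i : vertex E) : lfree := free_gen k (inl i : lgen).
Definition lf_d (x : darrow) : lfree := free_gen k (inr x : lgen).
Definition lf_a (a : arrow E) : lfree := lf_d (inl a).
Definition lf_s (a : arrow E) : lfree := lf_d (inr a).

(* [z] is a relator, i.e. z = 0 is one of the defining relations. The last one
   makes 1 = sum_i p_i, the unit of the algebra presented by the other
   relations as a non-unital algebra; inside the unital free algebra it has to
   be imposed. *)
Inductive leavitt_rel : lfree -> Prop :=
| rel_pp i j : leavitt_rel (lf_p i * lf_p j - (i == j)%:R *: lf_p i)
| rel_sp x : leavitt_rel (lf_p (dsource x) * lf_d x - lf_d x)
| rel_pr x : leavitt_rel (lf_d x * lf_p (drange x) - lf_d x)
| rel_ck1 a b : leavitt_rel (lf_s a * lf_a b - (a == b)%:R *: lf_p (range a))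
| rel_ck2 i : i \notin sink E ->
    leavitt_rel (lf_p i - \sum_(a : arrow E | source a == i) lf_a a * lf_s a)
| rel_unit : leavitt_rel (1 - \sum_(i : vertex E) lf_p i).

Definition leavitt : pzAlg k := alg_quot leavitt_rel.

Definition word_deg (w : {fmonom lgen}) : int := \sum_(x <- w) lgen_deg x.

(* The homogeneous component of degree d is spanned by the classes of the words
   of degree d in the generators. *)
Definition leavitt_deg (d : int) (x : leavitt) : Prop :=
  x \in span (fun y => exists2 w : {fmonom lgen},
    word_deg w = d & y = alg_proj leavitt_rel (free_word k w)).

End Leavitt.

Section ClosedPaths.
Variables (k : fieldType) (E : quiver) (m : nat).

Definition closed_path_at (i : vertex E) (c : seq (arrow E)) : bool :=
  if c is a :: c' then
    [&& path (fun x y => range x == source y) a c', source a == i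
      & range (last a c') == i]
  else false.

(* The disjoint union over i, not a sink, of the sets of closed paths of length
   m based at i. It is the basis of V_m, the direct sum of the V_{i,m}. *)
Definition cpath_pred (c : m.-tuple (arrow E)) : bool :=
  [exists i, (i \notin sink E) && closed_path_at i c].

Definition cpath : Type := {c : m.-tuple (arrow E) | cpath_pred c}.
HB.instance Definition _ := SubFinite.on cpath.

Lemma rot_cpath (c : m.-tuple (arrow E)) :
  cpath_pred c -> cpath_pred [tuple of rot 1 c].
Proof.
have nsink a : source a \notin sink E.
  by rewrite inE negb_forall; apply/existsP; exists a; rewrite eqxx.
move=> /existsP[i /andP[_]]; rewrite /cpath_pred /=.
case: (tval c) => [|a [|b c']] //=.
  case/andP=> /eqP sa /eqP ra; apply/existsP; exists (source a).
  by rewrite nsink /= ra sa !eqxx.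
case/and3P=> /andP[/eqP ab bc] /eqP sa /eqP rc; apply/existsP; exists (source b).
rewrite nsink /= cats1 rcons_path last_rcons bc rc sa ab.
by rewrite !eqxx.
Qed.

Definition rotate (c : cpath) : cpath :=
  exist (fun d : m.-tuple (arrow E) => cpath_pred d) _ (rot_cpath (valP c)).

Definition Vspace : lmodType k := {malg k[cpath]}.

Definition sigma : Vspace -> Vspace :=
  free_ext (fun c => << rotate c >> : Vspace).
HB.instance Definition _ := GRing.Linear.on sigma.

Definition one_minus_sigma : {linear Vspace -> Vspace} := idfun \- sigma.

End ClosedPaths.

Section Incidence.
Variables (k : fieldType) (E : quiver).

Definition n_sink : nat := #|sink E|.
Definition n_nonsink : nat := #|~: sink E|.

(* The sinks come first, so that incidence below drops their rows. *)
Definition vertex_of (i : 'I_(n_sink + n_nonsink)) : vertex E :=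
  match split i with inl j => enum_val j | inr j => enum_val j end.

Definition full_incidence : 'M[int]_(n_sink + n_nonsink) :=
  \matrix_(i, j) #|[set a : arrow E | (source a == vertex_of i)
                                      && (range a == vertex_of j)]|%:Z.

Definition incidence : 'M[int]_(n_nonsink, n_sink + n_nonsink) := dsubmx full_incidence.

Definition one_minus_Nt : 'M[int]_(n_sink + n_nonsink, n_nonsink) :=
  col_mx 0 1%:M - incidence^T.

Definition one_minus_Nt_map : {linear 'cV[k]_n_nonsink -> 'cV[k]_(n_sink + n_nonsink)} :=
  mulmx (map_mx intr one_minus_Nt).

End Incidence.

(* Main.v *)
From HB Require Import structures.
From mathcomp Require Import all_boot all_order all_algebra.
From mathcomp Require Import zify ring_quotient finmap boolp monalg.
Require Import Defs.

(** The Leavitt path algebra L of E has a bimodule resolution of length one,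
    relative to the semisimple subalgebra spanned by the vertices p_i:

      0 -> sum_a L p_(s a) (x) p_(r a) L -> sum_i L p_i (x) p_i L -> L -> 0 .

    It comes from a derivation [delta : L -> L (x) L (x) L] into the bar complex,
    with delta p_i = 0, delta a = p_(s a) (x) a (x) p_(r a), and hence, by the
    relations a^* b = 0 or p_(r a), delta a^* = - sum_b a^* (x) b (x) b^* over the
    arrows b with the source of a.  With the separability idempotent
    e = sum_i p_i (x) p_i, the boundary of delta x is x e - e x.  From e and delta
    alone one gets a bimodule endomorphism [rproj] of the bar complex, x (x) y |->
    x e y in degree 0, x (x) a (x) y |-> x (delta a) y in degree 1 and 0 above, and
    a bimodule homotopy from it to the identity ([homotopy0], [homotopyS]), which
    descends to the Hochschild complex ([hh_homotopy0], [hh_homotopyS]).  So the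
    Hochschild homology vanishes from degree 2 on, and in degrees 0 and 1 it is
    computed by the image of the projection.

    That image is explicit.  Let D be the sum of the corners p_i L p_i and D' its
    part over the vertices that are not sinks.  In degree 0 the image is D.  In
    degree 1, the map z |-> sum_a a^* z (x) a ([cycle_lift]) identifies D' with it,
    the inverse being x (x) a |-> a x ([hh_proj_normal], [swap_mul_lift],
    [hh_proj_lift]), and the boundary becomes z |-> psi z - z with
    psi z = sum_a a^* z a ([cycle_shift], [hh_bd_cycle_lift]).  Hence HH_0 and HH_1
    are the cokernel and the kernel of 1 - psi : D' -> D, degree by degree.

    The degree m part of L is spanned by the monomials u p_i v^* with
    |u| - |v| = m, filtered by min (|u|, |v|), and psi strips one arrow from u and
    one from v, so it lowers the filtration as long as it can
    ([cycle_shift_Fil]).  A solution of z = y + psi z with y in the lowest layer is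
    therefore in the lowest layer itself ([fixed_Fil0]), and each y in D is
    congruent to an element of the lowest layer modulo the image of 1 - psi
    ([coker_Fil0]): kernel and cokernel may be computed in the lowest layer.

    For m > 0 the lowest layer of D is spanned by the closed paths of length m,
    for m < 0 by the duals of those of length -m, and psi rotates them; no sink
    lies on a closed path, so the layer is contained in D'.  For m = 0 it is spanned by
    the p_i, and psi p_i is the sum of the ranges of the arrows leaving i, which
    is the transposed incidence matrix.  These spanning sets are linearly
    independent because c^* c' = 0 or p_(r c) for paths of the same length, and
    because no p_i vanishes, as a representation of L shows
    ([vertex_class_neq0]). *)

Set Implicit Arguments.
Unset Strict Implicit.
Unset Printing Implicit Defensive.

Import GRing.Theory Num.Theory.
Local Open Scope ring_scope.

(** * Linear maps, spans and isomorphisms *)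

Section LinearAlgebra.
Variable k : fieldType.

Section Unbundled.
Variables (V W : lmodType k) (f : V -> W).
Hypothesis lf : linear f.

Lemma lin0 : f 0 = 0.
Proof. by have /= := lf (-1) 0 0; rewrite scaler0 addr0 scaleN1r addNr. Qed.

Lemma linD x y : f (x + y) = f x + f y.
Proof. by have := lf 1 x y; rewrite !scale1r. Qed.

Lemma linZ a x : f (a *: x) = a *: f x.
Proof. by have := lf a x 0; rewrite lin0 !addr0. Qed.

Lemma linN x : f (- x) = - f x.
Proof. by rewrite -scaleN1r linZ scaleN1r. Qed.

Lemma linB x y : f (x - y) = f x - f y.
Proof. by rewrite linD linN. Qed.

Lemma lin_sum (I : Type) (r : seq I) (P : pred I) F :
  f (\sum_(i <- r | P i) F i) = \sum_(i <- r | P i) f (F i).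
Proof.
by elim/big_ind2: _ => [|_ x _ y <- <-|//]; rewrite ?lin0 ?linD.
Qed.

End Unbundled.

Lemma linear_comb (V W : lmodType k) (f g : V -> W) (c : k) :
  linear f -> linear g -> linear (fun x => f x + c *: g x).
Proof.
move=> lf lg a x y; rewrite lf lg !scalerDr !scalerA [c * a]mulrC.
exact: addrACA.
Qed.

Lemma linear_sub (V W : lmodType k) (f g : V -> W) :
  linear f -> linear g -> linear (fun x => f x - g x).
Proof. by move=> lf lg a x y; rewrite lf lg scalerBr opprD addrACA. Qed.

Lemma linear_compose (U V W : lmodType k) (f : V -> W) (g : U -> V) :
  linear f -> linear g -> linear (fun x => f (g x)).
Proof. by move=> lf lg a x y; rewrite lg lf. Qed.

Lemma span_map (V W : lmodType k) (G : V -> Prop) (f : V -> W)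
    (S : submodClosed W) : linear f ->
  (forall x, G x -> f x \in S) -> forall x, x \in span G -> f x \in S.
Proof.
move=> lf fG x /spanP; elim=> [|a u v Gu _ IH].
  by rewrite (lin0 lf) rpred0.
by rewrite lf rpredD // rpredZ // fG.
Qed.

Lemma span_eq (V W : lmodType k) (G : V -> Prop) (f g : V -> W) :
  linear f -> linear g -> (forall x, G x -> f x = g x) ->
  forall x, x \in span G -> f x = g x.
Proof.
move=> lf lg fg x /spanP; elim=> [|a u v Gu _ IH]; last first.
  by rewrite lf lg IH fg.
by rewrite (lin0 lf) (lin0 lg).
Qed.

Lemma malg_span (T : choiceType) (x : {malg k[T]}) :
  x \in span (fun y => exists t, y = << t >>).
Proof.
rewrite (monalgE x); apply: rpred_sum => t _.
have -> : << x@_t *g t >> = x@_t *: << t >> :> {malg k[T]}.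
  by apply/malgP => u; rewrite mcoeffZ !mcoeffU mulrnAr mulr1.
by apply/rpredZ/span_gen; exists t.
Qed.

Lemma malg_eq (T : choiceType) (W : lmodType k) (f g : {malg k[T]} -> W) :
  linear f -> linear g -> (forall t, f << t >> = g << t >>) -> f =1 g.
Proof.
move=> lf lg fg x; apply: (span_eq lf lg) (malg_span x) => y [t ->].
exact: fg.
Qed.

Lemma lmod_iso_quot (V W : lmodType k) (S : submodClosed V) (g : {linear V -> W}) :
  (forall v, (g v == 0) = (v \in S)) -> (forall w, exists v, w = g v) ->
  lmod_iso W (vquot S).
Proof.
move=> gS gsurj.
pose h w : vquot S := vproj S (projT1 (cid (gsurj w))).
have hg v : h (g v) = vproj S v.
  rewrite /h; case: cid => u /= e; apply/eq_vproj.
  by rewrite -gS linearB -e subrr.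
have lh : linear h.
  move=> a x y; have [u ->] := gsurj x; have [v ->] := gsurj y.
  by rewrite -linearP !hg linearP.
pose hL : {linear W -> vquot S} :=
  HB.pack h (GRing.isLinear.Build k W (vquot S) _ h lh).
exists hL; exists (fun x => g (vrepr x)) => [w|x] /=; last first.
  by rewrite hg vprojK.
have [v ->] := gsurj w; rewrite hg; apply/eqP.
by rewrite -subr_eq0 -linearB gS; apply/eq_vproj; rewrite vprojK.
Qed.

Lemma lmod_iso_inv (V W : lmodType k) (g : {linear V -> W}) :
  (forall v, g v = 0 -> v = 0) -> (forall w, exists v, w = g v) ->
  lmod_iso W V.
Proof.
move=> ginj gsurj.
pose h w : V := projT1 (cid (gsurj w)).
have hK w : g (h w) = w by rewrite /h; case: cid.
have inj u v : g u = g v -> u = v.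
  by move=> e; apply/subr0_eq/ginj; rewrite linearB e subrr.
have lh : linear h.
  by move=> a x y; apply: inj; rewrite linearP !hK.
pose hL : {linear W -> V} := HB.pack h (GRing.isLinear.Build k W V _ h lh).
by exists hL; exists g => [w|v]; [exact: hK | apply: inj; exact: hK].
Qed.

End LinearAlgebra.

Section Tensors.
Variables (k : fieldType) (V : lmodType k).

(** The basis vectors generate the free space of which [tpow] is a quotient.
    Through [tpow_eq] this reduces identities between linear maps to elementary
    tensors. *)
Lemma tpow_span n (x : tpow V n) : x \in span (fun y => exists a, y = tens a).
Proof.
rewrite -[x]vprojK.
apply: (span_map (f := vproj _)) (malg_span _); first exact: vproj_linear.
by move=> y [a ->]; apply: span_gen; exists a.
Qed.

Lemma tpow_eq n (W : lmodType k) (f g : tpow V n -> W) :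
  linear f -> linear g -> (forall a, f (tens a) = g (tens a)) -> f =1 g.
Proof.
move=> lf lg fg x; apply: (span_eq lf lg) (tpow_span x) => y [a ->].
exact: fg.
Qed.

Lemma upd_upd n (a : {ffun 'I_n -> V}) i x y : upd (upd a i x) i y = upd a i y.
Proof. by apply/ffunP => j; rewrite !ffunE; case: eqP. Qed.

Lemma updC n (a : {ffun 'I_n -> V}) i j x y : i != j ->
  upd (upd a i x) j y = upd (upd a j y) i x.
Proof.
move=> ij; apply/ffunP => l; rewrite !ffunE.
by have [->|] := eqVneq l j; rewrite // eq_sym (negbTE ij).
Qed.

Lemma upd_id n (a : {ffun 'I_n -> V}) i : upd a i (a i) = a.
Proof. by apply/ffunP => j; rewrite !ffunE; case: eqP => // ->. Qed.

(** A change of one argument of F amounts to a linear change of one argument of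
    the resulting tensor; this is the way in which all operators below are
    multilinear. *)
Lemma multilinear_tens n n' (F : {ffun 'I_n -> V} -> {ffun 'I_n' -> V}) :
  (forall a i, exists f j, linear f /\
     forall z, F (upd a i z) = upd (F (upd a i 0)) j (f z)) ->
  multilinear (fun a => tens (F a)).
Proof.
move=> H a i c x y; have [f [j [lf Hf]]] := H a i.
by rewrite (Hf (c *: x + y)) (Hf x) (Hf y) lf tens_multilinear.
Qed.

Lemma tlift_sig n (W : lmodType k) (h : {ffun 'I_n -> V} -> W) :
  multilinear h -> {f : tpow V n -> W | linear f /\ forall a, f (tens a) = h a}.
Proof.
move=> hl; exists (tlift h).
by split=> [|a]; [exact: tlift_linear hl | exact: tlift_tens hl a].
Qed.

End Tensors.

(** * The bar complex and its operators *)

Section Bar.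
Variables (k : fieldType) (R : pzAlg k).

Local Notation mul := (@pz_mul k R).

(** The bar complex in degree n is [tpow R n.+2], a bimodule under
    multiplication of the first entry from the left ([lmul]) and of the last
    entry from the right ([rmul]).  An operator on tensor powers is determined by
    linearity and by its values on elementary tensors; each of them is introduced
    by these two properties, and nothing else about it is used. *)
Fact lmul_multilinear n (x : R) : multilinear
  (fun a : {ffun 'I_n.+1 -> R} => tens (upd a ord0 (mul x (a ord0)))).
Proof.
apply: multilinear_tens => a i; have [->|i0] := eqVneq i ord0.
  exists (mul x), ord0; split; first exact: pz_mul_linr.
  by move=> z; rewrite !upd_upd !ffunE eqxx.
exists id, i; split=> // z; apply/ffunP => j; rewrite !ffunE.
have [->|_] := eqVneq j ord0; first by rewrite eq_sym (negbTE i0).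
by case: eqP.
Qed.

Fact lmul_exists : {f : forall n, R -> tpow R n.+1 -> tpow R n.+1 | forall n x,
  linear (f n x) /\
  forall a, f n x (tens a) = tens (upd a ord0 (mul x (a ord0)))}.
Proof.
exists (fun n x => sval (tlift_sig (@lmul_multilinear n x))) => n x.
exact: (svalP (tlift_sig (@lmul_multilinear n x))).
Qed.

Definition lmul := sval lmul_exists.

Lemma lmul_linear n x : linear (@lmul n x).
Proof. by case: (svalP lmul_exists n x). Qed.

Lemma lmulE n x (a : {ffun 'I_n.+1 -> R}) :
  lmul x (tens a) = tens (upd a ord0 (mul x (a ord0))).
Proof. by case: (svalP lmul_exists n x). Qed.

Fact rmul_multilinear n (x : R) : multilinear
  (fun a : {ffun 'I_n.+1 -> R} => tens (upd a ord_max (mul (a ord_max) x))).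
Proof.
apply: multilinear_tens => a i; have [->|i0] := eqVneq i ord_max.
  exists (mul^~ x), ord_max; split; first exact: pz_mul_linl.
  by move=> z; rewrite !upd_upd !ffunE eqxx.
exists id, i; split=> // z; apply/ffunP => j; rewrite !ffunE.
have [->|_] := eqVneq j ord_max; first by rewrite eq_sym (negbTE i0).
by case: eqP.
Qed.

Fact rmul_exists : {f : forall n, R -> tpow R n.+1 -> tpow R n.+1 | forall n x,
  linear (f n x) /\
  forall a, f n x (tens a) = tens (upd a ord_max (mul (a ord_max) x))}.
Proof.
exists (fun n x => sval (tlift_sig (@rmul_multilinear n x))) => n x.
exact: (svalP (tlift_sig (@rmul_multilinear n x))).
Qed.

Definition rmul := sval rmul_exists.

Lemma rmul_linear n x : linear (@rmul n x).
Proof. by case: (svalP rmul_exists n x). Qed.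

Lemma rmulE n x (a : {ffun 'I_n.+1 -> R}) :
  rmul x (tens a) = tens (upd a ord_max (mul (a ord_max) x)).
Proof. by case: (svalP rmul_exists n x). Qed.

Definition fcons n (x : R) (a : {ffun 'I_n -> R}) : {ffun 'I_n.+1 -> R} :=
  [ffun i => oapp a x (unlift ord0 i)].

Lemma fcons0 n x (a : {ffun 'I_n -> R}) : fcons x a ord0 = x.
Proof. by rewrite ffunE unlift_none. Qed.

Lemma fconsS n x (a : {ffun 'I_n -> R}) i : fcons x a (lift ord0 i) = a i.
Proof. by rewrite ffunE liftK. Qed.

Lemma fcons_eta n (a : {ffun 'I_n.+1 -> R}) :
  fcons (a ord0) [ffun i => a (lift ord0 i)] = a.
Proof.
by apply/ffunP => i; case: (unliftP ord0 i) => [j|] ->; rewrite ?fcons0 ?fconsS ?ffunE.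
Qed.

(** [tcons] is x |-> 1 (x) x, the contraction of the bar complex as a complex of
    right modules ([bar_bd_cons]).  [tsnoc] is x |-> x (x) 1, the section of the
    projection [wrap] to the Hochschild complex. *)
Fact tcons_multilinear n : multilinear
  (fun a : {ffun 'I_n -> R} => tens (fcons pz_one a)).
Proof.
apply: multilinear_tens => a i; exists id, (lift ord0 i); split=> // z.
apply/ffunP => j; case: (unliftP ord0 j) => [l|] ->; rewrite !ffunE.
  by rewrite liftK /= !ffunE (inj_eq lift_inj); case: eqP.
by rewrite unlift_none.
Qed.

Fact tcons_exists : {f : forall n, tpow R n -> tpow R n.+1 | forall n,
  linear (f n) /\ forall a, f n (tens a) = tens (fcons pz_one a)}.
Proof.
exists (fun n => sval (tlift_sig (@tcons_multilinear n))) => n.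
exact: (svalP (tlift_sig (@tcons_multilinear n))).
Qed.

Definition tcons := sval tcons_exists.

Lemma tcons_linear n : linear (@tcons n).
Proof. by case: (svalP tcons_exists n). Qed.

Lemma tconsE n (a : {ffun 'I_n -> R}) : tcons (tens a) = tens (fcons pz_one a).
Proof. by case: (svalP tcons_exists n). Qed.

Definition fsnoc n (a : {ffun 'I_n -> R}) (x : R) : {ffun 'I_n.+1 -> R} :=
  [ffun i => oapp a x (unlift ord_max i)].

Lemma fsnoc_max n x (a : {ffun 'I_n -> R}) : fsnoc a x ord_max = x.
Proof. by rewrite ffunE unlift_none. Qed.

Lemma fsnocW n x (a : {ffun 'I_n -> R}) i :
  fsnoc a x (widen_ord (leqnSn n) i) = a i.
Proof.
have -> : widen_ord (leqnSn n) i = lift ord_max i.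
  by apply/val_inj; rewrite /= /bump leqNgt ltn_ord.
by rewrite ffunE liftK.
Qed.

Fact tsnoc_multilinear n : multilinear
  (fun a : {ffun 'I_n -> R} => tens (fsnoc a pz_one)).
Proof.
apply: multilinear_tens => a i; exists id, (lift ord_max i); split=> // z.
apply/ffunP => j; case: (unliftP ord_max j) => [l|] ->; rewrite !ffunE.
  by rewrite liftK /= !ffunE (inj_eq lift_inj); case: eqP.
by rewrite unlift_none (negbTE (neq_lift _ _)).
Qed.

Fact tsnoc_exists : {f : forall n, tpow R n -> tpow R n.+1 | forall n,
  linear (f n) /\ forall a, f n (tens a) = tens (fsnoc a pz_one)}.
Proof.
exists (fun n => sval (tlift_sig (@tsnoc_multilinear n))) => n.
exact: (svalP (tlift_sig (@tsnoc_multilinear n))).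
Qed.

Definition tsnoc := sval tsnoc_exists.

Lemma tsnoc_linear n : linear (@tsnoc n).
Proof. by case: (svalP tsnoc_exists n). Qed.

Lemma tsnocE n (a : {ffun 'I_n -> R}) : tsnoc (tens a) = tens (fsnoc a pz_one).
Proof. by case: (svalP tsnoc_exists n). Qed.

(** The boundary of the bar complex: the Hochschild boundary without its last,
    cyclic term. *)
Fact bar_bd_multilinear n : multilinear (fun a : {ffun 'I_n.+2 -> R} =>
  \sum_(i < n.+1) (-1) ^+ i *: tens (hface i a)).
Proof. by apply: multilinear_sum => i; apply/multilinearZ/hface_multilinear. Qed.

Fact bar_bd_exists : {f : forall n, tpow R n.+2 -> tpow R n.+1 | forall n,
  linear (f n) /\
  forall a, f n (tens a) = \sum_(i < n.+1) (-1) ^+ i *: tens (hface i a)}.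
Proof.
exists (fun n => sval (tlift_sig (@bar_bd_multilinear n))) => n.
exact: (svalP (tlift_sig (@bar_bd_multilinear n))).
Qed.

Definition bar_bd := sval bar_bd_exists.

Lemma bar_bd_linear n : linear (@bar_bd n).
Proof. by case: (svalP bar_bd_exists n). Qed.

Lemma bar_bdE n (a : {ffun 'I_n.+2 -> R}) :
  bar_bd (tens a) = \sum_(i < n.+1) (-1) ^+ i *: tens (hface i a).
Proof. by case: (svalP bar_bd_exists n). Qed.

(** The projection from the bar complex to the Hochschild complex, which glues
    the two outer factors: R (x) R^n (x) R, modulo the commutators of its bimodule
    structure, is R (x) R^n. *)
Fact wrap_exists : {f : forall n, tpow R n.+2 -> tpow R n.+1 | forall n,
  linear (f n) /\ forall a, f n (tens a) = tens (hface_last a)}.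
Proof.
exists (fun n => sval (tlift_sig (@hface_last_multilinear k R n))) => n.
exact: (svalP (tlift_sig (@hface_last_multilinear k R n))).
Qed.

Definition wrap := sval wrap_exists.

Lemma wrap_linear n : linear (@wrap n).
Proof. by case: (svalP wrap_exists n). Qed.

Lemma wrapE n (a : {ffun 'I_n.+2 -> R}) : wrap (tens a) = tens (hface_last a).
Proof. by case: (svalP wrap_exists n). Qed.

End Bar.

Arguments lmul {k R n} x t.
Arguments rmul {k R n} x t.
Arguments tcons {k R n} t.
Arguments tsnoc {k R n} t.
Arguments bar_bd {k R n} t.
Arguments wrap {k R n} t.

Ltac prove_linear := repeat first
  [ done | exact: lmul_linear | exact: rmul_linear | exact: tcons_linear
  | exact: tsnoc_linear | exact: bar_bd_linear | exact: wrap_linear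
  | exact: linearP | apply: linear_sub | apply: linear_comb
  | apply: linear_compose ].

Section BarCalculus.
Variables (k : fieldType) (R : pzAlg k).

Local Notation mul := (@pz_mul k R).

Lemma lmulP n (t : tpow R n.+1) : linear (fun x => lmul x t).
Proof.
move=> c x y; rewrite addrC; apply: (tpow_eq (f := lmul (c *: x + y))
  (g := fun u => lmul y u + c *: lmul x u)) => [||a].
- prove_linear.
- prove_linear.
- by rewrite !lmulE pz_mul_linl tens_multilinear addrC.
Qed.

Lemma rmulP n (t : tpow R n.+1) : linear (fun x => rmul x t).
Proof.
move=> c x y; rewrite addrC; apply: (tpow_eq (f := rmul (c *: x + y))
  (g := fun u => rmul y u + c *: rmul x u)) => [||a].
- prove_linear.
- prove_linear.
- by rewrite !rmulE pz_mul_linr tens_multilinear addrC.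
Qed.

Lemma lmulM n x y (t : tpow R n.+1) : lmul (mul x y) t = lmul x (lmul y t).
Proof.
apply: (tpow_eq (f := lmul _) (g := lmul x \o lmul y)); try by prove_linear.
by move=> a; rewrite /= !lmulE !ffunE eqxx upd_upd pz_mulA.
Qed.

Lemma rmulM n x y (t : tpow R n.+1) : rmul (mul x y) t = rmul y (rmul x t).
Proof.
apply: (tpow_eq (f := rmul _) (g := rmul y \o rmul x)); try by prove_linear.
by move=> a; rewrite /= !rmulE !ffunE eqxx upd_upd pz_mulA.
Qed.

Lemma lmul1 n (t : tpow R n.+1) : lmul pz_one t = t.
Proof.
apply: (tpow_eq (f := lmul _) (g := id)) => // [|a]; first prove_linear.
by rewrite lmulE pz_mul1l upd_id.
Qed.

Lemma rmul1 n (t : tpow R n.+1) : rmul pz_one t = t.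
Proof.
apply: (tpow_eq (f := rmul _) (g := id)) => // [|a]; first prove_linear.
by rewrite rmulE pz_mul1r upd_id.
Qed.

Lemma lrmulC n x y (t : tpow R n.+1) : lmul x (rmul y t) = rmul y (lmul x t).
Proof.
apply: (tpow_eq (f := lmul x \o rmul y) (g := rmul y \o lmul x));
  try by prove_linear.
move=> a; rewrite /= rmulE lmulE lmulE rmulE !ffunE.
have [e|ne] := eqVneq (ord0 : 'I_n.+1) ord_max.
  by rewrite -e !upd_upd pz_mulA.
by rewrite updC // eq_sym.
Qed.

Lemma hh_bd_linear n : linear (@hh_bd k R n).
Proof. exact: tlift_linear (@hh_bd_multilinear k R n). Qed.

Lemma hh_bd_bar n (t : tpow R n.+2) :
  hh_bd t = bar_bd t + (-1) ^+ n.+1 *: wrap t.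
Proof.
apply: (tpow_eq (f := @hh_bd k R n)
  (g := fun t => bar_bd t + (-1) ^+ n.+1 *: wrap t)) => [||a].
- prove_linear.
- prove_linear.
- by rewrite hh_bdE bar_bdE wrapE.
Qed.

(** The face 0 of x (x) a multiplies x into a, and the others are x (x) the faces
    of a; hence the recursive form of the boundary in [bar_bd_cons]. *)
Lemma hface0_cons n x (a : {ffun 'I_n.+1 -> R}) :
  hface ord0 (fcons x a) = upd a ord0 (mul x (a ord0)).
Proof.
apply/ffunP => j; rewrite [LHS]ffunE [RHS]ffunE /= fconsS.
have [->|//] := eqVneq j ord0; congr mul.
by rewrite -[RHS](fcons0 x a); congr (fcons _ _ _); exact/val_inj.
Qed.

Lemma widen_lift0 n (j : 'I_n) : widen_ord (leqnSn n.+1) (lift ord0 j) =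
  lift ord0 (widen_ord (leqnSn n) j).
Proof. exact/val_inj. Qed.

Lemma hfaceS_cons n x (i : 'I_n.+1) (a : {ffun 'I_n.+2 -> R}) :
  hface (lift ord0 i) (fcons x a) = fcons x (hface i a).
Proof.
apply/ffunP => j; rewrite [LHS]ffunE; case: (unliftP ord0 j) => [l|] ->.
  rewrite widen_lift0 !fconsS ffunE /= (inj_eq lift_inj) ltnS.
  by [].
rewrite fcons0 /=; have -> : widen_ord (leqnSn n.+2) ord0 = ord0 by exact/val_inj.
by rewrite fcons0.
Qed.

Lemma bar_bd_cons0 (t : tpow R 1) : bar_bd (tcons t) = t.
Proof.
apply: (tpow_eq (f := @bar_bd k R 0 \o @tcons k R 1) (g := id)) => // [|a].
  prove_linear.
rewrite /= tconsE bar_bdE big_ord_recl big_ord0 addr0 expr0 scale1r.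
by rewrite hface0_cons pz_mul1l upd_id.
Qed.

Lemma bar_bd_cons n (t : tpow R n.+2) :
  bar_bd (tcons t) = t - tcons (bar_bd t).
Proof.
apply: (tpow_eq (f := @bar_bd k R n.+1 \o @tcons k R n.+2)
  (g := fun t => t - tcons (bar_bd t))) => [||a].
- prove_linear.
- prove_linear.
rewrite /= tconsE !bar_bdE big_ord_recl expr0 scale1r hface0_cons pz_mul1l upd_id.
congr (_ + _); rewrite (lin_sum (@tcons_linear k R _)) -sumrN.
apply: eq_bigr => i _ /=.
by rewrite (linZ (@tcons_linear k R _)) hfaceS_cons tconsE exprS mulN1r scaleNr.
Qed.

Lemma bar_bd_lmul n x (t : tpow R n.+2) : bar_bd (lmul x t) = lmul x (bar_bd t).
Proof.
apply: (tpow_eq (f := @bar_bd k R n \o lmul x) (g := lmul x \o @bar_bd k R n));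
  try by prove_linear.
move=> a /=; rewrite lmulE !bar_bdE (lin_sum (@lmul_linear k R _ _)).
apply: eq_bigr => i _ /=.
rewrite (linZ (@lmul_linear k R _ _)) lmulE; congr (_ *: tens _).
apply/ffunP => j; rewrite !ffunE.
have e0 : (ord0 : 'I_n.+2) = widen_ord (leqnSn n.+1) ord0 by exact/val_inj.
have -> : (widen_ord (leqnSn n.+1) j == ord0) = (j == ord0) by [].
have -> : (lift ord0 j == ord0 :> 'I_n.+2) = false by [].
have [-> /=|//] := eqVneq j ord0; rewrite -!e0.
by case: ifP => // i0; case: ifP => [_|]; [rewrite pz_mulA|case: i i0 => -[]].
Qed.

Lemma bar_bd_rmul n x (t : tpow R n.+2) : bar_bd (rmul x t) = rmul x (bar_bd t).
Proof.
apply: (tpow_eq (f := @bar_bd k R n \o rmul x) (g := rmul x \o @bar_bd k R n));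
  try by prove_linear.
move=> a /=; rewrite rmulE !bar_bdE (lin_sum (@rmul_linear k R _ _)).
apply: eq_bigr => i _ /=.
rewrite (linZ (@rmul_linear k R _ _)) rmulE; congr (_ *: tens _).
apply/ffunP => j; rewrite !ffunE.
have em : (ord_max : 'I_n.+2) = lift ord0 ord_max by exact/val_inj.
have -> : (widen_ord (leqnSn n.+1) j == ord_max) = false.
  by rewrite -val_eqE /= ltn_eqF.
have -> : (lift ord0 j == ord_max :> 'I_n.+2) = (j == ord_max).
  by rewrite em (inj_eq lift_inj).
have [-> /=|//] := eqVneq j ord_max.
rewrite -!em ltnNge -ltnS ltn_ord /=; case: eqP => // _.
by rewrite pz_mulA.
Qed.

End BarCalculus.

(** * From the bar complex to the Hochschild complex *)

Section Wrap.
Variables (k : fieldType) (R : pzAlg k).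

Local Notation mul := (@pz_mul k R).

Lemma wrap_mul n x y (t : tpow R n.+2) :
  wrap (lmul x (rmul y t)) = wrap (lmul (mul y x) t).
Proof.
apply: (tpow_eq (f := @wrap k R n \o (lmul x \o rmul y))
  (g := @wrap k R n \o lmul (mul y x)));
  try prove_linear.
move=> a /=; rewrite rmulE !lmulE !wrapE; congr tens.
apply/ffunP => j; rewrite !ffunE /=.
have [_|j0] := eqVneq j ord0; first by rewrite eqxx !pz_mulA.
have /negbTE -> : widen_ord (leqnSn n.+1) j != ord0 by [].
have /negbTE -> // : widen_ord (leqnSn n.+1) j != ord_max.
by rewrite -val_eqE /= ltn_eqF.
Qed.

Lemma wrap_snoc n (t : tpow R n.+1) : wrap (tsnoc t) = t.
Proof.
apply: (tpow_eq (f := @wrap k R n \o @tsnoc k R n.+1) (g := id)) => // [|a].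
  prove_linear.
rewrite /= tsnocE wrapE; congr tens; apply/ffunP => j.
rewrite ffunE fsnocW fsnoc_max pz_mul1l; have [->|//] := eqVneq j ord0.
by rewrite -(fsnocW pz_one a); congr (fsnoc _ _ _); exact/val_inj.
Qed.

Lemma hface_last_inner n (i : 'I_n.+1) (a : {ffun 'I_n.+3 -> R}) :
  hface_last (hface (widen_ord (leqnSn n.+1) i) a) = hface i (hface_last a).
Proof.
have ew m : widen_ord (leqnSn m.+1) ord0 = ord0 by exact/val_inj.
have em m : lift ord0 (@ord_max m) = ord_max by exact/val_inj.
have nwi m (l : 'I_m.+1) : (widen_ord (leqnSn m.+1) l == ord0) = (l == ord0) by [].
apply/ffunP => j; rewrite !ffunE /= !nwi.
have wl : widen_ord (leqnSn n.+2) (lift ord0 j) = lift ord0 (widen_ord (leqnSn n.+1) j).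
  exact/val_inj.
have ni : (n.+1 < i)%N = false by apply/negbTE; rewrite -leqNgt ltnW.
have mi : (ord_max == widen_ord (leqnSn n.+1) i) = false.
  by rewrite -val_eqE /= gtn_eqF.
rewrite ni mi em wl.
have [->|j0] := eqVneq j ord0.
  rewrite !ew; case: ifP => // i0.
  rewrite -[_ == i]val_eqE -[_ == widen_ord _ i]val_eqE /=.
  by case: ifP => // [_|]; [rewrite pz_mulA | move: i0; case: (nat_of_ord i)].
by [].
Qed.

Lemma hface_last_last n (a : {ffun 'I_n.+3 -> R}) :
  hface_last (hface ord_max a) = hface_last (hface_last a).
Proof.
have ew m : widen_ord (leqnSn m.+1) ord0 = ord0 by exact/val_inj.
have em m : lift ord0 (@ord_max m) = ord_max by exact/val_inj.
have nwi m (l : 'I_m.+1) : (widen_ord (leqnSn m.+1) l == ord0) = (l == ord0) by [].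
apply/ffunP => j; rewrite !ffunE /= !nwi ltnn eqxx em ew.
have [_|j0] := eqVneq j ord0; first by rewrite -pz_mulA.
by rewrite (ltn_ord j).
Qed.

(** [wrap] is a chain map: the inner faces commute with it, and the last face of
    the bar complex, once wrapped, becomes the cyclic face. *)
Lemma wrap_bar_bd n (t : tpow R n.+3) : wrap (bar_bd t) = hh_bd (wrap t).
Proof.
apply: (tpow_eq (f := @wrap k R n \o @bar_bd k R n.+1)
  (g := @hh_bd k R n \o @wrap k R n.+1)); try prove_linear.
move=> a /=; rewrite bar_bdE wrapE hh_bdE /hh_bd_tens.
rewrite (lin_sum (@wrap_linear k R _)) big_ord_recr /=.
congr (_ + _); last by rewrite (linZ (@wrap_linear k R _)) wrapE hface_last_last.
apply: eq_bigr => i _; rewrite (linZ (@wrap_linear k R _)) wrapE -hface_last_inner.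
by congr (_ *: tens (hface_last (hface _ _))); exact/val_inj.
Qed.

(** A bimodule map f descends along [wrap]: moving the last entry to the front
    with [tsnoc] and [wrap] changes t only by commutators, and f respects these. *)
Lemma wrap_snoc_wrap n n' (f : tpow R n.+2 -> tpow R n'.+2) (t : tpow R n.+2) :
  linear f -> (forall x t, f (lmul x t) = lmul x (f t)) ->
  (forall x t, f (rmul x t) = rmul x (f t)) ->
  wrap (f (tsnoc (wrap t))) = wrap (f t).
Proof.
move=> lf fl fr.
apply: (tpow_eq (f := fun t => wrap (f (tsnoc (wrap t)))) (g := fun t => wrap (f t))).
- prove_linear.
- prove_linear.
move=> a; pose u := tens (upd a ord_max pz_one).
have -> : tens a = rmul (a ord_max) u.
  by rewrite rmulE !ffunE eqxx upd_upd pz_mul1l upd_id.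
have -> : tsnoc (wrap (rmul (a ord_max) u)) = lmul (a ord_max) u.
  rewrite rmulE !ffunE eqxx upd_upd pz_mul1l upd_id wrapE tsnocE lmulE !ffunE /=.
  congr tens; apply/ffunP => j; rewrite !ffunE.
  case: (unliftP ord_max j) => [l|] -> /=; last first.
    by rewrite eqxx.
  have /negbTE -> : lift ord_max l != ord_max by rewrite eq_sym neq_lift.
  rewrite ffunE.
  have -> : (lift ord_max l == ord0) = (l == ord0).
    by rewrite -!val_eqE /= /bump leqNgt ltn_ord.
  case: eqP => // _; congr (a _); apply/val_inj.
  by rewrite /= /bump leqNgt ltn_ord.
by rewrite fl fr -[in RHS](lmul1 (rmul _ _)) wrap_mul pz_mul1r.
Qed.

End Wrap.

(** * Tensors with at most four factors *)

Section AlternatingSums.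
Variables (k : fieldType) (V : lmodType k).

Lemma alt_sum2 (F : 'I_2 -> V) :
  \sum_(i < 2) (-1) ^+ i *: F i = F ord0 - F (lift ord0 ord0).
Proof. by rewrite !big_ord_recl big_ord0 addr0 scale1r scaleN1r. Qed.

Lemma alt_sum3 (F : 'I_3 -> V) : \sum_(i < 3) (-1) ^+ i *: F i =
  F ord0 - F (lift ord0 ord0) + F (lift ord0 (lift ord0 ord0)).
Proof.
rewrite !big_ord_recl big_ord0 addr0 scale1r addrA scaleN1r /=.
by rewrite expr2 mulrNN mulr1 scale1r.
Qed.

End AlternatingSums.

Section LowTensors.
Variables (k : fieldType) (R : pzAlg k).

Local Notation mul := (@pz_mul k R).

Definition tseq n (s : seq R) : tpow R n := tens [ffun i : 'I_n => nth 0 s i].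

Definition t1 x := tseq 1 [:: x].
Definition t2 x y := tseq 2 [:: x; y].
Definition t3 x y z := tseq 3 [:: x; y; z].
Definition t4 x y z w := tseq 4 [:: x; y; z; w].

Lemma tens1 (a : {ffun 'I_1 -> R}) : tens a = t1 (a ord0).
Proof.
by congr tens; apply/ffunP => -[[|//] ?]; rewrite ffunE; congr (a _); exact/val_inj.
Qed.

Lemma tens2 (a : {ffun 'I_2 -> R}) : tens a = t2 (a ord0) (a ord_max).
Proof.
congr tens; apply/ffunP => -[[|[|//]] ?]; rewrite ffunE; congr (a _);
  exact/val_inj.
Qed.

Lemma tens3 (a : {ffun 'I_3 -> R}) :
  tens a = t3 (a ord0) (a (lift ord0 ord0)) (a ord_max).
Proof.
congr tens; apply/ffunP => -[[|[|[|//]]] ?]; rewrite ffunE; congr (a _);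
  exact/val_inj.
Qed.

Lemma tens4 (a : {ffun 'I_4 -> R}) : tens a =
  t4 (a ord0) (a (lift ord0 ord0)) (a (lift ord0 (lift ord0 ord0))) (a ord_max).
Proof.
congr tens; apply/ffunP => -[[|[|[|[|//]]]] ?]; rewrite ffunE; congr (a _);
  exact/val_inj.
Qed.

Let updE n s i x : (i < n.+1)%N -> tseq n.+1 (set_nth 0 s i x) =
  tens (upd [ffun j : 'I_n.+1 => nth 0 s j] (inord i) x).
Proof.
move=> ltin; congr tens; apply/ffunP => j; rewrite !ffunE nth_set_nth /=.
by rewrite -val_eqE /= inordK.
Qed.

Let tseqP n s i : (i < n.+1)%N -> linear (fun x => tseq n.+1 (set_nth 0 s i x)).
Proof. by move=> ltin c x y; rewrite !updE //; exact: tens_multilinear. Qed.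

Lemma t1P : linear t1.
Proof. exact: (@tseqP 0 [:: 0] 0). Qed.

Lemma t2Pl y : linear (t2^~ y).
Proof. exact: (@tseqP 1 [:: 0; y] 0). Qed.

Lemma t2Pr x : linear (t2 x).
Proof. exact: (@tseqP 1 [:: x; 0] 1). Qed.

Lemma t3Pl y z : linear (fun x => t3 x y z).
Proof. exact: (@tseqP 2 [:: 0; y; z] 0). Qed.

Lemma t3Pr x y : linear (fun z => t3 x y z).
Proof. exact: (@tseqP 2 [:: x; y; 0] 2). Qed.

Lemma lmul_t2 z x y : lmul z (t2 x y) = t2 (mul z x) y.
Proof.
by rewrite lmulE; congr tens; apply/ffunP => -[[|[|//]] ?]; rewrite !ffunE.
Qed.

Lemma rmul_t2 z x y : rmul z (t2 x y) = t2 x (mul y z).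
Proof.
by rewrite rmulE; congr tens; apply/ffunP => -[[|[|//]] ?]; rewrite !ffunE.
Qed.

Lemma lmul_t3 w x y z : lmul w (t3 x y z) = t3 (mul w x) y z.
Proof.
by rewrite lmulE; congr tens; apply/ffunP => -[[|[|[|//]]] ?]; rewrite !ffunE.
Qed.

Lemma rmul_t3 w x y z : rmul w (t3 x y z) = t3 x y (mul z w).
Proof.
by rewrite rmulE; congr tens; apply/ffunP => -[[|[|[|//]]] ?]; rewrite !ffunE.
Qed.

Lemma bar_bd_t2 x y : bar_bd (t2 x y) = t1 (mul x y).
Proof.
rewrite bar_bdE big_ord_recl big_ord0 addr0 scale1r.
by congr tens; apply/ffunP => -[[|//] ?]; rewrite !ffunE.
Qed.

Lemma bar_bd_t3 x y z : bar_bd (t3 x y z) = t2 (mul x y) z - t2 x (mul y z).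
Proof.
rewrite bar_bdE alt_sum2.
by congr (tens _ - tens _); apply/ffunP => -[[|[|//]] ?]; rewrite !ffunE.
Qed.

Lemma bar_bd_t4 x y z w : bar_bd (t4 x y z w) =
  t3 (mul x y) z w - t3 x (mul y z) w + t3 x y (mul z w).
Proof.
rewrite bar_bdE alt_sum3.
by congr (tens _ - tens _ + tens _); apply/ffunP => -[[|[|[|//]]] ?]; rewrite !ffunE.
Qed.

Lemma wrap_t2 x y : wrap (t2 x y) = t1 (mul y x).
Proof.
by rewrite wrapE; congr tens; apply/ffunP => -[[|//] ?]; rewrite !ffunE.
Qed.

Lemma wrap_t3 x y z : wrap (t3 x y z) = t2 (mul z x) y.
Proof.
by rewrite wrapE; congr tens; apply/ffunP => -[[|[|//]] ?]; rewrite !ffunE.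
Qed.

Lemma tsnoc_t1 x : tsnoc (t1 x) = t2 x pz_one.
Proof.
rewrite tsnocE; congr tens; apply/ffunP => -[[|[|//]] p].
  have -> : Ordinal p = lift ord_max (ord0 : 'I_1) by exact/val_inj.
  by rewrite !ffunE liftK /= ffunE.
have -> : Ordinal p = ord_max by exact/val_inj.
by rewrite fsnoc_max ffunE.
Qed.

Lemma tsnoc_t2 x y : tsnoc (t2 x y) = t3 x y pz_one.
Proof.
rewrite tsnocE; congr tens; apply/ffunP => -[[|[|[|//]]] p].
- have -> : Ordinal p = lift ord_max (ord0 : 'I_2) by exact/val_inj.
  by rewrite !ffunE liftK /= ffunE.
- have -> : Ordinal p = lift ord_max (ord_max : 'I_2) by exact/val_inj.
  by rewrite !ffunE liftK /= ffunE.
have -> : Ordinal p = ord_max by exact/val_inj.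
by rewrite fsnoc_max ffunE.
Qed.

Lemma hh_bd_t2 x y : hh_bd (t2 x y) = t1 (mul x y) - t1 (mul y x).
Proof. by rewrite hh_bd_bar bar_bd_t2 wrap_t2 expr1 scaleN1r. Qed.

Fact untens1_multilinear : multilinear (fun a : {ffun 'I_1 -> R} => a ord0).
Proof.
by move=> a i c x y; rewrite (ord1 i) !ffunE eqxx.
Qed.
Definition untens1 : tpow R 1 -> R := tlift (fun a : {ffun 'I_1 -> R} => a ord0).
Lemma untens1K x : untens1 (t1 x) = x.
Proof. by rewrite /untens1 (tlift_tens untens1_multilinear) ffunE. Qed.

End LowTensors.

(** * Bimodule maps and the contraction onto a short resolution *)

Section Bimodule.
Variables (k : fieldType) (R : pzAlg k).

Local Notation mul := (@pz_mul k R).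
Local Notation "1r" := (@pz_one k R).

Definition bimod n n' (f : tpow R n.+1 -> tpow R n'.+1) : Prop :=
  [/\ linear f, forall x t, f (lmul x t) = lmul x (f t)
    & forall x t, f (rmul x t) = rmul x (f t)].

Definition unit_ends n (a : {ffun 'I_n.+2 -> R}) : {ffun 'I_n.+2 -> R} :=
  upd (upd a ord0 1r) ord_max 1r.

Lemma unit_ends0 n (a : {ffun 'I_n.+2 -> R}) : unit_ends a ord0 = 1r.
Proof. by rewrite !ffunE. Qed.

Lemma unit_ends_max n (a : {ffun 'I_n.+2 -> R}) : unit_ends a ord_max = 1r.
Proof. by rewrite !ffunE eqxx. Qed.

Lemma tens_unit_ends n (a : {ffun 'I_n.+2 -> R}) :
  tens a = lmul (a ord0) (rmul (a ord_max) (tens (unit_ends a))).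
Proof.
rewrite rmulE lmulE upd_upd unit_ends_max pz_mul1l !ffunE /= pz_mul1r.
congr tens; apply/ffunP => j; rewrite !ffunE.
by have [->|_] := eqVneq j ord0; last by have [->|] := eqVneq j ord_max.
Qed.

(** The bar complex is generated, as a bimodule, by the tensors whose two outer
    entries are 1. *)
Lemma bimod_eq n n' (f g : tpow R n.+2 -> tpow R n'.+1) : bimod f -> bimod g ->
  (forall a : {ffun 'I_n.+2 -> R}, a ord0 = 1r -> a ord_max = 1r ->
     f (tens a) = g (tens a)) ->
  f =1 g.
Proof.
case=> lf fl fr [lg gl gr] fg; apply: tpow_eq => // a.
rewrite tens_unit_ends fl fr gl gr fg //; first exact: unit_ends0.
exact: unit_ends_max.
Qed.

Lemma bimod_comp n n' n'' (f : tpow R n'.+1 -> tpow R n''.+1)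
    (g : tpow R n.+1 -> tpow R n'.+1) :
  bimod f -> bimod g -> bimod (fun t => f (g t)).
Proof.
case=> lf fl fr [lg gl gr]; split=> [|x t|x t]; first exact: linear_compose.
  by rewrite gl fl.
by rewrite gr fr.
Qed.

Lemma bimod_sub n n' (f g : tpow R n.+1 -> tpow R n'.+1) :
  bimod f -> bimod g -> bimod (fun t => f t - g t).
Proof.
case=> lf fl fr [lg gl gr]; split=> [|x t|x t]; first exact: linear_sub.
  by rewrite fl gl (linB (lmul_linear x)).
by rewrite fr gr (linB (rmul_linear x)).
Qed.

Lemma bimod_id n : bimod (fun t : tpow R n.+1 => t).
Proof. by split. Qed.

Lemma bimod0 n n' : bimod (fun _ : tpow R n.+1 => 0 : tpow R n'.+1).
Proof.
split=> [a x y|x t|x t]; first by rewrite scaler0 addr0.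
  by rewrite (lin0 (lmul_linear x)).
by rewrite (lin0 (rmul_linear x)).
Qed.

Lemma bimod_bar_bd n : bimod (@bar_bd k R n).
Proof.
split; [exact: bar_bd_linear|exact: bar_bd_lmul|exact: bar_bd_rmul].
Qed.

(** [phi] is a function of the inner entries only; [bimod_ext phi] is the
    bimodule map that sends 1 (x) a_1 .. a_n (x) 1 to [phi a]. *)
Section Extension.
Variables (n n' : nat) (phi : {ffun 'I_n.+2 -> R} -> tpow R n'.+1).

Definition inner_multilinear : Prop :=
  [/\ forall a x, phi (upd a ord0 x) = phi a,
      forall a x, phi (upd a ord_max x) = phi a
    & forall a i, i != ord0 -> i != ord_max -> linear (fun x => phi (upd a i x))].

Definition bimod_ext : tpow R n.+2 -> tpow R n'.+1 :=
  tlift (fun a => lmul (a ord0) (rmul (a ord_max) (phi a))).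

Hypothesis phi_inner : inner_multilinear.

Fact bimod_ext_multilinear :
  multilinear (fun a => lmul (a ord0) (rmul (a ord_max) (phi a))).
Proof.
have [p0 pM pI] := phi_inner; move=> a i c x y; rewrite !ffunE.
have [->|i0] := eqVneq i ord0; first by rewrite ?eqxx !p0 /= lmulP.
have [->|iM] := eqVneq i ord_max.
  by rewrite ?eqxx !pM /= rmulP lmul_linear.
by rewrite pI // rmul_linear lmul_linear.
Qed.

Lemma bimod_extE a :
  bimod_ext (tens a) = lmul (a ord0) (rmul (a ord_max) (phi a)).
Proof. exact: tlift_tens bimod_ext_multilinear a. Qed.

Lemma bimod_ext_linear : linear bimod_ext.
Proof. exact: tlift_linear bimod_ext_multilinear. Qed.

Lemma bimod_extP : bimod bimod_ext.
Proof.
have [p0 pM pI] := phi_inner; have lb := bimod_ext_linear; split=> // x.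
  apply: (tpow_eq (f := fun t => bimod_ext (lmul x t))
    (g := fun t => lmul x (bimod_ext t))).
  - exact: (linear_compose lb (@lmul_linear k R n.+1 x)).
  - exact: (linear_compose (@lmul_linear k R n' x) lb).
  by move=> a; rewrite lmulE !bimod_extE !ffunE p0 /= -lmulM.
apply: (tpow_eq (f := fun t => bimod_ext (rmul x t))
  (g := fun t => rmul x (bimod_ext t))).
- exact: (linear_compose lb (@rmul_linear k R n.+1 x)).
- exact: (linear_compose (@rmul_linear k R n' x) lb).
move=> a; rewrite rmulE !bimod_extE !ffunE pM /= ?eqxx.
rewrite rmulM; exact: lrmulC.
Qed.

End Extension.

Lemma inner_unit_ends n n' (F : tpow R n.+2 -> tpow R n'.+1) : linear F ->
  inner_multilinear (fun a => F (tens (unit_ends a))).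
Proof.
move=> lF; split=> [a x|a x|a i i0 iM c x y].
- by rewrite /unit_ends upd_upd.
- by rewrite /unit_ends updC // upd_upd updC // [in RHS]updC.
rewrite /unit_ends.
have e z : upd (upd (upd a i z) ord0 1r) ord_max 1r =
    upd (upd (upd a ord0 1r) ord_max 1r) i z.
  by rewrite [upd (upd a i z) _ _]updC // [LHS]updC.
by rewrite !e tens_multilinear lF.
Qed.

End Bimodule.

Section Homotopy.
Variables (k : fieldType) (R : pzAlg k).

Local Notation mul := (@pz_mul k R).
Local Notation "1r" := (@pz_one k R).

(** [e] and [delta] are the images, in the bar complex, of the generators of a
    bimodule resolution of length one: e lifts the unit, and delta is a derivation
    that exhibits each difference x e - e x as a boundary. *)
Variables (e : tpow R 2) (delta : R -> tpow R 3).
Hypothesis e_unit : bar_bd e = t1 1r.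
Hypothesis delta_linear : linear delta.
Hypothesis delta_der :
  forall x y, delta (mul x y) = lmul x (delta y) + rmul y (delta x).
Hypothesis bar_bd_delta : forall x, bar_bd (delta x) = lmul x e - rmul x e.

(** The comparison endomorphism of the bar complex.  It factors through a complex
    of length one, which is why it vanishes from degree 2 on. *)
Definition rproj n : tpow R n.+2 -> tpow R n.+2 :=
  match n return tpow R n.+2 -> tpow R n.+2 with
  | 0 => bimod_ext (fun _ => e)
  | 1 => bimod_ext (fun a => delta (a (lift ord0 ord0)))
  | _ => fun _ => 0
  end.

Let e_inner : inner_multilinear (fun _ : {ffun 'I_2 -> R} => e).
Proof. by split=> // a [[|[|//]] p]. Qed.

Let delta_inner : inner_multilinear
  (fun a : {ffun 'I_3 -> R} => delta (a (lift ord0 ord0))).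
Proof.
split=> [a x|a x|a [[|[|[|//]]] p] // _ _ c x y]; rewrite !ffunE //=.
exact: delta_linear.
Qed.

Lemma rproj_bimod n : bimod (@rproj n).
Proof.
case: n => [|[|n]]; last exact: bimod0.
  exact: bimod_extP e_inner.
exact: bimod_extP delta_inner.
Qed.

Lemma rproj0_t2 x y : rproj (t2 x y) = lmul x (rmul y e).
Proof. by rewrite /= (bimod_extE e_inner) !ffunE. Qed.

Lemma rproj1_t3 x y z : rproj (t3 x y z) = lmul x (rmul z (delta y)).
Proof. by rewrite /= (bimod_extE delta_inner) !ffunE. Qed.

(** A chain map: in degree 1 this is the hypothesis on the boundary of delta, and
    in degree 2 it is the Leibniz rule. *)
Lemma bar_bd_rproj n (t : tpow R n.+3) :
  bar_bd (rproj t) = rproj (bar_bd t).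
Proof.
move: t; apply: bimod_eq.
- exact: bimod_comp (bimod_bar_bd _ _) (rproj_bimod _).
- exact: bimod_comp (rproj_bimod _) (bimod_bar_bd _ _).
case: n => [|[|n]] a a0 aM.
- rewrite tens3 a0 aM rproj1_t3 lmul1 rmul1 bar_bd_delta bar_bd_t3.
  have [lp _ _] := rproj_bimod 0.
  by rewrite (linB lp) !rproj0_t2 pz_mul1l pz_mul1r lmul1 rmul1.
- rewrite tens4 a0 aM bar_bd_t4 [@rproj 2 _]/= (lin0 (@bar_bd_linear k R _)).
  have [lp _ _] := rproj_bimod 1.
  rewrite (linD lp) (linB lp) !rproj1_t3 pz_mul1l pz_mul1r !lmul1 !rmul1.
  by rewrite delta_der addrAC subrr.
- by rewrite /= (lin0 (@bar_bd_linear k R _)).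
Qed.

(** Acyclic models: the homotopy is chosen on the generators 1 (x) a (x) 1 by
    applying the contraction [tcons] to the cycle that has to be bounded, and
    extended to a bimodule map. *)
Fixpoint bar_homotopy n : tpow R n.+2 -> tpow R n.+3 :=
  match n return tpow R n.+2 -> tpow R n.+3 with
  | 0 => bimod_ext (fun a => let x := tens (unit_ends a) in
                             tcons (x - rproj x))
  | n'.+1 => bimod_ext (fun a => let x := tens (unit_ends a) in
                tcons (x - rproj x - bar_homotopy (bar_bd x)))
  end.

Let tconsF_linear n (F : tpow R n.+2 -> tpow R n.+2) :
  linear F -> linear (fun t => tcons (F t)).
Proof. by move=> lF; prove_linear. Qed.

Lemma bar_homotopy_bimod n : bimod (@bar_homotopy n).
Proof.
elim: n => [|n IH]; apply/bimod_extP.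
  apply: (inner_unit_ends (F := fun x => tcons (x - rproj x))).
  by apply/tconsF_linear/linear_sub => //; case: (rproj_bimod 0).
apply: (inner_unit_ends
  (F := fun x => tcons (x - rproj x - bar_homotopy (bar_bd x)))).
apply/tconsF_linear/linear_sub.
  by apply: linear_sub => //; case: (rproj_bimod n.+1).
apply: linear_compose; first by case: IH.
prove_linear.
Qed.

Lemma unit_ends_id n (a : {ffun 'I_n.+2 -> R}) :
  a ord0 = 1r -> a ord_max = 1r -> unit_ends a = a.
Proof. by rewrite /unit_ends => a0 aM; rewrite -{1}a0 upd_id -aM upd_id. Qed.

Lemma bar_homotopy0E (a : {ffun 'I_2 -> R}) : a ord0 = 1r -> a ord_max = 1r ->
  bar_homotopy (tens a) = tcons (tens a - rproj (tens a)).
Proof.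
move=> a0 aM; rewrite /= bimod_extE.
  by rewrite unit_ends_id // a0 aM lmul1 rmul1.
apply: (inner_unit_ends (F := fun x => tcons (x - rproj x))).
by apply/tconsF_linear/linear_sub => //; case: (rproj_bimod 0).
Qed.

Lemma bar_homotopySE n (a : {ffun 'I_n.+3 -> R}) :
  a ord0 = 1r -> a ord_max = 1r ->
  bar_homotopy (tens a) =
    tcons (tens a - rproj (tens a) - bar_homotopy (bar_bd (tens a))).
Proof.
move=> a0 aM; rewrite [LHS]bimod_extE.
  by rewrite unit_ends_id // a0 aM lmul1 rmul1.
apply: (inner_unit_ends
  (F := fun x => tcons (x - rproj x - bar_homotopy (bar_bd x)))).
apply/tconsF_linear/linear_sub.
  by apply: linear_sub => //; case: (rproj_bimod n.+1).
apply: linear_compose; first by case: (bar_homotopy_bimod n).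
prove_linear.
Qed.

(** By induction along the contraction: the square of the boundary on 1 (x) x is
    1 (x) the square of the boundary on x. *)
Lemma bar_bd_bar_bd n (t : tpow R n.+3) : bar_bd (bar_bd t) = 0.
Proof.
elim: n t => [|n IH] t.
all: apply: (tpow_eq (f := fun t => bar_bd (bar_bd t)) (g := fun=> 0)) => [||a];
  [prove_linear | by move=> c x y; rewrite scaler0 addr0 |].
all: rewrite -(fcons_eta a); set b := finfun _.
all: have -> : tens (fcons (a ord0) b) = lmul (a ord0) (tcons (tens b));
  [by rewrite tconsE lmulE fcons0 pz_mul1r; congr tens; apply/ffunP => j;
     rewrite !ffunE; case: unliftP => [l|] -> //=; rewrite ?eqxx|].
  rewrite !bar_bd_lmul bar_bd_cons (linB (@bar_bd_linear k R _)) bar_bd_cons0 subrr.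
  exact: lin0 (lmul_linear _).
rewrite !bar_bd_lmul bar_bd_cons (linB (@bar_bd_linear k R _)) bar_bd_cons IH.
by rewrite (lin0 (@tcons_linear k R _)) subr0 subrr (lin0 (lmul_linear _)).
Qed.

Lemma homotopy0 (t : tpow R 2) : bar_bd (bar_homotopy t) = t - rproj t.
Proof.
move: t; apply: bimod_eq.
- exact: bimod_comp (bimod_bar_bd _ _) (bar_homotopy_bimod _).
- exact: bimod_sub (bimod_id _ _) (rproj_bimod _).
move=> a a0 aM; rewrite bar_homotopy0E // bar_bd_cons; set y := tens a - _.
suff -> : bar_bd y = 0 by rewrite (lin0 (@tcons_linear k R _)) subr0.
rewrite /y tens2 a0 aM (linB (@bar_bd_linear k R _)) bar_bd_t2.
rewrite rproj0_t2 lmul1 rmul1 e_unit.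
by rewrite pz_mul1l subrr.
Qed.

(** On a generator x, bar_bd (tcons y) = y - tcons (bar_bd y) for y the defect
    x - rproj x - bar_homotopy (bar_bd x), and the defect is a cycle by the
    identity one degree below. *)
Lemma homotopyS n (t : tpow R n.+3) :
  bar_bd (bar_homotopy t) = t - rproj t - bar_homotopy (bar_bd t).
Proof.
elim: n t => [|n IH].
all: apply: bimod_eq;
  [exact: bimod_comp (bimod_bar_bd _ _) (bar_homotopy_bimod _)
  |exact: bimod_sub (bimod_sub (bimod_id _ _) (rproj_bimod _))
     (bimod_comp (bar_homotopy_bimod _) (bimod_bar_bd _ _))|].
all: move=> a a0 aM; rewrite bar_homotopySE // bar_bd_cons; set y := tens a - _ - _.
all: suff -> : bar_bd y = 0 by rewrite (lin0 (@tcons_linear k R _)) subr0.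
all: rewrite /y !(linB (@bar_bd_linear k R _)) bar_bd_rproj.
  by rewrite homotopy0 subrr.
rewrite IH bar_bd_bar_bd; have [lh _ _] := bar_homotopy_bimod n.
by rewrite (lin0 lh) subr0 subrr.
Qed.

End Homotopy.

(** * Gradings, and the homotopy on the Hochschild complex *)

Section GradedMaps.
Variables (k : fieldType) (R : pzAlg k).

Local Notation mul := (@pz_mul k R).
Local Notation "1r" := (@pz_one k R).

Variable deg : int -> R -> Prop.
Hypothesis deg1 : deg 0 1r.
Hypothesis degM : forall d d' x y, deg d x -> deg d' y -> deg (d + d') (mul x y).

Local Notation gr m n := (@hh_gr k R deg m n).

Lemma tens_gr n (a : {ffun 'I_n.+1 -> R}) (d : 'I_n.+1 -> int) :
  (forall i, deg (d i) (a i)) -> (tens a : tpow R n.+1) \in gr (\sum_i d i) n.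
Proof. by move=> H; apply: span_gen; exists a, d. Qed.

Lemma gr_map n n' (f : tpow R n.+1 -> tpow R n'.+1) (c m : int) : linear f ->
  (forall (a : {ffun 'I_n.+1 -> R}) (d : 'I_n.+1 -> int),
     (forall i, deg (d i) (a i)) -> f (tens a) \in gr (c + \sum_i d i) n') ->
  forall t, t \in gr m n -> f t \in gr (c + m) n'.
Proof.
move=> lf H t tg; apply: (span_map lf) tg => _ [a [d [ad <- ->]]].
exact: H.
Qed.

Definition dupd n (d : 'I_n -> int) (i : 'I_n) (c : int) : 'I_n -> int :=
  fun j => if j == i then c else d j.

Lemma sum_dupd n (d : 'I_n -> int) i c :
  \sum_j dupd d i c j = c - d i + \sum_j d j.
Proof.
rewrite (bigD1 i) //= [in RHS](bigD1 i) //= /dupd eqxx addrA subrK.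
by congr (_ + _); apply: eq_bigr => j /negbTE ->.
Qed.

Lemma deg_upd n (a : {ffun 'I_n -> R}) d i c x : (forall i, deg (d i) (a i)) ->
  deg c x -> forall j, deg (dupd d i c j) (upd a i x j).
Proof. by move=> H cx j; rewrite ffunE /dupd; case: eqP. Qed.

Lemma gr_lmul n (m : int) c x (t : tpow R n.+1) :
  deg c x -> t \in gr m n -> lmul x t \in gr (c + m) n.
Proof.
move=> cx; apply: gr_map; first exact: lmul_linear.
move=> a d ad; rewrite lmulE.
have := tens_gr (@deg_upd _ a d ord0 _ _ ad (degM cx (ad ord0))).
by rewrite sum_dupd addrK.
Qed.

Lemma gr_rmul n (m : int) c x (t : tpow R n.+1) :
  deg c x -> t \in gr m n -> rmul x t \in gr (c + m) n.
Proof.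
move=> cx; apply: gr_map; first exact: rmul_linear.
move=> a d ad; rewrite rmulE.
have := tens_gr (@deg_upd _ a d ord_max _ _ ad (degM (ad ord_max) cx)).
by rewrite sum_dupd [d _ + c]addrC addrK.
Qed.

Lemma gr_tcons n (m : int) (t : tpow R n.+1) :
  t \in gr m n -> (tcons t : tpow R n.+2) \in gr m n.+1.
Proof.
rewrite -[in X in _ -> X](add0r m); apply: gr_map; first exact: tcons_linear.
move=> a d ad; rewrite tconsE add0r.
pose d' j := oapp d 0 (unlift ord0 j).
have -> : \sum_i d i = \sum_i d' i.
  rewrite [RHS]big_ord_recl {1}/d' unlift_none add0r.
  by apply: eq_bigr => i _; rewrite /d' liftK.
apply: tens_gr => j; rewrite /d' ffunE; case: unliftP => [i|] _ //=.
Qed.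

Lemma gr_tsnoc n (m : int) (t : tpow R n.+1) :
  t \in gr m n -> (tsnoc t : tpow R n.+2) \in gr m n.+1.
Proof.
rewrite -[in X in _ -> X](add0r m); apply: gr_map; first exact: tsnoc_linear.
move=> a d ad; rewrite tsnocE add0r.
pose d' j := oapp d 0 (unlift ord_max j).
have -> : \sum_i d i = \sum_i d' i.
  rewrite [RHS]big_ord_recr /= {2}/d' unlift_none addr0.
  apply: eq_bigr => i _; rewrite /d'.
  have -> : widen_ord (leqnSn n.+1) i = lift ord_max i.
    by apply/val_inj; rewrite /= /bump leqNgt ltn_ord.
  by rewrite liftK.
apply: tens_gr => j; rewrite /d' ffunE; case: unliftP => [i|] _ //=.
Qed.

Lemma gr_wrap n (m : int) (t : tpow R n.+2) :
  t \in gr m n.+1 -> (wrap t : tpow R n.+1) \in gr m n.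
Proof.
rewrite -[in X in _ -> X](add0r m); apply: gr_map; first exact: wrap_linear.
move=> a d ad; rewrite wrapE add0r.
pose d' j := (if j == ord0 then d ord_max else 0) + d (widen_ord (leqnSn n.+1) j).
have -> : \sum_i d i = \sum_i d' i.
  rewrite big_split /= -big_mkcond big_pred1_eq big_ord_recr addrC.
  by congr (_ + _).
apply: tens_gr => j; rewrite /d' ffunE; case: eqP => [->|_]; last by rewrite add0r.
have -> : widen_ord (leqnSn n.+1) ord0 = ord0 by exact/val_inj.
exact: degM.
Qed.

(** By the recursion x (x) t |-> x t - x (x) (boundary of t). *)
Lemma gr_bar_bd n (m : int) (t : tpow R n.+2) :
  t \in gr m n.+1 -> (bar_bd t : tpow R n.+1) \in gr m n.
Proof.
rewrite -[in X in _ -> X](add0r m).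
elim: n m t => [|n IH] m; apply: gr_map; try exact: bar_bd_linear.
all: move=> a d ad; rewrite -(fcons_eta a); set b := finfun _.
all: have -> : tens (fcons (a ord0) b) = lmul (a ord0) (tcons (tens b));
  [by rewrite tconsE lmulE fcons0 pz_mul1r; congr tens; apply/ffunP => j;
     rewrite !ffunE; case: unliftP => [l|] -> //=; rewrite ?eqxx|].
all: rewrite add0r big_ord_recl bar_bd_lmul; apply: gr_lmul => //.
all: have bg : tens b \in gr (\sum_i d (lift ord0 i)) _;
  [by apply: tens_gr => i; rewrite ffunE|].
  by rewrite bar_bd_cons0.
rewrite bar_bd_cons rpredB //; apply: gr_tcons.
by have := IH _ _ bg; rewrite add0r.
Qed.

(** A bimodule map preserves total degrees as soon as it does so on the
    generators, because both multiplications add degrees. *)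
Lemma bimod_gr n n' (f : tpow R n.+2 -> tpow R n'.+1) (m : int) : bimod f ->
  (forall (a : {ffun 'I_n.+2 -> R}) (d : 'I_n.+2 -> int),
    a ord0 = 1r -> a ord_max = 1r -> d ord0 = 0 -> d ord_max = 0 ->
    (forall i, deg (d i) (a i)) -> f (tens a) \in gr (\sum_i d i) n') ->
  forall t, t \in gr m n.+1 -> f t \in gr m n'.
Proof.
move=> [lf fl fr] H t tg; rewrite -(add0r m).
apply: gr_map tg => // a d ad; rewrite tens_unit_ends fl fr.
pose d' := dupd (dupd d ord0 0) ord_max 0.
have -> : 0 + \sum_i d i = d ord0 + (d ord_max + \sum_i d' i).
  by rewrite /d' !sum_dupd /dupd /=; set S := \sum_i d i; lia.
apply: gr_lmul => //; apply: gr_rmul => //; apply: H.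
- exact: unit_ends0.
- exact: unit_ends_max.
- by rewrite /d' /dupd ?eqxx ?if_same.
- by rewrite /d' /dupd eqxx.
- by apply: deg_upd => //; apply: deg_upd.
Qed.

Section Homotopy.
Variables (e : tpow R 2) (delta : R -> tpow R 3).
Hypothesis e_unit : bar_bd e = t1 1r.
Hypothesis delta_linear : linear delta.
Hypothesis delta_der :
  forall x y, delta (mul x y) = lmul x (delta y) + rmul y (delta x).
Hypothesis bar_bd_delta : forall x, bar_bd (delta x) = lmul x e - rmul x e.
Hypothesis e_gr : e \in gr 0 1.
Hypothesis delta_gr : forall d x, deg d x -> delta x \in gr d 2.

Local Notation rproj := (rproj e delta).
Local Notation bar_homotopy := (bar_homotopy e delta).

Lemma gr_rproj n (m : int) (t : tpow R n.+2) :
  t \in gr m n.+1 -> (rproj t : tpow R n.+2) \in gr m n.+1.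
Proof.
apply: bimod_gr; first exact: rproj_bimod.
case: n t => [|[|n]] _ a d a0 aM d0 dM ad; last exact: rpred0.
- rewrite tens2 rproj0_t2 // a0 aM lmul1 rmul1 !big_ord_recl big_ord0.
  have -> : lift ord0 ord0 = ord_max :> 'I_2 by exact/val_inj.
  by rewrite d0 dM !addr0.
- rewrite tens3 rproj1_t3 // a0 aM lmul1 rmul1 !big_ord_recl big_ord0.
  have -> : lift ord0 (lift ord0 ord0) = ord_max :> 'I_3 by exact/val_inj.
  by rewrite d0 dM add0r !addr0; apply: delta_gr.
Qed.

Lemma gr_bar_homotopy n (m : int) (t : tpow R n.+2) :
  t \in gr m n.+1 -> (bar_homotopy t : tpow R n.+3) \in gr m n.+2.
Proof.
elim: n m t => [|n IH] m; apply: bimod_gr; try exact: bar_homotopy_bimod.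
  move=> a d a0 aM d0 dM ad; rewrite bar_homotopy0E //.
  apply: gr_tcons; apply: rpredB; first exact: tens_gr.
  by apply: gr_rproj; exact: tens_gr.
move=> a d a0 aM d0 dM ad; rewrite bar_homotopySE //.
apply: gr_tcons; apply: rpredB; first apply: rpredB; first exact: tens_gr.
  by apply: gr_rproj; exact: tens_gr.
by apply: IH; apply: gr_bar_bd; exact: tens_gr.
Qed.

(** The endomorphism and the homotopy that [rproj] and [bar_homotopy] induce on
    the Hochschild complex. *)
Definition hh_proj n (t : tpow R n.+1) : tpow R n.+1 := wrap (rproj (tsnoc t)).
Definition hh_homotopy n (t : tpow R n.+1) : tpow R n.+2 :=
  wrap (bar_homotopy (tsnoc t)).

Lemma gr_hh_proj n m (t : tpow R n.+1) : t \in gr m n -> hh_proj t \in gr m n.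
Proof. by move=> tg; apply/gr_wrap/gr_rproj/gr_tsnoc. Qed.

Lemma gr_hh_homotopy n m (t : tpow R n.+1) :
  t \in gr m n -> hh_homotopy t \in gr m n.+1.
Proof. by move=> tg; apply/gr_wrap/gr_bar_homotopy/gr_tsnoc. Qed.

Lemma hh_proj_linear n : linear (@hh_proj n).
Proof.
apply: linear_compose; first exact: wrap_linear.
apply: linear_compose; last exact: tsnoc_linear.
by case: (@rproj_bimod k R e delta delta_linear n).
Qed.

Lemma hh_homotopy_linear n : linear (@hh_homotopy n).
Proof.
apply: linear_compose; first exact: wrap_linear.
apply: linear_compose; last exact: tsnoc_linear.
by case: (@bar_homotopy_bimod k R e delta delta_linear n).
Qed.

Lemma hh_proj_bd n (t : tpow R n.+2) :
  hh_proj (hh_bd t) = wrap (rproj (bar_bd (tsnoc t))).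
Proof.
rewrite -[in LHS](wrap_snoc t) -wrap_bar_bd /hh_proj.
by have [l1 l2 l3] := @rproj_bimod k R e delta delta_linear n; rewrite wrap_snoc_wrap.
Qed.

Lemma hh_bd_proj n (t : tpow R n.+2) : hh_bd (hh_proj t) = hh_proj (hh_bd t).
Proof. by rewrite hh_proj_bd -bar_bd_rproj // wrap_bar_bd. Qed.

(** The projection vanishes in degree 2 and is a chain map, so in degree 1 it
    kills the boundaries. *)
Lemma hh_proj1_bd (t : tpow R 3) : hh_proj (hh_bd t) = 0.
Proof.
rewrite hh_proj_bd -bar_bd_rproj //= (lin0 (@bar_bd_linear k R _)).
exact: lin0 (@wrap_linear k R _).
Qed.

Lemma hh_homotopy0 (t : tpow R 1) :
  t = hh_proj t + hh_bd (hh_homotopy t).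
Proof.
rewrite /hh_homotopy -wrap_bar_bd homotopy0 // (linB (@wrap_linear k R _)).
by rewrite wrap_snoc addrCA subrr addr0.
Qed.

Lemma hh_homotopyS n (t : tpow R n.+2) :
  t = hh_proj t + hh_bd (hh_homotopy t) + hh_homotopy (hh_bd t).
Proof.
rewrite /hh_homotopy -wrap_bar_bd homotopyS // !(linB (@wrap_linear k R _)).
rewrite wrap_snoc -[X in tsnoc (hh_bd X)](wrap_snoc t) -(wrap_bar_bd (tsnoc t)).
have [l1 l2 l3] := @bar_homotopy_bimod k R e delta delta_linear n.
by rewrite wrap_snoc_wrap // addrA subrK addrCA subrr addr0.
Qed.

Lemma hh_proj_ge2 n (t : tpow R n.+3) : hh_proj t = 0.
Proof. exact: lin0 (@wrap_linear k R _). Qed.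

End Homotopy.
End GradedMaps.

(** * Algebras given by generators and relations *)

Section AlgebraQuotient.
Variables (k : fieldType) (A : algType k) (G : A -> Prop).
Local Notation pi := (@vproj k A (ideal_gen G)).

Lemma vprojM x y : pi (x * y) = pz_mul (pi x : alg_quot G) (pi y).
Proof. exact/esym/quot_mulE. Qed.

Lemma vproj_rel g : G g -> pi g = 0.
Proof.
move=> Gg; apply/vproj_eq0/span_gen; exists 1, g, 1.
by rewrite mul1r mulr1.
Qed.

End AlgebraQuotient.

Section FreeWords.
Variables (k : fieldType) (X : choiceType).

Definition word (s : seq X) : free_alg k X := free_word k (FMonom s).

Lemma free_wordE (w : {fmonom X}) : free_word k w = word w.
Proof. by rewrite /word fmK. Qed.

Lemma word_nil : word [::] = 1.
Proof. by rewrite /word -fmoneE. Qed.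

Lemma word_cat s t : word (s ++ t) = word s * word t.
Proof.
rewrite /word; have -> : FMonom (s ++ t) = fmmul (FMonom s) (FMonom t).
  by rewrite fmmulE.
have := fgmulUU (1 : k) 1 (FMonom s) (FMonom t).
by rewrite mulr1 -malgM_def => e; exact: esym e.
Qed.

Lemma word1 x : word [:: x] = free_gen k x.
Proof. by rewrite /word /free_gen fmuE. Qed.

Lemma free_alg_eq (W : lmodType k) (f g : free_alg k X -> W) :
  linear f -> linear g -> (forall s, f (word s) = g (word s)) -> f =1 g.
Proof.
move=> lf lg fg; apply: (malg_eq (f := f) (g := g)) => // w.
by have := fg w; rewrite -free_wordE.
Qed.

End FreeWords.

(** Operators on a module, one for each generator, make it a module over the free
    algebra; if the relators act by 0, so does the ideal that they generate.  This
    is how elements of a presented algebra are shown to be nonzero. *)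
Section FreeAction.
Variables (k : fieldType) (X : choiceType) (M : lmodType k) (act_gen : X -> M -> M).
Hypothesis act_gen_linear : forall x, linear (act_gen x).
Local Notation F := (free_alg k X).

Definition act_word (s : seq X) (f : M) : M := foldr act_gen f s.

Definition act (z : F) (f : M) : M :=
  free_ext (fun w : {fmonom X} => act_word w f) z.

Lemma act_word_linear s : linear (act_word s).
Proof. by elim: s => [//|x s IH] a f g /=; rewrite IH act_gen_linear. Qed.

Lemma act_linearl f : linear (act^~ f).
Proof. exact: free_ext_linear. Qed.

Lemma act_wordE s f : act (word k s) f = act_word s f.
Proof. exact: free_extU. Qed.

Lemma act_linearr z : linear (act z).
Proof.
move=> a f g; rewrite addrC.
apply: (free_alg_eq (f := act^~ (a *: f + g)) (g := fun z => act z g + a *: act z f)).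
- exact: act_linearl.
- exact: linear_comb (act_linearl g) (act_linearl f).
by move=> s; rewrite !act_wordE act_word_linear addrC.
Qed.

Lemma act_gen_free x f : act (free_gen k x) f = act_gen x f.
Proof. by rewrite -word1 act_wordE. Qed.

Lemma act1 f : act 1 f = f.
Proof. by rewrite -(word_nil k) act_wordE. Qed.

Lemma actM y z f : act (y * z) f = act y (act z f).
Proof.
apply: (free_alg_eq (f := fun y => act (y * z) f) (g := act^~ (act z f))) => [||s].
- by move=> a u v; rewrite mulrDl -scalerAl (act_linearl f).
- exact: act_linearl.
apply: (free_alg_eq (f := fun z => act (word k s * z) f)
  (g := fun z => act (word k s) (act z f))) => [||t].
- by move=> a u v; rewrite mulrDr -scalerAr (act_linearl f).
- exact: linear_compose (act_linearr _) (act_linearl f).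
by rewrite -word_cat !act_wordE /act_word foldr_cat.
Qed.

Lemma act_ideal (G : F -> Prop) : (forall g, G g -> forall f, act g f = 0) ->
  forall z, z \in ideal_gen G -> forall f, act z f = 0.
Proof.
move=> Gact z zG f; apply: (span_eq (act_linearl f) (g := fun=> 0)) zG.
  by move=> a x y; rewrite scaler0 addr0.
move=> _ [a [g [b [Gg ->]]]]; by rewrite !actM (Gact _ Gg) (lin0 (@act_linearr a)).
Qed.

End FreeAction.

(** A derivation with prescribed values D0 on the generators: on words it is given
    by the iterated Leibniz rule, relative to a multiplicative map [cls] from words
    to R. *)
Section WordDerivation.
Variables (k : fieldType) (X : Type) (R : pzAlg k) (cls : seq X -> R).
Hypothesis cls_nil : cls [::] = pz_one.
Hypothesis cls_cat : forall s t, cls (s ++ t) = pz_mul (cls s) (cls t).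
Variables (n : nat) (D0 : X -> tpow R n.+1).

Fixpoint der_word (s : seq X) : tpow R n.+1 :=
  if s is x :: s' then
    lmul (cls [:: x]) (der_word s') + rmul (cls s') (D0 x)
  else 0.

Lemma der_word1 x : der_word [:: x] = D0 x.
Proof. by rewrite /= (lin0 (lmul_linear _)) add0r cls_nil rmul1. Qed.

Lemma der_word_cat s t : der_word (s ++ t) =
  lmul (cls s) (der_word t) + rmul (cls t) (der_word s).
Proof.
elim: s => [|x s IH] /=.
  by rewrite (lin0 (rmul_linear _)) addr0 cls_nil lmul1.
have -> : cls (x :: s) = pz_mul (cls [:: x]) (cls s) by rewrite -cls_cat.
rewrite IH (linD (lmul_linear _)) (linD (rmul_linear _)) cls_cat lmulM rmulM.
by rewrite lrmulC addrA.
Qed.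

End WordDerivation.

Section Derivation.
Variables (k : fieldType) (X : choiceType) (R : pzAlg k).
Local Notation F := (free_alg k X).

Variable pi : F -> R.
Hypothesis pi_linear : linear pi.
Hypothesis piM : forall u v, pi (u * v) = pz_mul (pi u) (pi v).
Hypothesis pi1 : pi 1 = pz_one.

Variables (n : nat) (D0 : X -> tpow R n.+1).

Definition word_class (s : seq X) : R := pi (word k s).

Lemma word_class_nil : word_class [::] = pz_one.
Proof. by rewrite /word_class word_nil. Qed.

Lemma word_class_cat s t :
  word_class (s ++ t) = pz_mul (word_class s) (word_class t).
Proof. by rewrite /word_class word_cat. Qed.

Definition der_free (z : F) : tpow R n.+1 :=
  free_ext (fun w : {fmonom X} => der_word word_class D0 w) z.

Lemma der_free_linear : linear der_free.
Proof. exact: free_ext_linear. Qed.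

Lemma der_free_word s : der_free (word k s) = der_word word_class D0 s.
Proof. exact: free_extU. Qed.

Lemma der_freeM (u v : F) : der_free (u * v) =
  lmul (pi u) (der_free v) + rmul (pi v) (der_free u).
Proof.
have ld := der_free_linear.
have add_lin (W : lmodType k) (f g : F -> W) : linear f -> linear g ->
    linear (fun x => f x + g x).
  move=> lf lg; have := linear_comb 1 lf lg => H a x y.
  by have := H a x y; rewrite !scale1r.
apply: (free_alg_eq (f := fun u => der_free (u * v)) (g := fun u =>
  lmul (pi u) (der_free v) + rmul (pi v) (der_free u))) => [||s].
- by move=> a x y; rewrite mulrDl -scalerAl ld.
- apply: add_lin.
    exact: (linear_compose (f := fun x => lmul x (der_free v)) (lmulP _)).
  exact: (linear_compose (rmul_linear _) ld).
apply: (free_alg_eq (f := fun v => der_free (word k s * v)) (g := fun v =>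
  lmul (pi (word k s)) (der_free v) + rmul (pi v) (der_free (word k s))))
  => [||t].
- by move=> a x y; rewrite mulrDr -scalerAr ld.
- apply: add_lin; first exact: (linear_compose (lmul_linear _) ld).
  exact: (linear_compose (f := fun x => rmul x (der_free (word k s))) (rmulP _)).
rewrite -word_cat !der_free_word.
exact: (der_word_cat word_class_nil word_class_cat).
Qed.

Lemma der_free_gen x : der_free (free_gen k x) = D0 x.
Proof. by rewrite -word1 der_free_word (der_word1 word_class_nil). Qed.

Lemma der_free1 : der_free 1 = 0.
Proof. by rewrite -(word_nil k) der_free_word. Qed.

Section Descent.
Variable G : F -> Prop.
Hypothesis pi_rel : forall g, G g -> pi g = 0.
Hypothesis der_rel : forall g, G g -> der_free g = 0.

Lemma der_free_ideal z : z \in ideal_gen G -> der_free z = 0.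
Proof.
move=> zG; apply: (span_eq der_free_linear (g := fun=> 0)) zG.
  by move=> a x y; rewrite scaler0 addr0.
move=> _ [a [g [b [Gg ->]]]]; rewrite der_freeM der_freeM (der_rel Gg).
rewrite piM (pi_rel Gg) (lin0 (pz_mul_linr _)) (lin0 (lmulP _)).
rewrite (lin0 (rmulP _)) !addr0 add0r.
by rewrite (lin0 (lmul_linear _)) (lin0 (rmul_linear _)).
Qed.

End Descent.

(** A derivation of the free algebra over pi that vanishes on the kernel of pi
    descends to R. *)
Section Lift.
Hypothesis pi_surj : forall x, exists u, x = pi u.
Hypothesis der_ker : forall u, pi u = 0 -> der_free u = 0.

Definition derivation (x : R) : tpow R n.+1 := der_free (projT1 (cid (pi_surj x))).

Lemma derivation_pi u : derivation (pi u) = der_free u.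
Proof.
rewrite /derivation; case: cid => v /= e.
apply/subr0_eq; rewrite -(linB der_free_linear); apply: der_ker.
by rewrite (linB pi_linear) e subrr.
Qed.

Lemma derivation_linear : linear derivation.
Proof.
move=> a x y; have [u ->] := pi_surj x; have [v ->] := pi_surj y.
by rewrite -pi_linear !derivation_pi der_free_linear.
Qed.

Lemma derivationM x y : derivation (pz_mul x y) =
  lmul x (derivation y) + rmul y (derivation x).
Proof.
have [u ->] := pi_surj x; have [v ->] := pi_surj y.
by rewrite -piM !derivation_pi der_freeM.
Qed.

End Lift.
End Derivation.

Notation "x ** y" := (pz_mul x y) (at level 40, left associativity).

(** * Leavitt families: the separability idempotent and the derivation *)

Section PzAlgSums.
Variables (k : fieldType) (R : pzAlg k).
Implicit Types x y z : R.

Lemma pz_mul0l y : 0 ** y = 0 :> R.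
Proof. exact: lin0 (pz_mul_linl y). Qed.

Lemma pz_mul0r x : x ** 0 = 0 :> R.
Proof. exact: lin0 (pz_mul_linr x). Qed.

Lemma pz_suml (I : Type) (r : seq I) (Q : pred I) (F : I -> R) y :
  (\sum_(i <- r | Q i) F i) ** y = \sum_(i <- r | Q i) F i ** y.
Proof. exact: lin_sum (pz_mul_linl y) _ _ _ _. Qed.

Lemma pz_sumr (I : Type) (r : seq I) (Q : pred I) (F : I -> R) x :
  x ** (\sum_(i <- r | Q i) F i) = \sum_(i <- r | Q i) x ** F i.
Proof. exact: lin_sum (pz_mul_linr x) _ _ _ _. Qed.

End PzAlgSums.

Section SpanSums.
Variables (k : fieldType) (V : lmodType k).

Lemma sum_linear (W : lmodType k) (I : Type) (r : seq I) (Q : pred I)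
    (f : I -> V -> W) : (forall i, linear (f i)) ->
  linear (fun x => \sum_(i <- r | Q i) f i x).
Proof.
move=> lf a x y; rewrite scaler_sumr -big_split.
by apply: eq_bigr => i _; rewrite lf.
Qed.

Lemma sum_if_eq (I : finType) (i : I) (Q : pred I) (F : I -> V) :
  \sum_(j | Q j) (if j == i then F j else 0) = if Q i then F i else 0.
Proof.
rewrite -big_mkcondr /=; case: ifP => Qi.
  rewrite (bigD1 i) ?Qi ?eqxx //= big1 ?addr0 // => j /andP[/andP[_ /eqP ->]].
  by rewrite eqxx.
by rewrite big_pred0 // => j; case: eqP => [->|]; rewrite ?Qi ?andbF.
Qed.

End SpanSums.

(** Elements of an algebra that satisfy the relations of L(E).  That they
    generate the algebra, and that no vertex vanishes, is assumed separately where
    it matters. *)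
Record leavitt_family (k : fieldType) (R : pzAlg k) (E : quiver)
    (P : vertex E -> R) (A S : arrow E -> R) : Prop := {
  lf_PP : forall i j, P i ** P j = if i == j then P i else 0;
  lf_PA : forall a, P (source a) ** A a = A a;
  lf_AP : forall a, A a ** P (range a) = A a;
  lf_PS : forall a, P (range a) ** S a = S a;
  lf_SP : forall a, S a ** P (source a) = S a;
  lf_SA : forall a b, S a ** A b = if a == b then P (range a) else 0;
  lf_CK : forall i, i \notin sink E ->
            P i = \sum_(a | source a == i) A a ** S a;
  lf_unit : \sum_i P i = pz_one
}.

Section LeavittFamily.
Variables (k : fieldType) (R : pzAlg k) (E : quiver).
Variables (P : vertex E -> R) (A S : arrow E -> R).
Hypothesis LF : leavitt_family P A S.

Let PP := lf_PP LF.
Let PA := lf_PA LF.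
Let AP := lf_AP LF.
Let PS := lf_PS LF.
Let SP := lf_SP LF.
Let SA := lf_SA LF.

Lemma PPid i : P i ** P i = P i.
Proof. by rewrite PP eqxx. Qed.

Lemma PA_if i a : P i ** A a = if i == source a then A a else 0.
Proof.
have -> : P i ** A a = P i ** P (source a) ** A a by rewrite -pz_mulA PA.
by rewrite PP; case: eqP => [->|_]; rewrite ?PA ?pz_mul0l.
Qed.

Lemma PS_if i a : P i ** S a = if i == range a then S a else 0.
Proof.
have -> : P i ** S a = P i ** P (range a) ** S a by rewrite -pz_mulA PS.
by rewrite PP; case: eqP => [->|_]; rewrite ?PS ?pz_mul0l.
Qed.

Lemma AP_if i a : A a ** P i = if i == range a then A a else 0.
Proof.
have -> : A a ** P i = A a ** (P (range a) ** P i) by rewrite pz_mulA AP.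
by rewrite PP eq_sym; case: eqP => _; rewrite ?AP ?pz_mul0r.
Qed.

Lemma SP_if i a : S a ** P i = if i == source a then S a else 0.
Proof.
have -> : S a ** P i = S a ** (P (source a) ** P i) by rewrite pz_mulA SP.
by rewrite PP eq_sym; case: eqP => _; rewrite ?SP ?pz_mul0r.
Qed.

Lemma source_nsink (a : arrow E) : source a \notin sink E.
Proof. by rewrite inE negb_forall; apply/existsP; exists a; rewrite eqxx. Qed.

(** The separability idempotent of the commutative semisimple algebra spanned by
    the vertices. *)
Definition sep_idem : tpow R 2 := \sum_i t2 (P i) (P i).

Lemma bar_bd_sep_idem : bar_bd sep_idem = t1 pz_one.
Proof.
rewrite /sep_idem (lin_sum (@bar_bd_linear k R _)) -(lf_unit LF).
rewrite (lin_sum (@t1P k R)); apply: eq_bigr => i _.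
by rewrite bar_bd_t2 PPid.
Qed.

(** The value on a dual arrow a^* is forced: applying a derivation that kills the
    vertices to a^* b = 0 or p_(r a) gives delta a^* . b = - a^* . delta b, and
    delta a^* is the sum of the delta a^* . b b^* over the arrows b with the
    source of a. *)
Definition gen_deriv (x : lgen E) : tpow R 3 :=
  match x with
  | inl _ => 0
  | inr (inl a) => t3 (P (source a)) (A a) (P (range a))
  | inr (inr a) => - \sum_(b | source b == source a) t3 (S a) (A b) (S b)
  end.

Definition gen_val (x : lgen E) : R :=
  match x with inl i => P i | inr (inl a) => A a | inr (inr a) => S a end.

Definition word_val (s : seq (lgen E)) : R :=
  foldr (fun x y => gen_val x ** y) pz_one s.

Lemma lmul_gen_deriv_ck1 a b : lmul (S a) (gen_deriv (inr (inl b))) +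
  rmul (A b) (gen_deriv (inr (inr a))) = 0.
Proof.
rewrite /= lmul_t3 SP_if (linN (@rmul_linear k R _ _)).
rewrite (lin_sum (@rmul_linear k R _ _)).
rewrite (eq_bigr (fun c => if c == b then t3 (S a) (A b) (P (range b)) else 0)).
  rewrite sum_if_eq; case: eqP => _; first by rewrite subrr.
  by rewrite (lin0 (t3Pl _ _)) subr0.
move=> c _; rewrite rmul_t3 SA; case: eqP => [->//|_].
exact: lin0 (t3Pr _ _).
Qed.

Lemma gen_deriv_ck2 i : i \notin sink E ->
  \sum_(a | source a == i) (lmul (A a) (gen_deriv (inr (inr a))) +
                            rmul (S a) (gen_deriv (inr (inl a)))) = 0.
Proof.
move=> ni; rewrite big_split /=.
rewrite (eq_bigr (fun a => - \sum_(b | source b == i) t3 (A a ** S a) (A b) (S b))).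
  rewrite sumrN exchange_big /= addrC; apply/eqP; rewrite subr_eq0; apply/eqP.
  apply: eq_bigr => b /eqP sb.
  rewrite -(lin_sum (t3Pl (A b) (S b)) _ _ (fun a => A a ** S a)) -(lf_CK LF ni).
  by rewrite rmul_t3 PS -sb.
move=> a /eqP sa; rewrite (linN (@lmul_linear k R _ _)) sa; congr (- _).
rewrite (lin_sum (@lmul_linear k R _ _)); apply: eq_bigr => b _.
by rewrite lmul_t3.
Qed.

Lemma bar_bd_gen_deriv x : bar_bd (gen_deriv x) =
  lmul (gen_val x) sep_idem - rmul (gen_val x) sep_idem.
Proof.
rewrite /sep_idem (lin_sum (@lmul_linear k R _ _)) (lin_sum (@rmul_linear k R _ _)).
case: x => [i|[a|a]] /=.
- rewrite (lin0 (@bar_bd_linear k R _)); apply/esym/eqP; rewrite subr_eq0.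
  apply/eqP; apply: eq_bigr => j _; rewrite lmul_t2 rmul_t2 !PP eq_sym.
  case: eqP => [->//|_].
  by rewrite (lin0 (t2Pl _)) (lin0 (t2Pr _)).
- rewrite bar_bd_t3 PA AP; congr (_ - _).
    rewrite (eq_bigr (fun i => if i == range a then t2 (A a) (P i) else 0)).
      by rewrite sum_if_eq.
    move=> i _; rewrite lmul_t2 AP_if; case: eqP => // _.
    exact: lin0 (t2Pl _).
  rewrite (eq_bigr (fun i => if i == source a then t2 (P i) (A a) else 0)).
    by rewrite sum_if_eq.
  move=> i _; rewrite rmul_t2 PA_if; case: eqP => // _.
  exact: lin0 (t2Pr _).
- rewrite (linN (@bar_bd_linear k R _)) (lin_sum (@bar_bd_linear k R _)) -sumrN.
  transitivity (t2 (S a) (P (source a)) - t2 (P (range a)) (S a)).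
    rewrite (lf_CK LF (source_nsink a)) (lin_sum (t2Pr _)).
    have -> : t2 (P (range a)) (S a) =
      \sum_(b | source b == source a) t2 (S a ** A b) (S b).
      rewrite (eq_bigr (fun b => if b == a then t2 (P (range a)) (S a) else 0)).
        by rewrite sum_if_eq eqxx.
      move=> b _; rewrite SA eq_sym; case: eqP => [->//|_].
      exact: lin0 (t2Pl _).
    rewrite -sumrB; apply: eq_bigr => b _.
    by rewrite bar_bd_t3 opprB.
  congr (_ - _).
    rewrite (eq_bigr (fun i => if i == source a then t2 (S a) (P i) else 0)).
      by rewrite sum_if_eq.
    move=> i _; rewrite lmul_t2 SP_if; case: eqP => // _.
    exact: lin0 (t2Pl _).
  rewrite (eq_bigr (fun i => if i == range a then t2 (P i) (S a) else 0)).
    by rewrite sum_if_eq.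
  move=> i _; rewrite rmul_t2 PS_if; case: eqP => // _.
  exact: lin0 (t2Pr _).
Qed.

End LeavittFamily.

(** * The reduced Hochschild complex of a Leavitt family *)

Section LowTensorDegrees.
Variables (k : fieldType) (R : pzAlg k) (deg : int -> R -> Prop).

Lemma t1_gr d x : deg d x -> t1 x \in @hh_gr k R deg d 0.
Proof.
move=> dx; have := @tens_gr k R deg 0 [ffun i : 'I_1 => nth 0 [:: x] i] (fun=> d).
rewrite big_ord_recl big_ord0 addr0; apply=> -[[|//] ?]; by rewrite ffunE.
Qed.

Lemma t2_gr d d' x y : deg d x -> deg d' y -> t2 x y \in @hh_gr k R deg (d + d') 1.
Proof.
move=> dx dy.
have := @tens_gr k R deg 1 [ffun i : 'I_2 => nth 0 [:: x; y] i]
  (fun i => nth 0 [:: d; d'] i).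
rewrite !big_ord_recl big_ord0 addr0 /=; apply=> -[[|[|//]] ?]; by rewrite ffunE.
Qed.

Lemma t3_gr d d' d'' x y z : deg d x -> deg d' y -> deg d'' z ->
  t3 x y z \in @hh_gr k R deg (d + d' + d'') 2.
Proof.
move=> dx dy dz.
have := @tens_gr k R deg 2 [ffun i : 'I_3 => nth 0 [:: x; y; z] i]
  (fun i => nth 0 [:: d; d'; d''] i).
rewrite !big_ord_recl big_ord0 addr0 addrA /=.
by apply=> -[[|[|[|//]]] ?]; rewrite ffunE.
Qed.

End LowTensorDegrees.

Section LeavittGrading.
Variables (k : fieldType) (R : pzAlg k) (E : quiver).
Variables (P : vertex E -> R) (A S : arrow E -> R).
Hypothesis LF : leavitt_family P A S.

Local Notation gen_val := (gen_val P A S).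
Local Notation word_val := (word_val P A S).
Local Notation gen_deriv := (gen_deriv P A S).
Local Notation e := (sep_idem P).

Definition wdeg (s : seq (lgen E)) : int := \sum_(x <- s) lgen_deg x.

Lemma wdeg_cat s t : wdeg (s ++ t) = wdeg s + wdeg t.
Proof. exact: big_cat. Qed.

Lemma wdeg_cons x s : wdeg (x :: s) = lgen_deg x + wdeg s.
Proof. exact: big_cons. Qed.

Lemma wdeg_nil : wdeg [::] = 0.
Proof. exact: big_nil. Qed.

Lemma word_val_cat s t : word_val (s ++ t) = word_val s ** word_val t.
Proof.
elim: s => [|x s IH] /=; first by rewrite pz_mul1l.
by rewrite IH pz_mulA.
Qed.

Lemma word_val1 x : word_val [:: x] = gen_val x.
Proof. exact: pz_mul1r. Qed.

Variable deg : int -> R -> Prop.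
Hypothesis degE : forall d x,
  deg d x <-> x \in span (fun y => exists2 s, wdeg s = d & y = word_val s).

Lemma deg_word s : deg (wdeg s) (word_val s).
Proof. by apply/degE/span_gen; exists s. Qed.

Lemma deg_gen x : deg (lgen_deg x) (gen_val x).
Proof. by have := deg_word [:: x]; rewrite wdeg_cons wdeg_nil addr0 word_val1. Qed.

Lemma degP i : deg 0 (P i).
Proof. exact: (deg_gen (inl i)). Qed.

Lemma degA a : deg 1 (A a).
Proof. exact: (deg_gen (inr (inl a))). Qed.

Lemma degS a : deg (-1) (S a).
Proof. exact: (deg_gen (inr (inr a))). Qed.

Lemma deg_lin d c x y : deg d x -> deg d y -> deg d (c *: x + y).
Proof. by move=> /degE dx /degE dy; apply/degE; rewrite rpredD ?rpredZ. Qed.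

Lemma deg0 d : deg d 0.
Proof. by apply/degE; exact: rpred0. Qed.

Lemma deg_sum d (I : Type) (r : seq I) (Q : pred I) F :
  (forall i, Q i -> deg d (F i)) -> deg d (\sum_(i <- r | Q i) F i).
Proof. by move=> H; apply/degE/rpred_sum => i Qi; apply/degE/H. Qed.

Lemma deg1 : deg 0 pz_one.
Proof. by have := deg_word [::]; rewrite wdeg_nil. Qed.

Lemma degM d d' x y : deg d x -> deg d' y -> deg (d + d') (x ** y).
Proof.
move=> dx /degE dy; apply/degE; apply: (span_map (pz_mul_linr x)) dy.
move=> _ [t <- ->]; move/degE: dx; apply: (span_map (pz_mul_linl _)).
move=> _ [s <- ->]; rewrite -word_val_cat; apply: span_gen.
by exists (s ++ t); rewrite ?wdeg_cat.
Qed.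

Lemma gr_gen_deriv x : gen_deriv x \in @hh_gr k R deg (lgen_deg x) 2.
Proof.
case: x => [i|[a|a]] /=; first exact: rpred0.
  by have := t3_gr (degP (source a)) (degA a) (degP (range a)).
rewrite rpredN; apply: rpred_sum => b _.
by have := t3_gr (degS a) (degA b) (degS b).
Qed.

Variable delta : R -> tpow R 3.
Hypothesis delta_linear : linear delta.
Hypothesis delta_der :
  forall x y, delta (x ** y) = lmul x (delta y) + rmul y (delta x).
Hypothesis delta_gen : forall x, delta (gen_val x) = gen_deriv x.
Hypothesis words_span : forall x, x \in span (fun y => exists s, y = word_val s).

Lemma delta1 : delta pz_one = 0.
Proof.
have := delta_der pz_one pz_one; rewrite pz_mul1l lmul1 rmul1.
by move/eqP; rewrite -subr_eq subrr => /eqP.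
Qed.

Lemma gr_delta d x : deg d x -> delta x \in @hh_gr k R deg d 2.
Proof.
move/degE; apply: (span_map delta_linear) => _ [s <- ->].
elim: s => [|g s IH] /=; first by rewrite delta1; exact: rpred0.
rewrite wdeg_cons delta_der delta_gen; apply: rpredD.
  by apply: (gr_lmul degM) IH; exact: deg_gen.
by rewrite addrC; apply: (gr_rmul degM); [exact: deg_word|exact: gr_gen_deriv].
Qed.

Lemma bar_bd_delta x : bar_bd (delta x) = lmul x e - rmul x e.
Proof.
apply: (span_eq (f := fun x => bar_bd (delta x))
  (g := fun x => lmul x e - rmul x e)) (words_span x).
- exact: (linear_compose (@bar_bd_linear k R 1) delta_linear).
- exact: linear_sub (lmulP e) (rmulP e).
move=> _ [s ->]; elim: s => [|g s IH] /=.
  by rewrite delta1 lmul1 rmul1 subrr (lin0 (@bar_bd_linear k R _)).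
rewrite delta_der (linD (@bar_bd_linear k R _)) bar_bd_lmul bar_bd_rmul IH delta_gen.
rewrite (bar_bd_gen_deriv LF) (linB (@lmul_linear k R _ _)).
rewrite (linB (@rmul_linear k R _ _)) lmulM rmulM lrmulC.
by rewrite addrA subrK.
Qed.

Lemma gr_sep_idem : e \in @hh_gr k R deg 0 1.
Proof.
by apply: rpred_sum => i _; have := t2_gr (degP i) (degP i).
Qed.

(** Generators of the bimodule spanned by the values of delta on the arrows.  It
    contains all values of delta ([delta_span]), and [hh_proj_normal] puts its
    image under the projection in normal form. *)
Definition deriv_tensor (t : tpow R 3) : Prop := exists x a y,
  t = t3 (x ** P (source a)) (A a) (P (range a) ** y).

Lemma delta_span x : delta x \in span deriv_tensor.
Proof.
have Kl y t : t \in span deriv_tensor -> lmul y t \in span deriv_tensor.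
  apply: span_map; first exact: lmul_linear.
  move=> _ [u [a [v ->]]]; apply: span_gen; exists (y ** u), a, v.
  by rewrite lmul_t3 pz_mulA.
have Kr y t : t \in span deriv_tensor -> rmul y t \in span deriv_tensor.
  apply: span_map; first exact: rmul_linear.
  move=> _ [u [a [v ->]]]; apply: span_gen; exists u, a, (v ** y).
  by rewrite rmul_t3 pz_mulA.
apply: (span_map delta_linear) (words_span x) => _ [s ->].
elim: s => [|g s IH] /=; first by rewrite delta1; exact: rpred0.
rewrite delta_der delta_gen; apply: rpredD; first exact: Kl.
apply: Kr; case: g => [i|[a|a]] /=; first exact: rpred0.
  apply: span_gen; exists (P (source a)), a, (P (range a)).
  by rewrite !(lf_PP LF) !eqxx.
rewrite rpredN; apply: rpred_sum => b /eqP sb.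
apply: span_gen; exists (S a), b, (S b).
by rewrite sb (lf_SP LF) (lf_PS LF).
Qed.

End LeavittGrading.

Section LeavittReduction.
Variables (k : fieldType) (R : pzAlg k) (E : quiver).
Variables (P : vertex E -> R) (A S : arrow E -> R).
Hypothesis LF : leavitt_family P A S.

(** The Q-part of the diagonal: the projection to the sum of the p_i L p_i with i
    in Q. *)
Definition corner (Q : pred (vertex E)) (z : R) : R :=
  \sum_(i | Q i) P i ** z ** P i.

Lemma corner_linear Q : linear (corner Q).
Proof.
apply: sum_linear => i; apply: (linear_compose (pz_mul_linl (P i))).
exact: pz_mul_linr.
Qed.

Lemma cornerK Q Q' z : corner Q (corner Q' z) = corner (predI Q Q') z.
Proof.
rewrite /corner (eq_bigr (fun i => if Q' i then P i ** z ** P i else 0)).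
  by rewrite -big_mkcondr.
move=> i _; rewrite pz_sumr pz_suml.
rewrite (eq_bigr (fun j => if j == i then P j ** z ** P j else 0)).
  exact: sum_if_eq.
move=> j _; have [->|ne] := eqVneq j i.
  by rewrite !pz_mulA (PPid LF) -!pz_mulA (PPid LF).
by rewrite !pz_mulA (lf_PP LF) eq_sym (negbTE ne) !pz_mul0l.
Qed.

Definition nsink : pred (vertex E) := [pred i | i \notin sink E].

(** On closed paths this is rotation, see [cycle_shift_path]. *)
Definition cycle_shift (z : R) : R := \sum_a S a ** z ** A a.

Lemma cycle_shift_linear : linear cycle_shift.
Proof.
apply: sum_linear => a; apply: (linear_compose (pz_mul_linl (A a))).
exact: pz_mul_linr.
Qed.

Lemma corner_cycle_shift z : corner predT (cycle_shift z) = cycle_shift z.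
Proof.
rewrite /cycle_shift (lin_sum (@corner_linear _)); apply: eq_bigr => a _.
rewrite /corner (eq_bigr (fun i => if i == range a then S a ** z ** A a else 0)).
  exact: sum_if_eq.
move=> i _; rewrite !pz_mulA (PS_if LF).
case: eqP => [->|_]; last by rewrite !pz_mul0l.
by rewrite -!pz_mulA (lf_AP LF).
Qed.

Definition cycle_lift (z : R) : tpow R 2 := \sum_a t2 (S a ** z) (A a).

Lemma cycle_lift_linear : linear cycle_lift.
Proof.
apply: sum_linear => a; apply: (linear_compose (t2Pl (A a))).
exact: pz_mul_linr.
Qed.

Fact swap_mul_multilinear :
  multilinear (fun a : {ffun 'I_2 -> R} => a ord_max ** a ord0).
Proof.
move=> a [[|[|//]] p] c x y; rewrite !ffunE /=.
  exact: pz_mul_linr.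
exact: pz_mul_linl.
Qed.

Fact swap_mul_exists : {f : tpow R 2 -> R | linear f /\
  forall x y, f (t2 x y) = y ** x}.
Proof.
exists (tlift (fun a : {ffun 'I_2 -> R} => a ord_max ** a ord0)); split.
  exact: tlift_linear swap_mul_multilinear.
by move=> x y; rewrite (tlift_tens swap_mul_multilinear) !ffunE.
Qed.

Definition swap_mul := sval swap_mul_exists.
Lemma swap_mul_linear : linear swap_mul.
Proof. by case: (svalP swap_mul_exists). Qed.
Lemma swap_mul_t2 x y : swap_mul (t2 x y) = y ** x.
Proof. by case: (svalP swap_mul_exists). Qed.

(** Summing a a^* z first over the arrows with a given source yields p_i z. *)
Lemma sum_AS Q z :
  \sum_(a | Q (source a)) A a ** S a ** z = \sum_(i | nsink i && Q i) P i ** z.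
Proof.
rewrite (partition_big (@source E) (fun i => nsink i && Q i)) /=; last first.
  by move=> a ->; rewrite andbT; exact: source_nsink.
apply: eq_bigr => i /andP[ni Qi]; rewrite (lf_CK LF ni) pz_suml.
by apply: eq_bigl => a; case: eqP => [->|_]; rewrite ?Qi ?andbF.
Qed.

Lemma swap_mul_lift z : corner nsink z = z -> swap_mul (cycle_lift z) = z.
Proof.
move=> cz; rewrite /cycle_lift (lin_sum swap_mul_linear).
rewrite (eq_bigr (fun a => A a ** S a ** z)) => [|a _]; last first.
  by rewrite swap_mul_t2 pz_mulA.
rewrite (sum_AS predT) -[in RHS]cz /corner; apply: eq_big => [i|i ni].
  by rewrite andbT.
rewrite -[in LHS]cz /corner pz_sumr.
rewrite (eq_bigr (fun j => if j == i then P j ** z ** P j else 0)).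
  by rewrite sum_if_eq; case: ifP ni => //; rewrite andbT => ->.
move=> j _; rewrite !pz_mulA (lf_PP LF) eq_sym.
by case: eqP => [->|_]; rewrite ?pz_mul0l.
Qed.

Lemma S_corner a z : corner nsink z = z ->
  S a ** z ** P (source a) = S a ** z.
Proof.
move=> cz; rewrite -cz /corner pz_sumr pz_suml; apply: eq_bigr => i _.
rewrite !pz_mulA (SP_if LF); case: eqP => [->|_]; last by rewrite !pz_mul0l.
by rewrite -pz_mulA (lf_PP LF) eqxx.
Qed.

(** The boundary of a^* z (x) a is a^* z a - a a^* z, and the a a^* sum to the
    identity of the corners over the vertices that are not sinks. *)
Lemma hh_bd_cycle_lift z : corner nsink z = z ->
  hh_bd (cycle_lift z) = t1 (cycle_shift z - z).
Proof.
move=> cz; rewrite /cycle_lift (lin_sum (@hh_bd_linear k R 0)).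
rewrite (linB (@t1P k R)) -[X in _ - t1 X](swap_mul_lift cz).
rewrite /cycle_lift (lin_sum swap_mul_linear) /cycle_shift.
rewrite !(lin_sum (@t1P k R)) -sumrB; apply: eq_bigr => a _.
by rewrite (hh_bd_t2 (S a ** z) (A a)) swap_mul_t2.
Qed.

Variable delta : R -> tpow R 3.
Hypothesis delta_linear : linear delta.
Hypothesis delta_span : forall x, delta x \in span (deriv_tensor P A).
Hypothesis delta_A :
  forall a, delta (A a) = t3 (P (source a)) (A a) (P (range a)).

Local Notation e := (sep_idem P).
Local Notation hh_proj := (hh_proj e delta).

Lemma hh_proj_t1 x : hh_proj (t1 x) = t1 (corner predT x).
Proof.
rewrite /hh_proj tsnoc_t1 rproj0_t2 // rmul1 /sep_idem.
rewrite (lin_sum (@lmul_linear k R _ _)) (lin_sum (@wrap_linear k R _)).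
rewrite /corner (lin_sum (@t1P k R)); apply: eq_bigr => i _.
by rewrite lmul_t2 wrap_t2 pz_mulA.
Qed.

Lemma hh_proj_t2 x y : hh_proj (t2 x y) = wrap (lmul x (delta y)).
Proof. by rewrite /hh_proj tsnoc_t2 rproj1_t3 // rmul1. Qed.

Lemma hh_proj_lift z : corner nsink z = z ->
  hh_proj (cycle_lift z) = cycle_lift z.
Proof.
move=> cz; rewrite /cycle_lift (lin_sum (@hh_proj_linear k R e delta delta_linear 1)).
apply: eq_bigr => a _; rewrite hh_proj_t2 delta_A lmul_t3 wrap_t3.
by rewrite S_corner // pz_mulA (lf_PS LF).
Qed.

(** Every element of the image of the projection is in normal form: on the value
    x (x) (v p_s (x) a (x) p_r w) it is p_r w x v p_s (x) a, which z = a w x v p_s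
    reproduces, as b^* a = 0 unless b = a. *)
Lemma hh_proj_normal t (z := swap_mul (hh_proj t)) :
  corner nsink z = z /\ cycle_lift z = hh_proj t.
Proof.
have lp := @hh_proj_linear k R e delta delta_linear 1.
have ls := linear_compose swap_mul_linear lp.
suff H x u : u \in span (deriv_tensor P A) ->
    let w := swap_mul (wrap (lmul x u)) in
    corner nsink w = w /\ cycle_lift w = wrap (lmul x u).
  rewrite /z; split.
    move: t @z; apply: (tpow_eq _ ls) => [|a].
      exact: (linear_compose (@corner_linear nsink) ls).
    by rewrite tens2 hh_proj_t2; have [] := H (a ord0) _ (delta_span (a ord_max)).
  move: t @z; apply: (tpow_eq _ lp) => [|a].
    exact: (linear_compose cycle_lift_linear ls).
  by rewrite tens2 hh_proj_t2; have [] := H (a ord0) _ (delta_span (a ord_max)).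
have lw : linear (fun u : tpow R 3 => wrap (lmul x u)).
  exact: (linear_compose (@wrap_linear k R 1) (@lmul_linear k R 2 x)).
have lsw := linear_compose swap_mul_linear lw.
have key a v w :
    let t := wrap (lmul x (t3 (v ** P (source a)) (A a) (P (range a) ** w))) in
    corner nsink (swap_mul t) = swap_mul t /\ cycle_lift (swap_mul t) = t.
  rewrite lmul_t3 wrap_t3 /= swap_mul_t2; split.
    rewrite /corner (eq_bigr (fun i => if i == source a then
      A a ** (P (range a) ** w ** (x ** (v ** P (source a)))) else 0)).
      by rewrite sum_if_eq (source_nsink a : nsink (source a)).
    move=> i _; rewrite !pz_mulA (PA_if LF).
    case: eqP => [->|_]; last by rewrite !pz_mul0l.
    by rewrite -[_ ** P _ ** P _]pz_mulA (lf_PP LF) eqxx.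
  rewrite /cycle_lift (eq_bigr (fun b => if b == a then
    t2 (P (range a) ** w ** (x ** (v ** P (source a)))) (A a) else 0)).
    by rewrite sum_if_eq.
  move=> b _; rewrite pz_mulA (lf_SA LF); case: eqP => [->|_].
    by rewrite !pz_mulA (lf_PP LF) eqxx.
  by rewrite pz_mul0l (lin0 (t2Pl _)).
move=> uK /=; split.
  apply: (span_eq (f := fun u => corner nsink (swap_mul (wrap (lmul x u)))) _ lsw) uK.
    exact: (linear_compose (@corner_linear nsink) lsw).
  by move=> _ [v [a [w ->]]]; have [] := key a v w.
apply: (span_eq (f := fun u => cycle_lift (swap_mul (wrap (lmul x u)))) _ lw) uK.
  exact: (linear_compose cycle_lift_linear lsw).
by move=> _ [v [a [w ->]]]; have [] := key a v w.
Qed.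

End LeavittReduction.

(** * Monomials and their filtration *)

Section NormalForms.
Variables (k : fieldType) (R : pzAlg k) (E : quiver).
Variables (P : vertex E -> R) (A S : arrow E -> R).
Hypothesis LF : leavitt_family P A S.

Local Notation gen_val := (gen_val P A S).
Local Notation word_val := (word_val P A S).
Local Notation corner := (corner P).
Local Notation cycle_shift := (cycle_shift A S).
Local Notation nsink := (@nsink E).

Definition path_val (u : seq (arrow E)) : R := foldr (fun a x => A a ** x) pz_one u.
(** The dual v^* of the path v, with the factors in reverse order. *)
Definition ghost_val (v : seq (arrow E)) : R := foldr (fun a x => x ** S a) pz_one v.
Definition monomial u i v : R := path_val u ** P i ** ghost_val v.

Lemma ghost_val_rcons v a : ghost_val (rcons v a) = S a ** ghost_val v.
Proof.
elim: v => [|b v IH] /=; first by rewrite pz_mul1l pz_mul1r.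
by rewrite IH pz_mulA.
Qed.

Lemma path_val_rcons u a : path_val (rcons u a) = path_val u ** A a.
Proof.
elim: u => [|b u IH] /=; first by rewrite pz_mul1l pz_mul1r.
by rewrite IH pz_mulA.
Qed.

Lemma P_path j a u : P j ** path_val (a :: u) =
  if j == source a then path_val (a :: u) else 0.
Proof. by rewrite /= pz_mulA (PA_if LF); case: eqP => // _; rewrite pz_mul0l. Qed.

Lemma ghost_P j a v : ghost_val (a :: v) ** P j =
  if j == source a then ghost_val (a :: v) else 0.
Proof. by rewrite /= -pz_mulA (SP_if LF); case: eqP => // _; rewrite pz_mul0r. Qed.

Definition mono_bound (m : int) (N : nat) (y : R) : Prop := exists u i v,
  [/\ (size u)%:Z - (size v)%:Z = m, (minn (size u) (size v) <= N)%N
    & y = monomial u i v].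

(** The layers of the degree m part, filtered by the length of the shorter of the
    two paths of a monomial. *)
Definition Fil m N : {pred R} := span (mono_bound m N).
HB.instance Definition _ m N := GRing.SubmodClosed.on (Fil m N).

Lemma monomial_Fil m N u i v : (size u)%:Z - (size v)%:Z = m ->
  (minn (size u) (size v) <= N)%N -> monomial u i v \in Fil m N.
Proof. by move=> *; apply: span_gen; exists u, i, v. Qed.

Lemma Fil_map m N (f : R -> R) (T : submodClosed R) : linear f ->
  (forall u i v, (size u)%:Z - (size v)%:Z = m ->
     (minn (size u) (size v) <= N)%N -> f (monomial u i v) \in T) ->
  forall x, x \in Fil m N -> f x \in T.
Proof.
move=> lf H; apply: span_map => // _ [u [i [v [uv mN ->]]]]; exact: H.
Qed.

Lemma Fil_sub m N N' : (N <= N')%N -> {subset Fil m N <= Fil m N'}.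
Proof.
move=> NN'; apply: (Fil_map (f := id)) => // u i v uv mN.
by apply: monomial_Fil => //; exact: leq_trans NN'.
Qed.

Lemma P_monomial j u i v : P j ** monomial u i v = 0 \/
  P j ** monomial u i v = monomial u i v.
Proof.
rewrite /monomial; case: u => [|a u].
  rewrite /= !pz_mul1l pz_mulA (lf_PP LF).
  by case: eqP => [->|_]; [right|left; rewrite pz_mul0l].
rewrite (pz_mulA (P j)) (pz_mulA (P j)) P_path; case: eqP => _; [by right|left].
by rewrite !pz_mul0l.
Qed.

Lemma monomial_P j u i v : monomial u i v ** P j = 0 \/
  monomial u i v ** P j = monomial u i v.
Proof.
rewrite /monomial; case: v => [|a v].
  rewrite /= !pz_mul1r -pz_mulA (lf_PP LF).
  by case: eqP => [->|_]; [right|left; rewrite pz_mul0r].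
rewrite -(pz_mulA _ _ (P j)) ghost_P; case: eqP => _; [by right|left].
by rewrite pz_mul0r.
Qed.

Lemma A_monomial a u i v : A a ** monomial u i v = monomial (a :: u) i v.
Proof. by rewrite /monomial /= !pz_mulA. Qed.

Lemma S_monomial a u i v : S a ** monomial (a :: u) i v =
  P (range a) ** monomial u i v.
Proof. by rewrite -A_monomial pz_mulA (lf_SA LF) eqxx. Qed.

Lemma S_monomial0 a b u i v : a != b -> S a ** monomial (b :: u) i v = 0.
Proof. by move=> ab; rewrite -A_monomial pz_mulA (lf_SA LF) (negbTE ab) pz_mul0l. Qed.

Lemma S_monomial_nil a i v : S a ** monomial [::] i v =
  if i == source a then monomial [::] (range a) (rcons v a) else 0.
Proof.
rewrite /monomial /= !pz_mul1l pz_mulA (SP_if LF) ghost_val_rcons.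
by case: eqP => _; rewrite ?pz_mul0l // pz_mulA (lf_PS LF).
Qed.

Lemma monomial_A a u i v : monomial u i (a :: v) ** A a =
  monomial u i v ** P (range a).
Proof. by rewrite /monomial /= -!pz_mulA (lf_SA LF) eqxx. Qed.

Lemma monomial_A0 a b u i v : b != a -> monomial u i (b :: v) ** A a = 0.
Proof.
by move=> ab; rewrite /monomial /= -!pz_mulA (lf_SA LF) (negbTE ab) !pz_mul0r.
Qed.

Lemma monomial_A_nil a u i : monomial u i [::] ** A a =
  if i == source a then monomial (rcons u a) (range a) [::] else 0.
Proof.
rewrite /monomial /= !pz_mul1r -pz_mulA (PA_if LF) path_val_rcons.
by case: eqP => _; rewrite ?pz_mul0r // -pz_mulA (lf_AP LF).
Qed.

(** Multiplying a monomial by a generator from the left gives a monomial or 0. *)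
Lemma word_Fil s : exists N, word_val s \in Fil (wdeg s) N.
Proof.
elim: s => [|g s [N IH]] /=.
  exists 0%N; rewrite wdeg_nil -(lf_unit LF); apply: rpred_sum => i _.
  have -> : P i = monomial [::] i [::] by rewrite /monomial /= pz_mul1l pz_mul1r.
  exact: monomial_Fil.
exists N.+1; rewrite wdeg_cons; move: IH.
apply: Fil_map; first exact: pz_mul_linr.
move=> u i v uv mN.
have Pin j u' i' v' : (size u')%:Z - (size v')%:Z = lgen_deg g + wdeg s ->
    (minn (size u') (size v') <= N.+1)%N ->
    P j ** monomial u' i' v' \in Fil (lgen_deg g + wdeg s) N.+1.
  by case: (P_monomial j u' i' v') => -> *; [exact: rpred0|exact: monomial_Fil].
case: g Pin => [j|[a|a]] /= Pin.
- by apply: Pin; lia.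
- by rewrite A_monomial; apply: monomial_Fil => /=; lia.
case: u uv mN => [|b u] /= uv mN.
  rewrite S_monomial_nil; case: eqP => _; last exact: rpred0.
  by apply: monomial_Fil; rewrite /= ?size_rcons; lia.
have [->|ab] := eqVneq a b; last by rewrite S_monomial0 //; exact: rpred0.
by rewrite S_monomial; apply: Pin; lia.
Qed.

Variable deg : int -> R -> Prop.
Hypothesis degE : forall d x,
  deg d x <-> x \in span (fun y => exists2 s, wdeg s = d & y = word_val s).

Lemma deg_Fil d x : deg d x -> exists N, x \in Fil d N.
Proof.
move=> /degE /spanP; elim=> [|a y z [s sd ->] _ [N zN]].
  by exists 0%N; exact: rpred0.
have [N' sN'] := word_Fil s; exists (maxn N N').
apply: rpredD; last by apply: Fil_sub zN; exact: leq_maxl.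
by apply/rpredZ; rewrite -sd; apply: Fil_sub sN'; exact: leq_maxr.
Qed.

Lemma deg_path u : deg (size u)%:Z (path_val u).
Proof.
elim: u => [|a u IH] /=; first exact: deg1 degE.
have := degM degE (degA degE a) IH.
by congr deg; lia.
Qed.

Lemma deg_ghost v : deg (- (size v)%:Z) (ghost_val v).
Proof.
elim: v => [|a v IH] /=; first exact: deg1 degE.
have := degM degE IH (degS degE a).
by congr deg; lia.
Qed.

Lemma Fil_deg d N x : x \in Fil d N -> deg d x.
Proof.
move=> xF; apply/degE; move: x xF; apply: (Fil_map (f := id)) => //.
move=> u i v uv _; apply/degE.
have := degM degE (degM degE (deg_path u) (degP degE i)) (deg_ghost v).
by congr deg; lia.
Qed.

Lemma corner_Fil Q m N x : x \in Fil m N -> corner Q x \in Fil m N.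
Proof.
apply: Fil_map; first exact: corner_linear.
move=> u i v uv mN; apply: rpred_sum => j _.
case: (P_monomial j u i v) => ->; first by rewrite pz_mul0l rpred0.
by case: (monomial_P j u i v) => ->; [exact: rpred0|exact: monomial_Fil].
Qed.

(** A sink starts no path, so that only the idempotents survive in its corner. *)
Lemma corner_sink_Fil m N x : x \in Fil m N ->
  corner (predC nsink) x \in Fil m 0.
Proof.
apply: Fil_map; first exact: corner_linear.
move=> u i v uv mN; apply: rpred_sum => j /negPn js.
have sj a : (j == source a) = false.
  by apply/negP => /eqP e; have := source_nsink a; rewrite -e js.
case: u uv mN => [|a u] uv mN; last first.
  by rewrite -A_monomial pz_mulA (PA_if LF) sj !pz_mul0l rpred0.
case: v uv mN => [|a v] uv mN; last first.
  rewrite -(pz_mulA (P j)) /monomial -(pz_mulA _ _ (P j)) ghost_P sj.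
  by rewrite !pz_mul0r rpred0.
case: (P_monomial j [::] i [::]) => ->; first by rewrite pz_mul0l rpred0.
by case: (monomial_P j [::] i [::]) => ->; [exact: rpred0|exact: monomial_Fil].
Qed.

(** The conjugation z |-> a^* z a strips the first arrow of u and that of v, or
    yields 0.  If one of the paths is empty, the shorter length is 0 and stays
    so; the truncated predecessor [N.-1] covers both cases. *)
Lemma cycle_shift_Fil m N x : x \in Fil m N -> cycle_shift x \in Fil m N.-1.
Proof.
apply: Fil_map; first exact: cycle_shift_linear.
move=> u i v uv mN; apply: rpred_sum => a _.
have PP_in u' i' v' : (size u')%:Z - (size v')%:Z = m ->
    (minn (size u') (size v') <= N.-1)%N ->
    P (range a) ** monomial u' i' v' ** P (range a) \in Fil m N.-1.
  case: (P_monomial (range a) u' i' v') => -> uv' mN'.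
    by rewrite pz_mul0l rpred0.
  case: (monomial_P (range a) u' i' v') => ->; first exact: rpred0.
  exact: monomial_Fil.
case: u uv mN => [|b u] uv mN.
  rewrite S_monomial_nil; case: eqP => [ia|_]; last by rewrite pz_mul0l rpred0.
  case: v uv mN => [|c v] uv mN.
    rewrite /monomial /= -!pz_mulA pz_mul1l !pz_mulA pz_mul1r.
    rewrite -pz_mulA (lf_SA LF) eqxx.
    have := PP_in [::] (range a) [::] uv; rewrite /monomial /= pz_mul1l pz_mul1r.
    by rewrite !(PPid LF); apply.
  have [ca|ca] := eqVneq c a; last first.
    by rewrite rcons_cons monomial_A0 // rpred0.
  rewrite rcons_cons ca monomial_A.
  case: (monomial_P (range a) [::] (range a) (rcons v a)) => ->.
    exact: rpred0.
  by apply: monomial_Fil; rewrite /= ?size_rcons //; move: uv => /=; lia.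
case: (eqVneq a b) PP_in => [->|ab] PP_in; last first.
  by rewrite S_monomial0 // pz_mul0l rpred0.
rewrite S_monomial -pz_mulA.
case: v uv mN => [|c v] uv mN.
  rewrite monomial_A_nil; case: eqP => _; last by rewrite pz_mul0r rpred0.
  case: (P_monomial (range b) (rcons u b) (range b) [::]) => ->.
    exact: rpred0.
  by apply: monomial_Fil; rewrite /= ?size_rcons ?minn0.
have [ca|ca] := eqVneq c b; last first.
  by rewrite monomial_A0 // pz_mul0r rpred0.
rewrite ca monomial_A (pz_mulA (P (range b))).
by apply: PP_in; move: uv mN => /=; lia.
Qed.

(** z = y + psi z is in each lower layer, since psi z is. *)
Lemma fixed_Fil0 m N y z : y \in Fil m 0 -> z \in Fil m N ->
  z = y + cycle_shift z -> z \in Fil m 0.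
Proof.
move=> yF; elim: N => [//|N IH] zN ez; apply: IH => //.
rewrite ez; apply: rpredD; first exact: Fil_sub yF.
exact: (cycle_shift_Fil zN).
Qed.

Lemma corner_split x : corner predT x = corner nsink x + corner (predC nsink) x.
Proof. exact: bigID. Qed.

(** Replace y by psi y, to which it is congruent, until the lowest layer is
    reached.  Only the part of y over the vertices that are not sinks can be
    replaced; the part over the sinks is in the lowest layer already. *)
Lemma coker_Fil0 m N y : y \in Fil m N -> corner predT y = y ->
  exists y0 z, [/\ y0 \in Fil m 0, corner predT y0 = y0, z \in Fil m N,
    corner nsink z = z & y = y0 + (z - cycle_shift z)].
Proof.
elim: N y => [|N IH] y yN cy.
  exists y, 0; split=> //; rewrite ?rpred0 //.
    exact: lin0 (@corner_linear _ _ _ _ _).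
  by rewrite (lin0 (@cycle_shift_linear _ _ _ _ _)) subrr addr0.
have cT Q x : corner predT (corner Q x) = corner Q x by rewrite (cornerK LF).
have cN x : corner nsink (corner nsink x) = corner nsink x.
  by rewrite (cornerK LF); apply: eq_bigl => i /=; rewrite andbb.
pose z1 := corner nsink y.
have z1N : z1 \in Fil m N.+1 by exact: corner_Fil.
have [|| y0 [z [y0F cy0 zN cz ey]]] := IH (cycle_shift z1 + corner (predC nsink) y).
- apply: rpredD; first exact: (cycle_shift_Fil z1N).
  by apply: Fil_sub (corner_sink_Fil yN).
- by rewrite (linD (@corner_linear _ _ _ _ _)) (corner_cycle_shift LF) cT.
exists y0, (z + z1); split=> //.
- by apply: rpredD => //; exact: Fil_sub zN.
- by rewrite (linD (@corner_linear _ _ _ _ _)) cz cN.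
rewrite (linD (@cycle_shift_linear _ _ _ _ _)).
have ec : y = z1 + corner (predC nsink) y by rewrite -[LHS]cy corner_split.
rewrite [LHS]ec; move: ey; move: (cycle_shift z1) (cycle_shift z) (corner _ y).
move=> p1 p c ey; by rewrite opprD addrACA (addrA y0) -ey [RHS]addrC subrKA.
Qed.

End NormalForms.

(** * Homology classes and the reduction to the lowest layer *)

Section HomologyClasses.
Variables (k : fieldType) (R : pzAlg k) (deg : int -> R -> Prop) (m : int).
Variables (n : nat) (U : lmodType k) (iota : U -> hh_chain R n).

Local Notation gr m n := (@hh_gr k R deg m n).
Local Notation cycles := (@gr_cycle k R deg m n).

Hypothesis iota_linear : linear iota.
Hypothesis iota_cycle : forall u, iota u \in cycles.

Definition cycle_of u : vsub cycles := exist (fun x => x \in cycles) _ (iota_cycle u).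
Definition class_of u : HH deg m n := vproj (@gr_bound k R deg m n) (cycle_of u).

Fact class_of_linear : linear class_of.
Proof.
move=> a x y; rewrite /class_of -linearP; congr vproj.
by apply/val_inj; rewrite /= iota_linear.
Qed.
HB.instance Definition _ := GRing.isLinear.Build k U (HH deg m n) _ class_of
  class_of_linear.

Lemma class_of_eq0 u :
  class_of u = 0 <-> exists2 t, t \in gr m n.+1 & iota u = hh_bd t.
Proof.
split=> [/vproj_eq0/asboolP [t tg e]|[t tg e]]; first by exists t.
by apply/vproj_eq0/asboolP; exists t.
Qed.

Lemma class_of_surj : (forall x, x \in cycles ->
    exists u, exists2 t, t \in gr m n.+1 & x = iota u + hh_bd t) ->
  forall w, exists u, w = class_of u.
Proof.
move=> H w; have [u [t tg e]] := H _ (valP (vrepr w)).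
exists u; rewrite -[w]vprojK; apply/eq_vproj/asboolP; exists t => //.
have -> : val (vrepr w - cycle_of u) = val (vrepr w) - iota u.
  exact: (linB (f := val) (@linearP _ _ _ _ _)).
by rewrite e addrC addKr.
Qed.

End HomologyClasses.

Section LeavittHomology.
Variables (k : fieldType) (R : pzAlg k) (E : quiver).
Variables (P : vertex E -> R) (A S : arrow E -> R).
Hypothesis LF : leavitt_family P A S.
Variable deg : int -> R -> Prop.
Hypothesis degE : forall d x, deg d x <->
  x \in span (fun y => exists2 s, wdeg s = d & y = word_val P A S s).
Hypothesis words_span :
  forall x, x \in span (fun y => exists s, y = word_val P A S s).
Variable delta : R -> tpow R 3.
Hypothesis delta_linear : linear delta.
Hypothesis delta_der :
  forall x y, delta (x ** y) = lmul x (delta y) + rmul y (delta x).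
Hypothesis delta_gen : forall x, delta (gen_val P A S x) = gen_deriv P A S x.

Local Notation e := (sep_idem P).
Local Notation corner := (corner P).
Local Notation cycle_shift := (cycle_shift A S).
Local Notation cycle_lift := (cycle_lift A S).
Local Notation nsink := (@nsink E).
Local Notation gr m n := (@hh_gr k R deg m n).
Local Notation Fil := (Fil P A S).

Let e_unit : bar_bd e = t1 pz_one := bar_bd_sep_idem LF.
Let bd_delta : forall x, bar_bd (delta x) = lmul x e - rmul x e :=
  bar_bd_delta LF delta_linear delta_der delta_gen words_span.
Let dspan : forall x, delta x \in span (deriv_tensor P A) :=
  delta_span LF delta_linear delta_der delta_gen words_span.
Let dA a : delta (A a) = t3 (P (source a)) (A a) (P (range a)) :=
  delta_gen (inr (inl a)).
Let e_gr : e \in gr 0 1 := gr_sep_idem degE.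
Let d_gr : forall d x, deg d x -> delta x \in gr d 2 :=
  fun d x => gr_delta degE delta_linear delta_der delta_gen (d := d) (x := x).
Let dg1 : deg 0 pz_one := deg1 degE.
Let dgM := degM degE.

Local Notation hh_proj := (hh_proj e delta).
Local Notation hh_homotopy := (hh_homotopy e delta).

Lemma gr0P m x : x \in gr m 0 -> exists2 y, deg m y & x = t1 y.
Proof.
move/spanP; elim=> [|a u v [b [d [bd dm ->]]] _ [y dy ->]].
  exists 0; first exact: (deg0 degE m).
  by rewrite (lin0 (@t1P k R)).
exists (a *: b ord0 + y).
  apply: (deg_lin degE) dy; rewrite -dm big_ord_recl big_ord0 addr0.
  exact: bd.
by rewrite (t1P a) tens1.
Qed.

Lemma t1_inj (x y : R) : t1 x = t1 y -> x = y.
Proof. by move=> xy; rewrite -[x]untens1K xy untens1K. Qed.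

Lemma gr_cycle_lift m z : deg m z -> cycle_lift z \in gr m 1.
Proof.
move=> dz; apply: rpred_sum => a _.
have := t2_gr (dgM (degS degE a) dz) (degA degE a).
by rewrite addrAC addNr add0r.
Qed.

Lemma deg_swap_mul m t : t \in gr m 1 -> deg m (swap_mul t).
Proof.
move=> tg; apply/degE; apply: (span_map (@swap_mul_linear k R)) tg.
move=> _ [a [d [ad <- ->]]]; rewrite tens2 swap_mul_t2; apply/degE.
rewrite !big_ord_recl big_ord0 addr0 addrC.
have -> : lift ord0 ord0 = ord_max :> 'I_2 by exact/val_inj.
exact: dgM.
Qed.

(** [HH0_repr], [HH0_rel], [HH1_repr] and [HH1_rel] say that HH_0 and HH_1 in
    degree m are the cokernel and the kernel of 1 - psi, in terms of
    representatives and relations. *)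
Lemma HH0_repr m x : x \in gr m 0 -> exists y, exists2 t, t \in gr m 1 &
  [/\ deg m y, corner predT y = y & x = t1 y + hh_bd t].
Proof.
move=> xg; have [y dy xy] := gr0P xg.
exists (corner predT y), (hh_homotopy x).
  exact: gr_hh_homotopy.
split.
- apply: (deg_sum degE) => i _; have := dgM (dgM (degP degE i) dy) (degP degE i).
  by rewrite add0r addr0.
- by rewrite (cornerK LF).
by rewrite {1}(hh_homotopy0 (delta := delta) e_unit delta_linear x) {1}xy hh_proj_t1.
Qed.

Lemma HH0_rel m y w : corner predT y = y -> w \in gr m 1 -> t1 y = hh_bd w ->
  exists z, [/\ deg m z, corner nsink z = z & y = cycle_shift z - z].
Proof.
move=> cy wg e1; exists (swap_mul (hh_proj w)).
have [cz ez] := hh_proj_normal LF delta_linear dspan w.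
split=> //; first by apply: deg_swap_mul; exact: gr_hh_proj.
apply: t1_inj; rewrite -(hh_bd_cycle_lift LF cz) ez hh_bd_proj // -e1.
by rewrite hh_proj_t1 // cy.
Qed.

Lemma HH1_repr m w : w \in gr m 1 -> hh_bd w = 0 ->
  exists z, exists2 t, t \in gr m 2 &
  [/\ deg m z, corner nsink z = z, cycle_shift z = z & w = cycle_lift z + hh_bd t].
Proof.
move=> wg w0; exists (swap_mul (hh_proj w)), (hh_homotopy w).
  exact: gr_hh_homotopy.
have [cz ez] := hh_proj_normal LF delta_linear dspan w.
split=> //; first by apply: deg_swap_mul; exact: gr_hh_proj.
  apply/subr0_eq/t1_inj; rewrite -(hh_bd_cycle_lift LF cz) ez hh_bd_proj // w0.
  by rewrite (lin0 (@hh_proj_linear k R e delta delta_linear 0)) (lin0 (@t1P k R)).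
rewrite {1}(hh_homotopyS e_unit delta_linear delta_der bd_delta w) ez w0.
by rewrite (lin0 (@hh_homotopy_linear k R e delta delta_linear 0)) addr0.
Qed.

Lemma HH1_rel z t : corner nsink z = z -> cycle_lift z = hh_bd t -> z = 0.
Proof.
move=> cz ez; rewrite -(swap_mul_lift LF cz) -(hh_proj_lift LF delta_linear dA cz).
by rewrite ez hh_proj1_bd // (lin0 (@swap_mul_linear k R)).
Qed.

Lemma HH_ge2 m n : lmod_iso (HH deg m n.+2) 'cV[k]_0.
Proof.
pose iota (u : 'cV[k]_0) : hh_chain R n.+2 := 0.
have li : linear iota by move=> a x y; rewrite /iota scaler0 addr0.
have ci u : iota u \in @gr_cycle k R deg m n.+2 by exact: rpred0.
apply: (lmod_iso_inv (g := class_of ci : {linear _ -> _})) => [v _|].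
  exact: flatmx0.
apply: class_of_surj => x /andP[xg /eqP x0].
exists 0, (hh_homotopy x); first exact: gr_hh_homotopy.
rewrite {1}(hh_homotopyS e_unit delta_linear delta_der bd_delta x).
rewrite [hh_bd x]x0 (lin0 (@hh_homotopy_linear k R e delta delta_linear _)) addr0.
by rewrite hh_proj_ge2.
Qed.

(** T : U1 -> U0 is a model of 1 - psi on the lowest layer: [i0] and [i1] identify
    U0 with the diagonal part of this layer, and U1 with the part of it over the
    vertices that are not sinks. *)
Section Reduction.
Variables (m : int) (U0 U1 : lmodType k) (T : {linear U1 -> U0}).
Variables (i0 : U0 -> R) (i1 : U1 -> R).
Hypotheses (i0_linear : linear i0) (i1_linear : linear i1).
Hypothesis iT : forall v, i0 (T v) = i1 v - cycle_shift (i1 v).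
Hypothesis i0_inj : forall u, i0 u = 0 -> u = 0.
Hypothesis i1_inj : forall v, i1 v = 0 -> v = 0.
Hypothesis i0_Fil : forall u, i0 u \in Fil m 0.
Hypothesis i1_Fil : forall v, i1 v \in Fil m 0.
Hypothesis i0_corner : forall u, corner predT (i0 u) = i0 u.
Hypothesis i1_corner : forall v, corner nsink (i1 v) = i1 v.
Hypothesis i0_surj : forall y, y \in Fil m 0 -> corner predT y = y ->
  exists u, y = i0 u.
Hypothesis i1_surj : forall z, z \in Fil m 0 -> corner nsink z = z ->
  exists v, z = i1 v.

Lemma HH0_coker : lmod_iso (HH deg m 0) (coker T).
Proof.
pose iota u : hh_chain R 0 := t1 (i0 u).
have li : linear iota by exact: linear_compose (@t1P k R) i0_linear.
have ci u : iota u \in @gr_cycle k R deg m 0.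
  rewrite inE andbT; apply: t1_gr; apply: (Fil_deg degE); exact: i0_Fil.
apply: (@lmod_iso_quot _ _ _ (im_pred T) (class_of ci : {linear _ -> _})) => [u|].
  apply/eqP/asboolP => [/class_of_eq0[w wg e1]|[v ->]].
    have [z [dz cz e2]] := HH0_rel (i0_corner u) wg e1.
    have [N zN] := deg_Fil LF degE dz.
    have [v ev] : exists v, z = i1 v.
      apply: i1_surj cz; apply: (fixed_Fil0 LF (y := - i0 u)) zN _.
        by rewrite rpredN i0_Fil.
      by rewrite e2 opprB subrK.
    (* the boundary of cycle_lift z is psi z - z, the opposite of the model T *)
    exists (- v); apply/subr0_eq/i0_inj.
    rewrite (linB i0_linear) linearN (linN i0_linear) iT e2 ev.
    by rewrite opprK addrC subrKA subrr.
  apply/class_of_eq0; exists (- cycle_lift (i1 v)).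
    by rewrite rpredN; apply: gr_cycle_lift; exact: Fil_deg (i1_Fil v).
  rewrite (linN (@hh_bd_linear k R 0)) (hh_bd_cycle_lift LF) //.
  by rewrite -(linN (@t1P k R)) opprB -iT.
apply: class_of_surj => x /andP[xg _].
have [y [t tg [dy cy ex]]] := HH0_repr xg.
have [N yN] := deg_Fil LF degE dy.
have [y0 [z [y0F cy0 zN cz ey]]] := coker_Fil0 LF yN cy.
have [u eu] := i0_surj y0F cy0.
exists u, (t - cycle_lift z).
  by rewrite rpredB // gr_cycle_lift //; exact: (Fil_deg degE zN).
rewrite ex ey eu (linB (@hh_bd_linear k R 0)) (hh_bd_cycle_lift LF cz).
rewrite (linD (@t1P k R)) -(linN (@t1P k R)) opprB /iota.
by rewrite -addrA [hh_bd t + _]addrC.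
Qed.

Lemma HH1_kernel : lmod_iso (HH deg m 1) (kernel T).
Proof.
pose iota (v : kernel T) : hh_chain R 1 := cycle_lift (i1 (val v)).
have li : linear iota.
  move=> a x y; rewrite /iota; have -> : val (a *: x + y) = a *: val x + val y by [].
  by rewrite i1_linear (@cycle_lift_linear k R E A S).
have T0 v : v \in ker_pred T -> cycle_shift (i1 v) - i1 v = 0.
  by move=> /eqP Tv; rewrite -opprB -iT Tv (lin0 i0_linear) oppr0.
have ci v : iota v \in @gr_cycle k R deg m 1.
  apply/andP; split; first by apply: gr_cycle_lift; exact: Fil_deg (i1_Fil _).
  apply/eqP; rewrite [LHS](hh_bd_cycle_lift LF) // T0 ?(valP v) //.
  exact: lin0 (@t1P k R).
apply: (lmod_iso_inv (g := class_of ci : {linear _ -> _})) => [v|].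
  move=> /class_of_eq0[t _ e1]; apply/val_inj/i1_inj.
  exact: HH1_rel e1.
apply: class_of_surj => w /andP[wg /eqP w0].
have [z [t tg [dz cz pz ew]]] := HH1_repr wg w0.
have [N zN] := deg_Fil LF degE dz.
have zF : z \in Fil m 0.
  by apply: (fixed_Fil0 LF (y := 0)) zN _; rewrite ?rpred0 // add0r pz.
have [v ev] := i1_surj zF cz.
have Tv : v \in ker_pred T.
  by apply/eqP/i0_inj; rewrite iT -ev pz subrr.
by exists (exist (fun x => x \in ker_pred T) v Tv), t => //; rewrite ew ev.
Qed.

End Reduction.
End LeavittHomology.

(** * Bases of the lowest layer *)

(** Linear independence from a family of separating operators [g]. *)

Lemma free_ext_inj (k : fieldType) (T : choiceType) (W : lmodType k) (h w : T -> W)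
    (g : T -> W -> W) : (forall c, linear (g c)) -> (forall c, w c <> 0) ->
  (forall c c', g c (h c') = if c' == c then w c else 0) ->
  forall x : {malg k[T]}, free_ext h x = 0 -> x = 0.
Proof.
move=> lg w0 gh x hx; apply/malgP => c; rewrite mcoeff0.
have e : g c (free_ext h x) = x@_c *: w c.
  apply: (malg_eq (f := fun x => g c (free_ext h x)) (g := fun x => x@_c *: w c)).
  - exact: (linear_compose (lg c) (free_ext_linear h)).
  - by move=> a y z; rewrite mcoeffD mcoeffZ scalerDl scalerA.
  by move=> t; rewrite free_extU gh mcoeffU; case: eqP; rewrite ?scale1r ?scale0r.
move: e; rewrite hx (lin0 (lg c)) => /esym/eqP; rewrite scaler_eq0.
by case/orP => /eqP // /w0.
Qed.

Section PathBasis.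
Variables (k : fieldType) (R : pzAlg k) (E : quiver).
Variables (P : vertex E -> R) (A S : arrow E -> R).
Hypothesis LF : leavitt_family P A S.
Hypothesis P_neq0 : forall i, P i <> 0.

Local Notation path_val := (path_val A).
Local Notation ghost_val := (ghost_val S).
Local Notation monomial := (monomial P A S).
Local Notation corner := (corner P).
Local Notation cycle_shift := (cycle_shift A S).
Local Notation nsink := (@nsink E).
Local Notation Fil := (Fil P A S).
Local Notation is_path := (path (fun x y : arrow E => range x == source y)).

Lemma path_val_P j a u : path_val (a :: u) ** P j =
  if j == range (last a u) then path_val (a :: u) else 0.
Proof.
elim: u a => [|b u IH] a.
  by rewrite /= pz_mul1r (AP_if LF).
rewrite -[path_val (a :: b :: u)]/(A a ** path_val (b :: u)) -pz_mulA IH /=.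
by case: eqP => // _; exact: pz_mul0r.
Qed.

Lemma P_ghost_val j a u : P j ** ghost_val (a :: u) =
  if j == range (last a u) then ghost_val (a :: u) else 0.
Proof.
elim: u a => [|b u IH] a.
  by rewrite /= pz_mul1l (PS_if LF).
rewrite -[ghost_val (a :: b :: u)]/(ghost_val (b :: u) ** S a) pz_mulA IH /=.
by case: eqP => // _; exact: pz_mul0l.
Qed.

Lemma path_val0 a u : ~~ is_path a u -> path_val (a :: u) = 0.
Proof.
elim: u a => [//|b u IH] a /=; rewrite negb_and -(lf_AP LF a) -pz_mulA.
rewrite -[A b ** _]/(path_val (b :: u)) (P_path LF).
case: eqP => _; last by rewrite pz_mul0r.
by move/IH->; rewrite pz_mul0r.
Qed.

Lemma ghost_val0 a u : ~~ is_path a u -> ghost_val (a :: u) = 0.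
Proof.
elim: u a => [//|b u IH] a /=; rewrite negb_and -(lf_PS LF a) pz_mulA.
rewrite -[_ ** S b]/(ghost_val (b :: u)) (ghost_P LF).
case: eqP => _; last by rewrite pz_mul0l.
by move/IH->; rewrite pz_mul0l.
Qed.

(** A product of arrows, cut down to the corner at j, survives only if it is a
    closed path based at j; and likewise for the dual paths. *)
Lemma path_val_corner j a u : P j ** path_val (a :: u) ** P j =
  if closed_path_at j (a :: u) then path_val (a :: u) else 0.
Proof.
rewrite (P_path LF) -[closed_path_at _ _]/[&& _, _ & _].
rewrite [_ == j]eq_sym [range _ == j]eq_sym.
case: eqP => _; last by rewrite pz_mul0l andbF.
rewrite path_val_P; case: eqP => _; last by rewrite !andbF.
by case: (boolP (is_path a u)) => //= /path_val0.
Qed.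

Lemma ghost_val_corner j a u : P j ** ghost_val (a :: u) ** P j =
  if closed_path_at j (a :: u) then ghost_val (a :: u) else 0.
Proof.
rewrite P_ghost_val -[closed_path_at _ _]/[&& _, _ & _].
rewrite [source _ == j]eq_sym [range _ == j]eq_sym.
case: (j == range _); last by rewrite pz_mul0l !andbF.
rewrite (ghost_P LF); case: eqP => _; last by rewrite !andbF.
by case: (boolP (is_path a u)) => //= /ghost_val0.
Qed.

(** This and [ghost_path_id] make paths of the same length linearly independent:
    c^* separates c from the others. *)
Lemma ghost_path_neq u v : size u = size v -> u != v ->
  ghost_val u ** path_val v = 0.
Proof.
elim: u v => [|a u IH] [|b v] //= [uv] neq.
rewrite -pz_mulA (pz_mulA (S a)) (lf_SA LF); have [eab|_] := eqVneq a b; last first.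
  by rewrite pz_mul0l pz_mul0r.
have {}neq : u != v by apply: contraNneq neq => ->; rewrite eab.
case: v uv neq => [|c v] uv neq; first by move: uv neq; case: u {IH}.
rewrite (P_path LF); case: eqP => _; last exact: pz_mul0r.
exact: IH.
Qed.

Lemma ghost_path_id a u : is_path a u ->
  ghost_val (a :: u) ** path_val (a :: u) = P (range (last a u)).
Proof.
elim: u a => [|b u IH] a /=.
  by rewrite pz_mul1l pz_mul1r (lf_SA LF) eqxx.
case/andP => /eqP rab ub; rewrite -pz_mulA (pz_mulA (S a)) (lf_SA LF) eqxx.
rewrite -[A b ** _]/(path_val (b :: u)) (P_path LF) rab eqxx.
exact: IH.
Qed.

Lemma cycle_shift_path a u : closed_path_at (source a) (a :: u) ->
  cycle_shift (path_val (a :: u)) = path_val (rcons u a).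
Proof.
case/and3P => pu _ ru; rewrite /cycle_shift.
rewrite (eq_bigr (fun b => if b == a then P (range a) ** path_val (rcons u a) else 0)).
  rewrite sum_if_eq; case: u pu ru => [|b u] /= pu ru.
    by rewrite pz_mulA (PA_if LF) ru.
  by rewrite pz_mulA (PA_if LF); case/andP: pu => ->.
move=> b _; rewrite path_val_rcons /= pz_mulA (lf_SA LF).
by case: eqP => [->|_]; rewrite ?pz_mul0l // pz_mulA.
Qed.

Lemma cycle_shift_ghost a u : closed_path_at (source a) (a :: u) ->
  cycle_shift (ghost_val (a :: u)) = ghost_val (rcons u a).
Proof.
case/and3P => pu _ ru; rewrite /cycle_shift.
rewrite (eq_bigr (fun b => if b == a then ghost_val (rcons u a) ** P (range a) else 0)).
  rewrite sum_if_eq; case: u pu ru => [|b u] /= pu ru.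
    by rewrite -pz_mulA (SP_if LF) ru.
  by rewrite -pz_mulA (SP_if LF); case/andP: pu => ->.
move=> b _; rewrite ghost_val_rcons /= -pz_mulA -(pz_mulA _ (S a)) (lf_SA LF).
case: (eqVneq b a) => [->|ne]; first by rewrite pz_mulA.
by rewrite !pz_mul0r.
Qed.

Section NonzeroDegree.
Variable m : int.
Hypothesis m0 : m != 0.
Local Notation N := `|m|%N.

(** In positive degree the lowest layer consists of paths, in negative degree of
    dual paths. *)
Definition cycle_val (c : seq (arrow E)) : R :=
  if 0 < m then path_val c else ghost_val c.

Definition cpath_val (c : cpath E N) : R := cycle_val (val (val c)).
Definition cpath_ext : {malg k[cpath E N]} -> R := free_ext cpath_val.

Lemma cpath_extU c : cpath_ext << c >> = cpath_val c.
Proof. exact: free_extU. Qed.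

Lemma cpath_ext_linear : linear cpath_ext.
Proof. exact: free_ext_linear. Qed.

Variant cpath_spec (c : cpath E N) : Prop :=
  CpathSpec a u of val (val c) = a :: u & closed_path_at (source a) (a :: u)
    & size (a :: u) = N.

Lemma cpathP c : cpath_spec c.
Proof.
have := valP c; have := size_tuple (val c).
case/existsP: (valP c) => i /andP[_].
case e : (val (val c)) => [|a u] // cp sz _; apply: (CpathSpec e) => //.
by move: (cp) => /and3P[? /eqP si ?]; rewrite si.
Qed.

Lemma cycle_val_corner j a u : P j ** cycle_val (a :: u) ** P j =
  if closed_path_at j (a :: u) then cycle_val (a :: u) else 0.
Proof.
rewrite /cycle_val; case: ifP => _; first exact: path_val_corner.
exact: ghost_val_corner.
Qed.

Lemma corner_cpath_val (Q : pred (vertex E)) c : (forall a, Q (source a)) ->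
  corner Q (cpath_val c) = cpath_val c.
Proof.
move=> Qs; rewrite /cpath_val; have [a u -> cp sz] := cpathP c.
rewrite /corner (eq_bigr (fun j => if j == source a then cycle_val (a :: u) else 0)).
  by rewrite sum_if_eq Qs.
move=> j _; rewrite cycle_val_corner; case: (eqVneq j (source a)) => [->|ne].
  by rewrite cp.
case: ifP => // /and3P[_ /eqP e _]; by rewrite e eqxx in ne.
Qed.

Lemma corner_cpath_ext (Q : pred (vertex E)) x : (forall a, Q (source a)) ->
  corner Q (cpath_ext x) = cpath_ext x.
Proof.
move=> Qs; move: x; apply: malg_eq.
- exact: (linear_compose (@corner_linear _ _ _ _ _) cpath_ext_linear).
- exact: cpath_ext_linear.
by move=> c; rewrite cpath_extU corner_cpath_val.
Qed.

Lemma cycle_shift_cpath_val c :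
  cycle_shift (cpath_val c) = cpath_val (rotate c).
Proof.
rewrite /cpath_val /=; have [a u -> cp sz] := cpathP c; rewrite rot1_cons.
by rewrite /cycle_val; case: ifP => _; [exact: cycle_shift_path|exact: cycle_shift_ghost].
Qed.

(** psi rotates closed paths. *)
Lemma cpath_ext_shift x : cpath_ext (one_minus_sigma k E N x) =
  cpath_ext x - cycle_shift (cpath_ext x).
Proof.
rewrite [one_minus_sigma k E N x]/(x - sigma x) (linB cpath_ext_linear).
congr (_ - _); move: x; apply: malg_eq.
- exact: (linear_compose cpath_ext_linear (free_ext_linear _)).
- exact: (linear_compose (@cycle_shift_linear _ _ _ _ _) cpath_ext_linear).
move=> c; have -> : sigma << c >> = << rotate c >> :> Vspace k E N.
  exact: free_extU.
transitivity (cpath_val (rotate c)); first exact: cpath_extU.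
rewrite -cycle_shift_cpath_val.
congr (cycle_shift _).
exact: esym (cpath_extU c).
Qed.

Lemma cpath_ext_inj x : cpath_ext x = 0 -> x = 0.
Proof.
pose g (c : cpath E N) y := if 0 < m then ghost_val (val (val c)) ** y
                            else y ** path_val (val (val c)).
pose w (c : cpath E N) := ghost_val (val (val c)) ** path_val (val (val c)).
apply: (free_ext_inj (w := w) (g := g)) => [c|c|c c'].
- by rewrite /g; case: (0 < m); [exact: pz_mul_linr|exact: pz_mul_linl].
- rewrite /w; have [a u -> cp sz] := cpathP c.
  by case/and3P: cp => pu _ _; rewrite ghost_path_id.
have [->|ne] := eqVneq c' c; first by rewrite /g /cpath_val /cycle_val /w; case: (0 < m).
have ne' : val (val c') != val (val c) by rewrite !val_eqE.
rewrite /g /cpath_val /cycle_val; case: (0 < m); apply: ghost_path_neq => //.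
- by rewrite !size_tuple.
- by rewrite eq_sym.
- by rewrite !size_tuple.
Qed.

Lemma cpath_ext_Fil x : cpath_ext x \in Fil m 0.
Proof.
apply: (span_map cpath_ext_linear) (malg_span x) => _ [c ->].
rewrite cpath_extU -(corner_cpath_val (Q := predT)) //.
rewrite /corner; apply: rpred_sum => i _; rewrite /cpath_val /cycle_val.
have := size_tuple (val c); set u := val (val c) => szu.
case: ifP => m_pos.
  have e : P i ** path_val u ** P i = P i ** monomial u i [::].
    by rewrite /monomial /= pz_mul1r pz_mulA.
  rewrite e; case: (P_monomial LF i u i [::]) => ->; first exact: rpred0.
  by apply: monomial_Fil; rewrite ?minn0 //= szu; lia.
have e : P i ** ghost_val u ** P i = monomial [::] i u ** P i.
  by rewrite /monomial /= pz_mul1l.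
rewrite e; case: (monomial_P LF i [::] i u) => ->; first exact: rpred0.
by apply: monomial_Fil; rewrite ?min0n //= szu; lia.
Qed.

HB.instance Definition _ := GRing.isLinear.Build k {malg k[cpath E N]} R _
  cpath_ext cpath_ext_linear.

Lemma cycle_val_im u j : size u = N ->
  P j ** cycle_val u ** P j \in im_pred cpath_ext.
Proof.
case: u => [|a u] sz; first by move: sz m0; rewrite /=; lia.
rewrite cycle_val_corner; case: ifP => cp; last exact: rpred0.
have cpp : cpath_pred (Tuple (introT eqP sz)).
  apply/existsP; exists j; rewrite cp andbT.
  by case/and3P: cp => _ /eqP <- _; exact: source_nsink.
pose c : cpath E N := exist (fun t => cpath_pred t) _ cpp.
by apply/asboolP; exists << c >>; exact: esym (cpath_extU c).
Qed.

Lemma cpath_ext_surj (Q : pred (vertex E)) y : y \in Fil m 0 -> corner Q y = y ->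
  exists x, y = cpath_ext x.
Proof.
move=> yF cy; suff : corner Q y \in im_pred cpath_ext.
  by rewrite cy => /asboolP.
move: y yF {cy}; apply: Fil_map; first exact: corner_linear.
move=> u i v uv; rewrite leqn0 => /eqP mn.
apply: rpred_sum => j _.
have [vE|[uE mN]] : v = [::] /\ 0 < m \/ u = [::] /\ m < 0.
- case: u v uv mn => [|a u] [|b v] /= uv mn; move: m0;
    [lia | right; split=> //; lia | left; split=> //; lia | lia].
- case: vE uv => -> mp /= uv; rewrite /monomial /= pz_mul1r.
  have sz : size u = N by lia.
  have := cycle_val_im j sz; rewrite /cycle_val mp.
  rewrite -2!(pz_mulA (P j)) -(pz_mulA (path_val u)) (lf_PP LF).
  by case: eqP => [->//|_] H; rewrite !pz_mul0r rpred0.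
move: uv; rewrite uE /= => uv.
have sz : size v = N by lia.
have := cycle_val_im j sz; rewrite /cycle_val (_ : (0 < m) = false); last by lia.
rewrite /monomial /= pz_mul1l (pz_mulA (P j)) (lf_PP LF).
by case: eqP => [->//|_] H; rewrite !pz_mul0l rpred0.
Qed.


End NonzeroDegree.

Section ZeroDegree.

Lemma vertex_of_rshift (j : 'I_(n_nonsink E)) :
  vertex_of (rshift (n_sink E) j) = enum_val j.
Proof. by rewrite /vertex_of (unsplitK (inr j)). Qed.

Lemma vertex_of_bij : bijective (@vertex_of E).
Proof.
apply: inj_card_bij; last by rewrite card_ord /n_sink /n_nonsink cardsC.
move=> i j; rewrite /vertex_of -{2}(splitK i) -{2}(splitK j).
case: (split i) (split j) => [a|a] [b|b] e.
- by rewrite (enum_val_inj e).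
- by have := enum_valP b; rewrite -e inE (enum_valP a).
- by have := enum_valP a; rewrite e inE (enum_valP b).
- by rewrite (enum_val_inj e).
Qed.

Lemma sum_vertex_of (V : nmodType) (F : vertex E -> V) :
  \sum_i F (vertex_of i) = \sum_x F x.
Proof. by rewrite [RHS](reindex (@vertex_of E)) //; exact: onW_bij vertex_of_bij. Qed.

Definition vertex_ext (u : 'cV[k]_(n_sink E + n_nonsink E)) : R :=
  \sum_i u i 0 *: P (vertex_of i).

Definition nonsink_ext (v : 'cV[k]_(n_nonsink E)) : R :=
  \sum_j v j 0 *: P (enum_val j).

Lemma vertex_ext_linear : linear vertex_ext.
Proof.
move=> a x y; rewrite /vertex_ext scaler_sumr -big_split; apply: eq_bigr => i _.
by rewrite !mxE scalerDl scalerA.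
Qed.

Lemma nonsink_ext_linear : linear nonsink_ext.
Proof.
move=> a x y; rewrite /nonsink_ext scaler_sumr -big_split; apply: eq_bigr => i _.
by rewrite !mxE scalerDl scalerA.
Qed.

Lemma P_sum (I : finType) (f : I -> vertex E) (c : I -> k) l : injective f ->
  P (f l) ** (\sum_i c i *: P (f i)) = c l *: P (f l).
Proof.
move=> fI; rewrite pz_sumr.
rewrite (eq_bigr (fun i => if i == l then c i *: P (f i) else 0)).
  exact: sum_if_eq.
move=> i _; rewrite (linZ (pz_mul_linr _)) (lf_PP LF) (inj_eq fI) eq_sym.
by case: eqP => [->//|_]; exact: scaler0.
Qed.

Lemma scale_P_eq0 a i : a *: P i = 0 -> a = 0.
Proof.
by move/eqP; rewrite scaler_eq0 => /orP[/eqP//|/eqP /P_neq0].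
Qed.

Lemma vertex_ext_inj u : vertex_ext u = 0 -> u = 0.
Proof.
move=> u0; apply/matrixP => l j; rewrite (ord1 j) mxE.
apply: (@scale_P_eq0 _ (vertex_of l)).
rewrite -(P_sum (fun i => u i 0) _ (bij_inj vertex_of_bij)).
by rewrite [X in _ ** X]u0 pz_mul0r.
Qed.

Lemma nonsink_ext_inj v : nonsink_ext v = 0 -> v = 0.
Proof.
move=> v0; apply/matrixP => l j; rewrite (ord1 j) mxE.
apply: (@scale_P_eq0 _ (enum_val l)).
rewrite -(P_sum (fun i => v i 0) _ enum_val_inj).
by rewrite [X in _ ** X]v0 pz_mul0r.
Qed.

Lemma P_Fil i : P i \in Fil 0 0.
Proof.
have -> : P i = monomial [::] i [::] by rewrite /monomial /= pz_mul1l pz_mul1r.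
exact: monomial_Fil.
Qed.

Lemma vertex_ext_Fil u : vertex_ext u \in Fil 0 0.
Proof. by apply: rpred_sum => i _; apply/rpredZ/P_Fil. Qed.

Lemma nonsink_ext_Fil v : nonsink_ext v \in Fil 0 0.
Proof. by apply: rpred_sum => i _; apply/rpredZ/P_Fil. Qed.

Lemma corner_P Q i : corner Q (P i) = if Q i then P i else 0.
Proof.
rewrite /corner (eq_bigr (fun j => if j == i then P i else 0)).
  exact: (sum_if_eq i Q (fun=> P i)).
move=> j _; rewrite (lf_PP LF); case: eqP => [->|_]; last exact: pz_mul0l.
exact: PPid LF i.
Qed.

Lemma vertex_ext_corner u : corner predT (vertex_ext u) = vertex_ext u.
Proof.
rewrite /vertex_ext (lin_sum (@corner_linear _ _ _ _ _)); apply: eq_bigr => i _.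
by rewrite (linZ (@corner_linear _ _ _ _ _)) corner_P.
Qed.

Lemma nonsink_ext_corner v : corner nsink (nonsink_ext v) = nonsink_ext v.
Proof.
rewrite /nonsink_ext (lin_sum (@corner_linear _ _ _ _ _)); apply: eq_bigr => i _.
rewrite (linZ (@corner_linear _ _ _ _ _)) corner_P.
by have := enum_valP i; rewrite inE => ns; rewrite (_ : nsink _).
Qed.

HB.instance Definition _ := GRing.isLinear.Build k
  'cV[k]_(n_sink E + n_nonsink E) R _ vertex_ext vertex_ext_linear.
HB.instance Definition _ := GRing.isLinear.Build k
  'cV[k]_(n_nonsink E) R _ nonsink_ext nonsink_ext_linear.

Lemma P_im_vertex i : P i \in im_pred vertex_ext.
Proof.
have [f fK vK] := vertex_of_bij; apply/asboolP; exists (delta_mx (f i) 0).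
rewrite /= /vertex_ext (bigD1 (f i)) //= mxE !eqxx scale1r vK.
rewrite big1 ?addr0 // => j /negbTE ne.
by rewrite mxE ne scale0r.
Qed.

Lemma P_im_nonsink i : nsink i -> P i \in im_pred nonsink_ext.
Proof.
move=> ns; have iS : i \in ~: sink E by rewrite inE.
apply/asboolP; exists (delta_mx (enum_rank_in iS i) 0).
rewrite /= /nonsink_ext (bigD1 (enum_rank_in iS i)) //= mxE !eqxx scale1r.
rewrite enum_rankK_in // big1 ?addr0 // => j /negbTE ne.
by rewrite mxE ne scale0r.
Qed.

Lemma vertex_ext_surj y : y \in Fil 0 0 -> corner predT y = y ->
  exists u, y = vertex_ext u.
Proof.
move=> yF cy; suff : corner predT y \in im_pred vertex_ext.
  by rewrite cy => /asboolP.
move: y yF {cy}; apply: Fil_map; first exact: corner_linear.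
case=> [|a u] i [|b v] /= uv mn; try by move: uv mn; lia.
rewrite /monomial /= pz_mul1l pz_mul1r corner_P.
exact: P_im_vertex.
Qed.

Lemma nonsink_ext_surj z : z \in Fil 0 0 -> corner nsink z = z ->
  exists v, z = nonsink_ext v.
Proof.
move=> zF cz; suff : corner nsink z \in im_pred nonsink_ext.
  by rewrite cz => /asboolP.
move: z zF {cz}; apply: Fil_map; first exact: corner_linear.
case=> [|a u] i [|b v] /= uv mn; try by move: uv mn; lia.
rewrite /monomial /= pz_mul1l pz_mul1r corner_P.
by case: ifP => [/P_im_nonsink//|_]; exact: rpred0.
Qed.

Lemma cycle_shift_P i : cycle_shift (P i) = \sum_(a | source a == i) P (range a).
Proof.
rewrite [RHS]big_mkcond; apply: eq_bigr => a _; rewrite (SP_if LF) eq_sym.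
by case: eqP => _; [rewrite (lf_SA LF) eqxx | rewrite pz_mul0l].
Qed.

(** Grouping the arrows that leave a vertex by their range. *)
Lemma sum_incidence j :
  \sum_i (incidence E j i)%:~R *: P (vertex_of i) = cycle_shift (P (enum_val j)).
Proof.
rewrite cycle_shift_P.
pose F x : R :=
  #|[set a : arrow E | (source a == enum_val j) && (range a == x)]|%:R *: P x.
rewrite (eq_bigr (fun i => F (vertex_of i))) => [|i _]; last first.
  by rewrite /F !mxE vertex_of_rshift pmulrn.
rewrite sum_vertex_of (partition_big (@range E) predT) //=; apply: eq_bigr => x _.
rewrite (eq_bigr (fun=> P x)) => [|a /andP[_ /eqP ->]//].
rewrite /F -sum1dep_card natr_sum scaler_suml; apply: eq_bigr => a _.
exact: scale1r.
Qed.

Lemma vertex_ext_shift v : vertex_ext (one_minus_Nt_map k E v) =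
  nonsink_ext v - cycle_shift (nonsink_ext v).
Proof.
have lhs i : (one_minus_Nt_map k E v) i 0 =
    (col_mx 0 v : 'cV_(n_sink E + n_nonsink E)) i 0
    - \sum_j (incidence E j i)%:~R * v j 0.
  rewrite /one_minus_Nt_map /= /one_minus_Nt map_mxB map_col_mx map_mx0 map_mx1.
  rewrite mulmxBl mul_col_mx mul0mx mul1mx [LHS]mxE; congr (_ + _).
  by rewrite [LHS]mxE [in LHS]mxE; congr (- _); apply: eq_bigr => j _; rewrite !mxE.
rewrite /vertex_ext (eq_bigr (fun i =>
  (col_mx 0 v : 'cV_(n_sink E + n_nonsink E)) i 0 *: P (vertex_of i) -
  \sum_j v j 0 *: ((incidence E j i)%:~R *: P (vertex_of i)))).
  rewrite sumrB; congr (_ - _).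
    rewrite big_split_ord /= big1 ?add0r => [|i _]; last first.
      by rewrite col_mxEu mxE scale0r.
    by apply: eq_bigr => j _; rewrite col_mxEd vertex_of_rshift.
  rewrite exchange_big /= /nonsink_ext (lin_sum (@cycle_shift_linear _ _ _ _ _)).
  apply: eq_bigr => j _; rewrite (linZ (@cycle_shift_linear _ _ _ _ _)).
  by rewrite -sum_incidence scaler_sumr.
move=> i _; rewrite lhs scalerBl; congr (_ - _).
rewrite scaler_suml; apply: eq_bigr => j _.
by rewrite scalerA mulrC.
Qed.

End ZeroDegree.
End PathBasis.

(** * The Leavitt path algebra *)

Section LeavittAlgebra.
Variables (k : fieldType) (E : quiver).
Local Notation F := (free_alg k (lgen E)).
Local Notation R := (leavitt k E).
Local Notation rel := (@leavitt_rel k E).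
Local Notation I := (ideal_gen rel).

Definition leavitt_class (z : F) : R := vproj I z.

Lemma leavitt_class_linear : linear leavitt_class.
Proof. exact: vproj_linear. Qed.

Lemma leavitt_classM u v : leavitt_class (u * v) = leavitt_class u ** leavitt_class v.
Proof. exact: vprojM. Qed.

Lemma leavitt_class1 : leavitt_class 1 = pz_one.
Proof. by []. Qed.

Lemma leavitt_class_surj x : exists u, x = leavitt_class u.
Proof. by exists (vrepr x); rewrite /leavitt_class vprojK. Qed.

Lemma leavitt_class_eq u v : rel (u - v) -> leavitt_class u = leavitt_class v.
Proof.
move=> r; apply/subr0_eq; rewrite -(linB leavitt_class_linear).
exact: vproj_rel.
Qed.

Definition vertex_class i := leavitt_class (lf_p k i).
Definition arrow_class a := leavitt_class (lf_a k a).
Definition ghost_class a := leavitt_class (lf_s k a).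

Local Notation gen_val := (gen_val vertex_class arrow_class ghost_class).
Local Notation word_val := (word_val vertex_class arrow_class ghost_class).
Local Notation gen_deriv := (gen_deriv vertex_class arrow_class ghost_class).

Lemma leavitt_familyP : leavitt_family vertex_class arrow_class ghost_class.
Proof.
split=> [i j|a|a|a|a|a b|i ni|].
- rewrite -leavitt_classM (leavitt_class_eq (rel_pp k i j)) (linZ leavitt_class_linear).
  by case: eqP => _; rewrite ?scale1r ?scale0r.
- by rewrite -leavitt_classM; apply/leavitt_class_eq/(rel_sp k (inl a)).
- by rewrite -leavitt_classM; apply/leavitt_class_eq/(rel_pr k (inl a)).
- by rewrite -leavitt_classM; apply/leavitt_class_eq/(rel_sp k (inr a)).
- by rewrite -leavitt_classM; apply/leavitt_class_eq/(rel_pr k (inr a)).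
- rewrite -leavitt_classM (leavitt_class_eq (rel_ck1 k a b)) (linZ leavitt_class_linear).
  by case: eqP => _; rewrite ?scale1r ?scale0r.
- rewrite /vertex_class (leavitt_class_eq (rel_ck2 k ni)) (lin_sum leavitt_class_linear).
  by apply: eq_bigr => a _; rewrite leavitt_classM.
- rewrite -leavitt_class1 (leavitt_class_eq (rel_unit k E)).
  by rewrite (lin_sum leavitt_class_linear).
Qed.

Lemma gen_valE x : gen_val x = leavitt_class (free_gen k x).
Proof. by case: x => [i|[a|a]]. Qed.

Lemma word_valE s : word_val s = leavitt_class (word k s).
Proof.
elim: s => [|x s IH] /=; first by rewrite word_nil leavitt_class1.
have -> : word k (x :: s) = word k [:: x] * word k s by rewrite -word_cat.
by rewrite leavitt_classM IH gen_valE word1.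
Qed.

Lemma words_span_leavitt (x : R) :
  x \in span (fun y => exists s, y = word_val s).
Proof.
have [u ->] := leavitt_class_surj x.
apply: (span_map leavitt_class_linear) (malg_span u) => _ [w ->].
apply: span_gen; exists (w : seq _); rewrite word_valE.
by rewrite -free_wordE.
Qed.

Lemma leavitt_degE d (x : R) : leavitt_deg d x <->
  x \in span (fun y => exists2 s, wdeg s = d & y = word_val s).
Proof.
split; apply: (span_map (f := id)) => // _ [s sd ->]; apply: span_gen.
  exists (s : seq _) => //; rewrite word_valE -free_wordE.
  by [].
by exists (FMonom s); rewrite // word_valE.
Qed.

Definition leavitt_der_free : F -> tpow R 3 :=
  der_free leavitt_class gen_deriv.

Let dM := der_freeM leavitt_class_linear leavitt_classM leavitt_class1 gen_deriv.
Let dG := der_free_gen leavitt_class1 gen_deriv.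
Let dL := der_free_linear leavitt_class gen_deriv.
Let LF := leavitt_familyP.

(** The derivation respects the relations; the interesting ones are a^* b = 0 or
    p_(r a) and the Cuntz-Krieger relation p_i = sum a a^*. *)
Lemma leavitt_der_rel g : rel g -> leavitt_der_free g = 0.
Proof.
rewrite /leavitt_der_free.
case=> [i j|x|x|a b|i ni|].
- rewrite (linB dL) (linZ dL) dM !dG /=.
  rewrite (lin0 (@lmul_linear k R _ _)) (lin0 (@rmul_linear k R _ _)) scaler0.
  by rewrite addr0 subr0.
- rewrite (linB dL) dM !dG (lin0 (@rmul_linear k R _ _)) addr0.
  apply/eqP; rewrite subr_eq0; apply/eqP; case: x => a /=.
    by rewrite lmul_t3 (PPid LF).
  rewrite (linN (@lmul_linear k R _ _)) (lin_sum (@lmul_linear k R _ _)).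
  by congr (- _); apply: eq_bigr => b _; rewrite lmul_t3 (lf_PS LF).
- rewrite (linB dL) dM !dG (lin0 (@lmul_linear k R _ _)) add0r.
  apply/eqP; rewrite subr_eq0; apply/eqP; case: x => a /=.
    by rewrite rmul_t3 (PPid LF).
  rewrite (linN (@rmul_linear k R _ _)) (lin_sum (@rmul_linear k R _ _)).
  by congr (- _); apply: eq_bigr => b /eqP <-; rewrite rmul_t3 (lf_SP LF).
- rewrite (linB dL) (linZ dL) dM !dG scaler0 subr0.
  exact: (lmul_gen_deriv_ck1 LF a b).
- have e : \sum_(a | source a == i)
      der_free leavitt_class gen_deriv (lf_a k a * lf_s k a) = 0.
    rewrite -[RHS](gen_deriv_ck2 LF ni); apply: eq_bigr => a _.
    by rewrite dM !dG.
  by rewrite (linB dL) (lin_sum dL) dG e subr0.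
- rewrite (linB dL) (lin_sum dL) der_free1.
  by rewrite big1 ?subr0 // => i _; rewrite dG.
Qed.

Lemma leavitt_der_ker u : leavitt_class u = 0 -> leavitt_der_free u = 0.
Proof.
move=> /vproj_eq0.
apply: (der_free_ideal leavitt_class_linear leavitt_classM leavitt_class1).
- by move=> g rg; exact: vproj_rel.
- exact: leavitt_der_rel.
Qed.

Definition leavitt_delta : R -> tpow R 3 :=
  derivation gen_deriv leavitt_class_surj.

(** A representation in which no vertex acts by 0.  The basis is vertex x nat, one
    copy of nat for each vertex.  If i is not a sink and d arrows leave it, then
    Euclidean division by d is a bijection between the copy at i and the disjoint
    union of the copies at the ranges of these arrows, and the arrows act through
    it. *)
Section Representation.

Definition outs (i : vertex E) : seq (arrow E) := enum [pred a | source a == i].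
Definition out_deg i := size (outs i).
Definition out_index (a : arrow E) : nat := index a (outs (source a)).

Lemma out_mem a : a \in outs (source a).
Proof. by rewrite mem_enum inE. Qed.

Lemma out_index_lt a : (out_index a < out_deg (source a))%N.
Proof. by rewrite index_mem out_mem. Qed.

Lemma out_index_inj a b :
  source a = source b -> out_index a = out_index b -> a = b.
Proof.
move=> sab; rewrite /out_index -sab => e.
by rewrite -(nth_index a (out_mem a)) e nth_index // sab out_mem.
Qed.

Lemma out_indexP i j : (j < out_deg i)%N ->
  exists2 a, source a = i & out_index a = j.
Proof.
move=> ji; have [a0 _] : exists a : arrow E, true.
  by move: ji; rewrite /out_deg; case: (outs i) => [|a] //; exists a.
have := mem_nth a0 ji; rewrite mem_enum inE => /eqP sa.
by exists (nth a0 (outs i) j) => //; rewrite /out_index sa index_uniq // enum_uniq.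
Qed.

Local Notation M := {malg k[(vertex E * nat)%type]}.

Definition basis_act (x : lgen E) (b : vertex E * nat) : M :=
  let: (j, n) := b in
  match x with
  | inl i => if j == i then << (j, n) >> else 0
  | inr (inl a) => if j == range a
      then << (source a, (n * out_deg (source a) + out_index a)%N) >> else 0
  | inr (inr a) => if (j == source a) && (n %% out_deg j == out_index a)%N
      then << (range a, (n %/ out_deg j)%N) >> else 0
  end.

Definition gen_act (x : lgen E) (f : M) : M := free_ext (basis_act x) f.

Lemma gen_act_linear x : linear (gen_act x).
Proof. exact: free_ext_linear. Qed.

Lemma gen_actU x b : gen_act x << b >> = basis_act x b.
Proof. exact: free_extU. Qed.

Local Notation act := (act gen_act).

Let aL f := act_linearl gen_act f.
Let aM := actM gen_act_linear.
Let aR z : linear (act z) := act_linearr gen_act_linear z.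

Lemma rel_act g : rel g -> forall f, act g f = 0.
Proof.
move=> rg f; apply: (malg_eq (f := act g) (g := fun=> 0)) f => [||[j n]].
- exact: (aR g).
- by move=> a x y; rewrite scaler0 addr0.
case: rg => [i i'|x|x|a b|i ni|].
- rewrite (linB (aL _)) (linZ (aL _)) aM !act_gen_free // !gen_actU /=.
  have [->|ji'] := eqVneq j i'.
    rewrite gen_actU /=; have [->|ii'] := eqVneq i' i.
      by rewrite ?eqxx scale1r subrr.
    by rewrite scale0r subrr.
  rewrite (lin0 (@gen_act_linear _)) sub0r; apply/eqP; rewrite oppr_eq0; apply/eqP.
  case: (eqVneq j i) => [ji|_]; last exact: scaler0.
  by rewrite -ji (negbTE ji') scale0r.
- rewrite (linB (aL _)) aM !act_gen_free // !gen_actU.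
  case: x => a /=; case: ifP => // c; rewrite ?(lin0 (@gen_act_linear _)) ?subrr //.
    by rewrite gen_actU /= eqxx subrr.
  by rewrite gen_actU /= eqxx subrr.
- rewrite (linB (aL _)) aM !act_gen_free // !gen_actU.
  case: x => a /=; have [ej|nj] := eqVneq j _;
    rewrite ?(lin0 (@gen_act_linear _)) ?subrr //.
    by rewrite gen_actU /= -ej eqxx subrr.
  by rewrite gen_actU /= -ej eqxx subrr.
- rewrite (linB (aL _)) (linZ (aL _)) aM !act_gen_free // !gen_actU /=.
  have [->|jb] := eqVneq j (range b); last first.
    rewrite (lin0 (@gen_act_linear _)) sub0r; apply/eqP; rewrite oppr_eq0; apply/eqP.
    have [ja|_] := eqVneq j (range a); last exact: scaler0.
    have [ab|_] := eqVneq a b; last exact: scale0r.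
    by move: jb; rewrite -ab ja eqxx.
  rewrite gen_actU /= modnMDl modn_small ?out_index_lt //.
  rewrite divnMDl ?(leq_ltn_trans _ (out_index_lt b)) // divn_small ?out_index_lt //.
  rewrite addn0; have [->|ab] := eqVneq a b; first by rewrite !eqxx scale1r subrr.
  rewrite scale0r subr0; case: ifP => // /andP[/eqP s1 /eqP s2].
  by move: ab; rewrite (out_index_inj s1 s2) eqxx.
- rewrite (linB (aL _)) (lin_sum (aL _)) act_gen_free // gen_actU /=.
  rewrite (eq_bigr (fun a => if (j == i) && (n %% out_deg j == out_index a)%N
                             then << (j, n) >> else 0)); last first.
    move=> a /eqP sa; rewrite aM !act_gen_free // gen_actU /= sa.
    case: ifP => [/andP[/eqP -> /eqP e]|_]; last exact: lin0 (@gen_act_linear _).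
    by rewrite gen_actU /= eqxx sa -e -divn_eq.
  have [->|_] /= := eqVneq j i; last by rewrite big1 ?subr0.
  have di : (0 < out_deg i)%N.
    move: ni; rewrite inE negb_forall => /existsP[a].
    by rewrite negbK => /eqP <-; exact: leq_ltn_trans (out_index_lt a).
  have [a sa ea] := out_indexP (ltn_pmod n di).
  rewrite (eq_bigr (fun b => if b == a then << (i, n) >> else 0)).
    by rewrite (sum_if_eq a (fun b => source b == i) (fun=> << (i, n) >>)) sa eqxx subrr.
  move=> b /eqP sb; rewrite -ea eq_sym; case: (eqVneq b a) => [->|ab]; rewrite ?eqxx //.
  case: eqP => // e; case/eqP: ab; apply: out_index_inj => //.
  by rewrite sa sb.
- rewrite (linB (aL _)) (lin_sum (aL _)) act1.
  rewrite (eq_bigr (fun i => if i == j then << (j, n) >> else 0)).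
    by rewrite (sum_if_eq j predT (fun=> << (j, n) >>)) subrr.
  by move=> i _; rewrite act_gen_free // gen_actU /= eq_sym.
Qed.

Lemma vertex_class_neq0 i : vertex_class i <> 0.
Proof.
move=> /vproj_eq0 /(act_ideal gen_act_linear rel_act) /(_ << (i, 0%N) >>) /eqP.
by rewrite act_gen_free // gen_actU /= eqxx monalgU_eq0 oner_eq0.
Qed.

End Representation.
End LeavittAlgebra.

(** * Hochschild homology of the Leavitt path algebra *)

Section LeavittTheorem.
Variables (k : fieldType) (E : quiver).
Local Notation R := (leavitt k E).

Local Notation P := (@vertex_class k E).
Local Notation A := (@arrow_class k E).
Local Notation S := (@ghost_class k E).

Let LF := leavitt_familyP k E.
Let degE := @leavitt_degE k E.
Let spanE := @words_span_leavitt k E.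
Let delta := @leavitt_delta k E.
Let d_lin : linear delta :=
  derivation_linear (leavitt_class_linear (E := E)) (@leavitt_class_surj k E)
    (@leavitt_der_ker k E).
Let d_der x y : delta (x ** y) = lmul x (delta y) + rmul y (delta x) :=
  derivationM (leavitt_class_linear (E := E)) (@leavitt_classM k E) (leavitt_class1 k E)
    (@leavitt_class_surj k E) (@leavitt_der_ker k E) x y.
Let d_gen x : delta (gen_val P A S x) =
  gen_deriv P A S x.
Proof.
rewrite gen_valE.
rewrite [LHS](derivation_pi (leavitt_class_linear (E := E)) _ (@leavitt_der_ker k E)).
exact: (der_free_gen (leavitt_class1 k E)).
Qed.

Lemma HH_leavitt0 :
  lmod_iso (HH (@leavitt_deg k E) 0 0) (coker (one_minus_Nt_map k E)) /\
  lmod_iso (HH (@leavitt_deg k E) 0 1) (kernel (one_minus_Nt_map k E)).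
Proof.
have l0 := @vertex_ext_linear k R E P.
have l1 := @nonsink_ext_linear k R E P.
have shift := vertex_ext_shift LF.
have inj0 := vertex_ext_inj LF (@vertex_class_neq0 k E).
have inj1 := nonsink_ext_inj LF (@vertex_class_neq0 k E).
have F0 := @vertex_ext_Fil k R E P A S.
have F1 := @nonsink_ext_Fil k R E P A S.
have c0 := vertex_ext_corner LF; have c1 := nonsink_ext_corner LF.
have s0 := vertex_ext_surj LF; have s1 := nonsink_ext_surj LF.
split.
  exact: (HH0_coker LF degE spanE d_lin d_der d_gen l0 shift inj0 F0 F1 c0 c1 s0 s1).
exact: (HH1_kernel LF degE spanE d_lin d_der d_gen l0 l1 shift inj0 inj1 F1 c1 s1).
Qed.

Lemma HH_leavitt_neq0 (m : int) : m != 0 ->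
  lmod_iso (HH (@leavitt_deg k E) m 0) (coker (one_minus_sigma k E `|m|%N)) /\
  lmod_iso (HH (@leavitt_deg k E) m 1) (kernel (one_minus_sigma k E `|m|%N)).
Proof.
move=> m0.
have l0 := @cpath_ext_linear k R E A S m.
have shift := cpath_ext_shift LF (m := m).
have inj0 := cpath_ext_inj LF (@vertex_class_neq0 k E) (m := m).
have F0 := cpath_ext_Fil LF m0.
have c0 u := corner_cpath_ext LF (m := m) u (Q := predT) (fun=> isT).
have c1 u := corner_cpath_ext LF (m := m) u (Q := @nsink E) (@source_nsink E).
have s0 y := cpath_ext_surj LF m0 (Q := predT) (y := y).
have s1 y := cpath_ext_surj LF m0 (Q := @nsink E) (y := y).
split.
  exact: (HH0_coker LF degE spanE d_lin d_der d_gen l0 shift inj0 F0 F0 c0 c1 s0 s1).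
exact: (HH1_kernel LF degE spanE d_lin d_der d_gen l0 l0 shift inj0 inj0 F0 c1 s1).
Qed.

Lemma HH_leavitt_ge2 (m : int) (n : nat) :
  lmod_iso (HH (@leavitt_deg k E) m n.+2) 'cV[k]_0.
Proof. exact: (HH_ge2 LF degE spanE d_lin d_der d_gen). Qed.

End LeavittTheorem.

Theorem theorem4p4 (k : fieldType) (E : quiver) (hE : no_sources E)
    (m : int) (n : nat) :
  lmod_iso (HH (@leavitt_deg k E) m n)
    (match n return lmodType k with
     | 0%N => if m != 0 then coker (one_minus_sigma k E `|m|%N)
              else coker (one_minus_Nt_map k E)
     | 1%N => if m != 0 then kernel (one_minus_sigma k E `|m|%N)
              else kernel (one_minus_Nt_map k E)
     | _ => 'cV[k]_0
     end).
Proof.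
case: n => [|[|n]]; last exact: HH_leavitt_ge2.
  have [->|m0] /= := eqVneq m 0; first by have [] := HH_leavitt0 k E.
  by have [] := HH_leavitt_neq0 k E m0.
have [->|m0] /= := eqVneq m 0; first by have [] := HH_leavitt0 k E.
by have [] := HH_leavitt_neq0 k E m0.
Qed.
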